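(* Let $A$ be a C$^*$-algebra. Then every Jordan derivation from $A$ to a Banach $A$-bimodule is continuous, and every Jordan derivation from $A$ to a Jordan Banach $A$-module is continuous.
   Context: Derivations here are linear maps, not assumed continuous. A Banach $A$-bimodule is a Banach space $X$ which is an $A$-bimodule (bilinear products $(a,x)\mapsto ax$, $(a,x)\mapsto xa$ with $a(bx)=(ab)x$, $a(xb)=(ax)b$, $(xa)b=x(ab)$) with continuous module operations. A Jordan derivation from $A$ to a Banach $A$-bimodule $X$ is a linear map $D:A\to X$ with $D(a^2)=aD(a)+D(a)a$ for all $a\in A$ (equivalently $D(ab+ba)=aD(b)+D(b)a+D(a)b+bD(a)$ for all $a,b\in A$). $A$ is a Jordan algebra under $a\circ b=\frac12(ab+ba)$. For a Jordan algebra $J$, a Jordan $J$-module is a vector space $X$ with bilinear products $(a,x)\mapsto a\circ x$ and $(x,a)\mapsto x\circ a$ into $X$ satisfying, for all $a,b\in J$, $x\in X$: $a\circ x=x\circ a$, $a^2\circ(x\circ a)=(a^2\circ x)\circ a$, and $2((x\circ a)\circ b)\circ a+x\circ(a^2\circ b)=2(x\circ a)\circ(a\circ b)+(x\circ b)\circ a^2$. A Jordan Banach $J$-module is a Jordan $J$-module which is a Banach space with continuous module operation. A Jordan derivation from $J$ to a Jordan Banach $J$-module is a linear map $D$ with $D(a\circ b)=D(a)\circ b+a\circ D(b)$ for all $a,b\in J$. A Jordan Banach $A$-module means one over the Jordan algebra $(A,\circ)$. *)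

(* Defs.v *)
(* MathComp-Analysis; complex scalars are R[i] for R : realType. *)
From HB Require Import structures.
From mathcomp Require Import all_boot all_order all_algebra.
From mathcomp Require Import complex.
From mathcomp Require Import all_classical all_reals all_analysis.

Set Implicit Arguments.
Unset Strict Implicit.
Unset Printing Implicit Defensive.

Import Order.TTheory GRing.Theory Num.Theory.
Import numFieldNormedType.Exports.

Local Open Scope ring_scope.
Local Open Scope complex_scope.

(* A C*-algebra need not be unital, whereas MathComp rings are: the product is
   therefore a bilinear map on a complex Banach space, not a ring structure.
   The norm of a normed module over R[i] takes (nonnegative) values in R[i]. *)
Record cstar_algebra (R : realType) (A : completeNormedModType R[i])
    (mul : {bilinear A -> A -> A}) (star : A -> A) : Prop := CstarAlgebra {
  cstar_mulA : forall a b c, mul a (mul b c) = mul (mul a b) c;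
  cstar_normM : forall a b, `|mul a b| <= `|a| * `|b|;
  cstar_starD : forall a b, star (a + b) = star a + star b;
  cstar_starZ : forall (l : R[i]) a, star (l *: a) = conjc l *: star a;
  cstar_starM : forall a b, star (mul a b) = mul (star b) (star a);
  cstar_starK : forall a, star (star a) = a;
  cstar_normE : forall a, `|mul (star a) a| = `|a| ^+ 2
}.

Record banach_bimodule (R : realType) (A X : completeNormedModType R[i])
    (mul : {bilinear A -> A -> A})
    (lact : {bilinear A -> X -> X}) (ract : {bilinear X -> A -> X}) : Prop :=
  BanachBimodule {
  bimod_lactA : forall a b x, lact a (lact b x) = lact (mul a b) x;
  bimod_lractA : forall a x b, lact a (ract x b) = ract (lact a x) b;
  bimod_ractA : forall x a b, ract (ract x a) b = ract x (mul a b);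
  bimod_lact_cont : continuous (fun p : A * X => lact p.1 p.2);
  bimod_ract_cont : continuous (fun p : X * A => ract p.1 p.2)
}.

Definition bimodule_jordan_derivation (R : realType)
    (A X : completeNormedModType R[i]) (mul : {bilinear A -> A -> A})
    (lact : {bilinear A -> X -> X}) (ract : {bilinear X -> A -> X})
    (D : {linear A -> X}) : Prop :=
  forall a, D (mul a a) = lact a (D a) + ract (D a) a.

Definition jordan_product (R : realType) (A : completeNormedModType R[i])
    (mul : {bilinear A -> A -> A}) (a b : A) : A :=
  2^-1 *: (mul a b + mul b a).

(* [jmul] is meant to be a Jordan product on J; its axioms play no role in the
   definition of a Jordan J-module, so they are not required here. *)
Record jordan_module (R : realType) (J X : lmodType R[i]) (jmul : J -> J -> J)
    (lact : {bilinear J -> X -> X}) (ract : {bilinear X -> J -> X}) : Prop :=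
  JordanModule {
  jmod_comm : forall a x, lact a x = ract x a;
  jmod_jordan : forall a x,
    lact (jmul a a) (ract x a) = ract (lact (jmul a a) x) a;
  jmod_linearized : forall a b x,
    2 *: ract (ract (ract x a) b) a + ract x (jmul (jmul a a) b)
    = 2 *: ract (ract x a) (jmul a b) + ract (ract x b) (jmul a a)
}.

Record jordan_banach_module (R : realType) (J X : completeNormedModType R[i])
    (jmul : J -> J -> J)
    (lact : {bilinear J -> X -> X}) (ract : {bilinear X -> J -> X}) : Prop :=
  JordanBanachModule {
  jbmod_module : jordan_module jmul lact ract;
  jbmod_lact_cont : continuous (fun p : J * X => lact p.1 p.2);
  jbmod_ract_cont : continuous (fun p : X * J => ract p.1 p.2)
}.

Definition jordan_derivation (R : realType) (J X : completeNormedModType R[i])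
    (jmul : J -> J -> J)
    (lact : {bilinear J -> X -> X}) (ract : {bilinear X -> J -> X})
    (D : {linear J -> X}) : Prop :=
  forall a b, D (jmul a b) = ract (D a) b + lact a (D b).

(* Main.v *)
From HB Require Import structures.
Require Import Defs.
From mathcomp Require Import all_boot all_order all_algebra.
From mathcomp Require Import complex.
From mathcomp Require Import all_classical all_reals all_analysis.
From mathcomp Require Import cyclic separable cyclotomic.
From mathcomp Require Import zify ring lra.
Set Implicit Arguments.
Unset Strict Implicit.
Unset Printing Implicit Defensive.
Import Order.TTheory GRing.Theory Num.Theory.
Import numFieldNormedType.Exports.
Local Open Scope ring_scope.
Local Open Scope complex_scope.

(* A bimodule over A is a Jordan module under a.x = (ax + xa)/2, so only Jordan
   modules matter.  Adjoin a unit to A and write L_a for the action of a.  Call a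
   good when L_a D is bounded, and let N be the set of those a for which every
   b a c and b a^* c is good: a closed two-sided *-ideal.

   D is bounded on N: by uniform boundedness |L_z D b| <= C |z| |b| for z in N, so
   D (z o w) = L_z D w + L_w D z is bounded on products, and a self-adjoint element
   of N is a difference of two squares z^2 - w^2 with z, w in N of controlled norm.

   N has finite codimension: a gliding hump shows that among infinitely many
   orthogonal elements of a functional calculus some belong to N, so each
   self-adjoint h satisfies a split real polynomial modulo N.  Hence A/N has no
   infinite orthogonal sequence of projections, its unit is a finite sum of minimal
   projections, and the corners between minimal projections are at most
   one-dimensional. *)

(** * Real norms and bounded linear maps *)

(** The Jordan setting is the obstacle. In a bimodule, one-sided multiplication by a member e_j of
    an orthogonal family isolates one component of D; here only the symmetric actions L_a exist, and
    mixed components f_i y e_j + e_j y f_i escape a single gliding hump. A second hump, along a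
    subsequence, removes them. Nor do good elements form an ideal: the product of a good element
    with an arbitrary b is reached only through intermediate units. Hence the chains f, f1, f2, e of
    functions of one self-adjoint element, each a unit for the one before.

    The quotient by N is never formed. Every statement about it is a membership in N, and
    annihilation by a polynomial with real roots replaces finiteness of the spectrum. The functional
    calculus is likewise built without spectra or characters: a self-adjoint contraction is the real
    part of a unitary, and this bounds real polynomials in it by their supremum on [-1, 1].

    At the end D is bounded on a closed subspace of finite codimension, and the missing dimensions
    are added one at a time. *)

Section ComplexModulus.
Variable R : realType.
Implicit Types (z w : R[i]) (r : R).

Definition cabs z : R := complex.Re `|z|.

Lemma cabsE z : `|z| = (cabs z)%:C.
Proof. by rewrite /cabs normc_def. Qed.

Lemma cabs_ge0 z : 0 <= cabs z.
Proof. by rewrite /cabs normc_def /= sqrtr_ge0. Qed.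

Lemma cabsM z w : cabs (z * w) = cabs z * cabs w.
Proof.
by apply: (@complexI R); rewrite rmorphM /= -!cabsE normrM.
Qed.

Lemma cabsD z w : cabs (z + w) <= cabs z + cabs w.
Proof.
have := ler_normD z w; rewrite !cabsE -rmorphD /= lecE /=.
by case/andP.
Qed.

Lemma cabs_real r : cabs r%:C = `|r|.
Proof. by apply: (@complexI R); rewrite -cabsE normc_def /= expr0n addr0 sqrtr_sqr. Qed.

Lemma cabs_nneg r : 0 <= r -> cabs r%:C = r.
Proof. by move=> r0; rewrite cabs_real ger0_norm. Qed.

Lemma cabs1 : cabs 1 = 1.
Proof. by rewrite (cabs_real 1) normr1. Qed.

Lemma cabs0 : cabs 0 = 0.
Proof. by rewrite (cabs_real 0) normr0. Qed.

Lemma cabsN1 : cabs (-1) = 1.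
Proof. by apply: (@complexI R); rewrite -cabsE normrN1. Qed.

Lemma cabs_eq0 z : cabs z = 0 -> z = 0.
Proof. by move=> h; apply/eqP; rewrite -normr_eq0 cabsE h. Qed.

Lemma cabsX z n : cabs (z ^+ n) = cabs z ^+ n.
Proof.
elim: n => [|n IH]; first by rewrite !expr0 cabs1.
by rewrite !exprS cabsM IH.
Qed.

Lemma cabsJ z : cabs z^*%C = cabs z.
Proof. by rewrite /cabs normcJ. Qed.

Lemma cabs_half : cabs (2^-1 : R[i]) = 2^-1.
Proof.
have -> : 2^-1 = (2^-1 : R)%:C by rewrite rmorphV ?unitfE ?pnatr_eq0 // rmorph_nat.
by rewrite cabs_nneg // invr_ge0.
Qed.

Lemma conj_half : (2^-1 : R[i])^*%C = 2^-1.
Proof.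
have -> : 2^-1 = (2^-1 : R)%:C by rewrite rmorphV ?unitfE ?pnatr_eq0 // rmorph_nat.
exact: conjc_real.
Qed.

Lemma cabs_i : cabs ('i : R[i]) = 1.
Proof. by rewrite /cabs normc_def /= expr0n add0r expr1n sqrtr1. Qed.

Lemma mul_ii : 'i * 'i = -1 :> R[i].
Proof. by rewrite -expr2 sqr_i. Qed.

Lemma conj_i : 'i^*%C = - 'i :> R[i].
Proof. by apply/eqP; rewrite eq_complex /= oppr0 !eqxx. Qed.

End ComplexModulus.

(** Norms are bare real-valued functions: [unit_norm] on the unitization then needs no normed-module
    instance, and all estimates stay in real arithmetic. *)
Record is_norm (R : realType) (V : lmodType R[i]) (n : V -> R) : Prop := IsNorm {
  nrmD : forall x y, n (x + y) <= n x + n y;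
  nrmZ : forall c x, n (c *: x) = cabs c * n x;
  nrm_eq0 : forall x, n x = 0 -> x = 0 }.

Definition cauchy_for (R : realType) (V : lmodType R[i]) (n : V -> R) (u : nat -> V) :=
  forall e, 0 < e -> exists N, forall m k, (N <= m)%N -> (N <= k)%N -> n (u m - u k) <= e.

Definition tends (R : realType) (V : lmodType R[i]) (n : V -> R) (u : nat -> V) l :=
  forall e, 0 < e -> exists N, forall k, (N <= k)%N -> n (u k - l) <= e.

Definition complete_for (R : realType) (V : lmodType R[i]) (n : V -> R) :=
  forall u, cauchy_for n u -> exists l, tends n u l.

(** Linearity is unbundled because most operators below are anonymous sums and composites. *)
Definition lin (K : pzRingType) (V W : lmodType K) (f : V -> W) :=
  (forall x y, f (x + y) = f x + f y) /\ (forall c x, f (c *: x) = c *: f x).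

Definition bounded (R : realType) (V W : lmodType R[i]) (nV : V -> R) (nW : W -> R)
    (f : V -> W) := exists2 C, 0 <= C & forall x, nW (f x) <= C * nV x.

Section Lin.
Variables (K : pzRingType) (V W U : lmodType K).
Implicit Types f g : V -> W.

Lemma lin0 f : lin f -> f 0 = 0.
Proof. by move=> [_ fZ]; rewrite -(scale0r (0 : V)) fZ scale0r. Qed.

Lemma linN f x : lin f -> f (- x) = - f x.
Proof. by move=> [_ fZ]; rewrite -scaleN1r fZ scaleN1r. Qed.

Lemma linB f x y : lin f -> f (x - y) = f x - f y.
Proof. by move=> lf; case: (lf) => fD _; rewrite fD linN. Qed.

Lemma lin_sum f I (r : seq I) (F : I -> V) : lin f ->
  f (\sum_(i <- r) F i) = \sum_(i <- r) f (F i).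
Proof.
move=> lf; elim: r => [|i r IH]; first by rewrite !big_nil lin0.
by rewrite !big_cons; case: (lf) => -> _; rewrite IH.
Qed.

Lemma lin_comp f (g : U -> V) : lin f -> lin g -> lin (fun x => f (g x)).
Proof. by move=> [fD fZ] [gD gZ]; split=> [x y|c x]; rewrite ?gD ?fD ?gZ ?fZ. Qed.

Lemma lin_add f g : lin f -> lin g -> lin (fun x => f x + g x).
Proof.
move=> [fD fZ] [gD gZ]; split=> [x y|c x]; first by rewrite fD gD addrACA.
by rewrite fZ gZ scalerDr.
Qed.

End Lin.

Section Norms.
Variables (R : realType) (V : lmodType R[i]) (n : V -> R).
Hypothesis nP : is_norm n.

Lemma nrm0 : n 0 = 0.
Proof. by rewrite -(scale0r (0 : V)) (nrmZ nP) cabs0 mul0r. Qed.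

Lemma nrmN x : n (- x) = n x.
Proof. by rewrite -scaleN1r (nrmZ nP) cabsN1 mul1r. Qed.

Lemma nrm_ge0 x : 0 <= n x.
Proof. by have := nrmD nP x (- x); rewrite subrr nrm0 nrmN; lra. Qed.

Lemma nrmB x y : n (x - y) <= n x + n y.
Proof. by rewrite -(nrmN y); apply: nrmD. Qed.

Lemma nrmC x y : n (x - y) = n (y - x).
Proof. by rewrite -nrmN opprB. Qed.

Lemma nrm_dist3 z x y : n (x - y) <= n (x - z) + n (z - y).
Proof. by have := nrmD nP (x - z) (z - y); rewrite addrA subrK. Qed.

Lemma nrm_near x y : n x <= n y + n (x - y).
Proof. by have := nrmD nP y (x - y); rewrite addrC subrK. Qed.

Lemma nrmZr (r : R) x : n (r%:C *: x) = `|r| * n x.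
Proof. by rewrite (nrmZ nP) cabs_real. Qed.

Lemma nrm_gt0 x : x <> 0 -> 0 < n x.
Proof.
move=> x0; rewrite lt_neqAle nrm_ge0 andbT; apply/eqP => /esym h.
by apply: x0; apply: (nrm_eq0 nP).
Qed.

Lemma nrm_le_eps x r : (forall e, 0 < e -> n x <= r + e) -> n x <= r.
Proof. by move=> h; apply/ler_addgt0Pr. Qed.

Lemma nrm_small0 x : (forall e, 0 < e -> n x <= e) -> x = 0.
Proof.
move=> h; apply: (nrm_eq0 nP); apply/eqP; rewrite eq_le nrm_ge0 andbT.
by apply/ler_addgt0Pr => e /h; rewrite add0r.
Qed.

Lemma tends_le u l x r N : tends n u l ->
  (forall k, (N <= k)%N -> n (u k - x) <= r) -> n (l - x) <= r.
Proof.
move=> ul h; apply: nrm_le_eps => e /ul [M hM].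
have := nrm_dist3 (u (maxn N M)) l x.
have := h _ (leq_maxl N M); have := hM _ (leq_maxr N M).
rewrite (nrmC _ l); lra.
Qed.

Lemma tends_uniq u l l' : tends n u l -> tends n u l' -> l = l'.
Proof.
move=> h h'; apply/eqP; rewrite -subr_eq0; apply/eqP; apply: nrm_small0 => e /h' [N hN].
exact: tends_le h hN.
Qed.

(** By telescoping, [u] is Cauchy as soon as [s] converges to [S]. A general majorant is allowed
    because [dom_seq] converges more slowly than any geometric sequence. *)
Lemma tends_dominated (s : nat -> R) S (u : nat -> V) : complete_for n ->
  (forall k, s k <= S) -> (forall e, 0 < e -> exists N, S - s N <= e) ->
  (forall k, n (u k.+1 - u k) <= s k.+1 - s k) ->
  exists2 l, tends n u l & forall k, n (l - u k) <= S - s k.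
Proof.
move=> cV sS sl h.
have sm k m : s k <= s (k + m)%N.
  elim: m => [|m IH]; first by rewrite addn0.
  by apply: le_trans IH _; rewrite addnS; have := h (k + m)%N; have := nrm_ge0 (u (k+m).+1 - u (k+m)); lra.
have hd k m : n (u (k + m)%N - u k) <= s (k + m)%N - s k.
  elim: m => [|m IH]; first by rewrite addn0 !subrr nrm0.
  rewrite addnS; have := h (k + m)%N; have := nrm_dist3 (u (k + m)%N) (u (k + m).+1) (u k).
  lra.
have hS k m : (k <= m)%N -> n (u m - u k) <= S - s k.
  by move=> km; rewrite -(subnKC km); have := hd k (m - k)%N; have := sS (k + (m - k))%N; lra.
have [l ul] : exists l, tends n u l.
  apply: cV => e e0; have [|N hN] := sl (e / 2); first by rewrite divr_gt0.
  exists N => m k mN kN.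
  have := hS _ _ mN; have := hS _ _ kN; have := nrm_dist3 (u N) (u m) (u k).
  rewrite (nrmC (u N)); lra.
by exists l => // k; apply: (tends_le (N := k) ul) => m; apply: hS.
Qed.

Lemma half_pow_small (e : R) : 0 < e -> exists N, 2^-1 ^+ N <= e.
Proof.
move=> e0; have : 0 <= e^-1 by rewrite invr_ge0 ltW.
move=> /archi_boundP; set N := Num.bound _ => h; exists N.
have h2 : (N%:R : R) <= 2 ^+ N by rewrite -natrX ler_nat ltnW // ltn_expl.
rewrite exprVn -[e]invrK lef_pV2 ?posrE ?invr_gt0 ?exprn_gt0 //.
exact: ltW (lt_le_trans h h2).
Qed.

Lemma tends_geometric (u : nat -> V) : complete_for n ->
  (forall k, n (u k.+1 - u k) <= 2^-1 ^+ k) ->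
  exists l, tends n u l.
Proof.
move=> cV h.
(* The majorant [- (2 * 2^-1 ^+ k)] has supremum 0 and increments exactly [2^-1 ^+ k]. *)
have [|e e0||l ? _] := @tends_dominated (fun k => - (2 * 2^-1 ^+ k)) 0 u cV.
- by move=> k; rewrite oppr_le0 mulr_ge0 ?exprn_ge0 ?invr_ge0.
- have [|N hN] := @half_pow_small (e/2); first by rewrite divr_gt0.
  by exists N; lra.
- by move=> k; apply: le_trans (h k) _; rewrite exprS; lra.
by exists l.
Qed.

End Norms.

Section Bounded.
Variables (R : realType) (V W U : lmodType R[i]).
Variables (nV : V -> R) (nW : W -> R) (nU : U -> R).
Hypotheses (nVP : is_norm nV) (nWP : is_norm nW) (nUP : is_norm nU).

Lemma bounded_comp (f : W -> U) (g : V -> W) :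
  bounded nW nU f -> bounded nV nW g -> bounded nV nU (fun x => f (g x)).
Proof.
move=> [C C0 hC] [D D0 hD]; exists (C * D); first exact: mulr_ge0.
by move=> x; rewrite -mulrA; apply: le_trans (hC _) _; apply: ler_wpM2l.
Qed.

Lemma bounded_add (f g : V -> W) :
  bounded nV nW f -> bounded nV nW g -> bounded nV nW (fun x => f x + g x).
Proof.
move=> [C C0 hC] [D D0 hD]; exists (C + D); first exact: addr_ge0.
by move=> x; rewrite mulrDl; apply: le_trans (nrmD nWP _ _) _; apply: lerD.
Qed.

Lemma bounded_scale c (f : V -> W) :
  bounded nV nW f -> bounded nV nW (fun x => c *: f x).
Proof.
move=> [C C0 hC]; exists (cabs c * C); first by rewrite mulr_ge0 ?cabs_ge0.
by move=> x; rewrite (nrmZ nWP) -mulrA ler_wpM2l ?cabs_ge0.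
Qed.

Lemma bounded_opp (f : V -> W) :
  bounded nV nW f -> bounded nV nW (fun x => - f x).
Proof. by move=> [C C0 hC]; exists C => // x; rewrite (nrmN nWP). Qed.

Lemma bounded_sub (f g : V -> W) :
  bounded nV nW f -> bounded nV nW g -> bounded nV nW (fun x => f x - g x).
Proof. by move=> bf bg; apply: bounded_add bf (bounded_opp bg). Qed.

Lemma bounded_ext (f g : V -> W) :
  (forall x, f x = g x) -> bounded nV nW f -> bounded nV nW g.
Proof. by move=> e [C C0 hC]; exists C => // x; rewrite -e. Qed.

Lemma bounded0 : bounded nV nW (fun=> 0).
Proof. by exists 0 => // x; rewrite mul0r (nrm0 nWP). Qed.

Lemma bounded_tends (f : V -> W) u l : lin f -> bounded nV nW f ->
  tends nV u l -> tends nW (fun k => f (u k)) (f l).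
Proof.
move=> lf [C C0 hC] ul e e0.
have [|N hN] := ul (e / (C + 1)); first by rewrite divr_gt0 // ltr_wpDl.
exists N => k /hN h; rewrite -linB //; apply: le_trans (hC _) _.
have := nrm_ge0 nVP (u k - l).
rewrite ler_pdivlMr in h; last by rewrite ltr_wpDl.
nra.
Qed.

Lemma unbounded_large (f : V -> W) (d M : R) : lin f -> ~ bounded nV nW f ->
  0 < d -> exists2 v, nV v <= d & M <= nW (f v).
Proof.
move=> lf uf d0; apply: contrapT => h; apply: uf.
have hM v : nV v <= d -> nW (f v) < M.
  by move=> vd; rewrite ltNge; apply/negP => ?; apply: h; exists v.
have M0 : 0 < M.
  have := hM 0; rewrite (nrm0 nVP) => /(_ (ltW d0)).
  by apply: le_lt_trans; apply: nrm_ge0.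
exists (M / d); first by rewrite divr_ge0 ?ltW.
move=> x; have [->|x0] := eqVneq x 0.
  by rewrite (lin0 lf) (nrm0 nWP) (nrm0 nVP) mulr0.
have nx : 0 < nV x by apply: (nrm_gt0 nVP); apply/eqP.
have q0 : 0 <= d / nV x by rewrite divr_ge0 ?ltW.
have := hM ((d / nV x)%:C *: x).
rewrite (nrmZr nVP) (ger0_norm q0) divfK ?gt_eqF // => /(_ (lexx _)).
case: (lf) => _ ->; rewrite (nrmZr nWP) (ger0_norm q0).
move=> /ltW; rewrite mulrAC ler_pdivrMr // mulrAC ler_pdivlMr //.
by rewrite mulrC.
Qed.

End Bounded.

(** * Deciding linear identities *)

Section LinearCombination.
Variables (K : comPzRingType) (V : lmodType K).

(** Reflection syntax for linear combinations; an atom is its position in an environment, and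
    coefficients stay symbolic so that [field] can compare them. *)
Inductive lcomb :=
  | LVar of nat | LZero | LAdd of lcomb & lcomb | LOpp of lcomb | LScale of K & lcomb.

Fixpoint lcomb_eval (env : seq V) t : V :=
  match t with
  | LVar i => env`_i
  | LZero => 0
  | LAdd t1 t2 => lcomb_eval env t1 + lcomb_eval env t2
  | LOpp t1 => - lcomb_eval env t1
  | LScale c t1 => c *: lcomb_eval env t1
  end.

Fixpoint lcomb_coef (i : nat) t : K :=
  match t with
  | LVar j => if i == j then 1 else 0
  | LZero => 0
  | LAdd t1 t2 => lcomb_coef i t1 + lcomb_coef i t2
  | LOpp t1 => - lcomb_coef i t1
  | LScale c t1 => c * lcomb_coef i t1
  end.

(** Recursion on [n] instead of a quantifier, so that simplification produces one scalar equation
    per atom. *)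
Fixpoint lcomb_agree n t1 t2 : Prop :=
  if n is m.+1 then lcomb_coef m t1 = lcomb_coef m t2 /\ lcomb_agree m t1 t2 else True.

Lemma lcomb_evalE env t :
  lcomb_eval env t = \sum_(i < size env) lcomb_coef i t *: env`_i.
Proof.
elim: t => /= [j||t1 -> t2 ->|t ->|c t ->].
- have [jn|nj] := ltnP j (size env); last first.
    rewrite nth_default // big1 // => i _; case: eqP => [e|_]; rewrite ?scale0r //.
    by have := ltn_ord i; rewrite e ltnNge nj.
  rewrite (bigD1 (Ordinal jn)) //= eqxx scale1r big1 ?addr0 // => i.
  by rewrite -val_eqE /= => /negbTE ->; rewrite scale0r.
- by rewrite big1 // => i _; rewrite scale0r.
- by rewrite -big_split; apply: eq_bigr => i _; rewrite scalerDl.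
- by rewrite -sumrN; apply: eq_bigr => i _; rewrite scaleNr.
- by rewrite scaler_sumr; apply: eq_bigr => i _; rewrite scalerA.
Qed.

Lemma lcomb_eq env t1 t2 :
  lcomb_agree (size env) t1 t2 -> lcomb_eval env t1 = lcomb_eval env t2.
Proof.
move=> h; rewrite !lcomb_evalE; apply: eq_bigr => -[i /= +] _.
elim: (size env) h => //= n IH [e h]; rewrite ltnS leq_eqVlt => /predU1P[->|/(IH h)//].
by rewrite e.
Qed.

End LinearCombination.

(** Typing [erefl x : x = y] identifies atoms up to conversion, not only syntactically. *)
Ltac lc_index x l :=
  lazymatch l with
  | nil => constr:(0%N)
  | cons ?y ?l' =>
    match constr:(tt) with
    | _ => let _ := constr:(erefl x : x = y) in constr:(0%N)
    | _ => let n := lc_index x l' in constr:(S n)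
    end
  end.

Ltac lc_mem x l :=
  lazymatch l with
  | nil => constr:(false)
  | cons ?y ?l' =>
    match constr:(tt) with
    | _ => let _ := constr:(erefl x : x = y) in constr:(true)
    | _ => lc_mem x l'
    end
  end.

Ltac lc_atoms t l :=
  lazymatch t with
  | (0)%R => l
  | (?a + ?b)%R => let l1 := lc_atoms a l in lc_atoms b l1
  | (- ?a)%R => lc_atoms a l
  | (_ *: ?a)%R => lc_atoms a l
  | _ => let m := lc_mem t l in
         lazymatch m with true => l | false => constr:(cons t l) end
  end.

Ltac lc_quote K t l :=
  lazymatch t with
  | (0)%R => constr:(@LZero K)
  | (?a + ?b)%R =>
    let a' := lc_quote K a l in let b' := lc_quote K b l in constr:(@LAdd K a' b')
  | (- ?a)%R => let a' := lc_quote K a l in constr:(@LOpp K a')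
  | (?c *: ?a)%R => let a' := lc_quote K a l in constr:(@LScale K c a')
  | _ => let n := lc_index t l in constr:(@LVar K n)
  end.

(* Equalities of linear combinations in an lmodType, reduced to the equality of
   the coefficient of each atom. *)
Ltac lmod_eq K :=
  lazymatch goal with
  | |- @eq ?V ?s ?t =>
    let l0 := constr:(@nil V) in
    let l1 := lc_atoms s l0 in let l2 := lc_atoms t l1 in
    let s' := lc_quote K s l2 in let t' := lc_quote K t l2 in
    apply: (@lcomb_eq K _ l2 s' t'); rewrite /=;
    repeat (split; [try by [|field]|]); try exact: I
  end.

Ltac algebra_eq K :=
  rewrite ?(mulrDl, mulrDr, mulNr, mulrN, =^~ scalerAl, =^~ scalerAr, mulrA);
  lmod_eq K.

Definition jprod (R : realType) (E : algType R[i]) (a b : E) : E := 2^-1 *: (a * b + b * a).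

(** * Uniform boundedness and the gliding hump *)

Section UniformBoundedness.
Variables (R : realType) (E X : lmodType R[i]) (nE : E -> R) (nX : X -> R).
Hypotheses (nEP : is_norm nE) (nXP : is_norm nX) (cE : complete_for nE).

(** Since [2 f v = f (x + v) - f (x - v)], one sign of [v] makes the image at [x] plus or minus [v]
    at least as large as that of [v], whatever [x] is. This takes the place of Baire category. *)
Lemma plus_or_minus (f : E -> X) x v : lin f -> exists2 w, w = v \/ w = - v &
  nX (f v) <= nX (f (x + w)).
Proof.
move=> lf; have h : 2 * nX (f v) <= nX (f (x + v)) + nX (f (x - v)).
  have := nrmB nXP (f (x + v)) (f (x - v)); rewrite -linB //.
  have -> : x + v - (x - v) = (2%:R : R)%:C *: v by rewrite rmorph_nat; lmod_eq (R[i]).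
  by case: (lf) => _ ->; rewrite (nrmZr nXP) normr_nat.
have [h1|h1] := leP (nX (f v)) (nX (f (x + v))); first by exists v => //; left.
by exists (- v); [right|lra].
Qed.

(** Banach-Steinhaus on a closed subspace given as a predicate. If the conclusion fails, there are
    nested balls centred in [N] such that on the k-th one some [F i] has norm at least k; their
    common point violates pointwise boundedness. *)
Theorem uniform_boundedness (N : E -> Prop) (I : Type) (F : I -> E -> X) :
  N 0 -> (forall x y, N x -> N y -> N (x + y)) -> (forall c x, N x -> N (c *: x)) ->
  (forall u l, (forall k, N (u k)) -> tends nE u l -> N l) ->
  (forall i, lin (F i)) ->
  (forall i, exists2 C, 0 <= C & forall z, N z -> nX (F i z) <= C * nE z) ->
  (forall z, N z -> exists C, forall i, nX (F i z) <= C) ->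
  exists2 C, 0 <= C & forall i z, N z -> nX (F i z) <= C * nE z.
Proof.
move=> N0 ND NZ Ncl Flin Fb Fp.
apply: contrapT => hn.
have large (M r : R) : 0 < r -> exists i, exists v, [/\ N v, nE v <= r & M <= nX (F i v)].
  move=> r0; apply: contrapT => h; apply: hn.
  pose M' := Num.max M 0.
  have M'0 : 0 <= M' by rewrite le_max lexx orbT.
  exists (M' / r) => [|i z Nz]; first by rewrite divr_ge0 // ltW.
  have [->|z0] := eqVneq z 0; first by rewrite (lin0 (Flin i)) (nrm0 nXP) (nrm0 nEP) mulr0.
  have nz : 0 < nE z by apply: (nrm_gt0 nEP); apply/eqP.
  have q0 : 0 <= r / nE z by rewrite divr_ge0 // ltW.
  have : nX (F i ((r / nE z)%:C *: z)) < M'.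
    rewrite lt_max ltNge; apply/orP; left; apply/negP => hM; apply: h.
    exists i, ((r / nE z)%:C *: z); split=> //; first exact: NZ.
    by rewrite (nrmZr nEP) (ger0_norm q0) divfK ?gt_eqF.
  case: (Flin i) => _ ->; rewrite (nrmZr nXP) (ger0_norm q0) => /ltW.
  by rewrite mulrAC ler_pdivrMr // mulrAC ler_pdivlMr // mulrC.
(* A pair is a ball, centre and radius. The conditions on [p] come after the existential, so that
   [choice] yields a total function to iterate. *)
have step k (p : E * R) : exists q : E * R, N p.1 -> 0 < p.2 ->
    [/\ N q.1, 0 < q.2, q.2 <= p.2 / 2, nE (q.1 - p.1) <= p.2 / 2 &
     exists i, forall y, N y -> nE (y - q.1) <= q.2 -> k%:R <= nX (F i y)].
  have [[Np p0]|np] := pselect (N p.1 /\ 0 < p.2); last first.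
    by exists p => ? ?; case: np.
  have [|i [v [Nv vr hv]]] := large (k%:R + 1) (p.2 / 2); first by rewrite divr_gt0.
  have [w vw hw] := plus_or_minus p.1 v (Flin i).
  have [C C0 hC] := Fb i.
  have wr : nE w <= p.2 / 2 by case: vw => ->; rewrite ?(nrmN nEP).
  have Nw : N w by case: vw => -> //; rewrite -scaleN1r; apply: NZ.
  (* The radius [(C + 1)^-1] lets [F i] vary by at most 1 over the new ball, which is why the value
     [k + 1] was requested for [v]. *)
  exists (p.1 + w, Num.min (p.2 / 2) (C + 1)^-1) => _ _ /=; split=> //.
  - exact: ND.
  - by rewrite lt_min divr_gt0 // invr_gt0 ltr_wpDl.
  - by rewrite ge_min lexx.
  - by rewrite addrC addKr.
  exists i => y Ny; rewrite le_min => /andP[_ hy].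
  have : nX (F i (y - (p.1 + w))) <= 1.
    have Nd : N (y - (p.1 + w)) by apply: (ND) => //; rewrite -scaleN1r; apply: NZ; apply: ND.
    apply: le_trans (hC _ Nd) _; rewrite -[1](@mulfV _ (C + 1)) ?gt_eqF ?ltr_wpDl //.
    apply: ler_pM => //; first exact: nrm_ge0.
    by rewrite lerDl.
  rewrite linB // (nrmC nXP) => h1.
  have := nrm_near nXP (F i (p.1 + w)) (F i y); lra.
have [g hg] := choice (fun kp : nat * (E * R) => step kp.1 kp.2).
pose p := fix p k := if k is j.+1 then g (j, p j) else (0, 1) : E * R.
have inv k : N (p k).1 /\ 0 < (p k).2.
  elim: k => [|k [IH1 IH2]] //=.
  by have [] := hg (k, p k) IH1 IH2.
have st k := hg (k, p k) (inv k).1 (inv k).2.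
have hr k : (p k).2 <= 2^-1 ^+ k.
  elim: k => [|k IH] //=; have [_ _ h _ _] := st k.
  by apply: le_trans h _; rewrite exprSr ler_pM2r ?invr_gt0.
have [|l hl] := @tends_geometric R E nE nEP (fun k => (p k).1) cE.
  move=> k; have [_ _ _ h _] := st k; apply: le_trans h _.
  by have := hr k; have := (inv k).2; lra.
have Nl : N l by apply: Ncl hl => k; case: (inv k).
have dist k m : nE ((p (k + m)%N).1 - (p k).1) <= (p k).2 - (p (k + m)%N).2.
  elim: m => [|m IH]; first by rewrite addn0 !subrr (nrm0 nEP).
  have [_ _ h1 h2 _] := st (k + m)%N; rewrite addnS /=.
  have := nrm_dist3 nEP (p (k + m)%N).1 (g (k + m, p (k + m))%N).1 (p k).1.
  by move: h1 h2 => /=; lra.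
have dl k : nE (l - (p k).1) <= (p k).2.
  apply: (tends_le (N := k) nEP hl) => m km.
  by rewrite -(subnKC km); have := dist k (m - k)%N; have := (inv (k + (m - k))%N).2; lra.
have [C hC] := Fp _ Nl.
have [_ _ _ _ [i hi]] := st (Num.bound C).
have := le_trans (hi _ Nl (dl (Num.bound C).+1)) (hC i).
rewrite leNgt => /negP; apply.
have [C_ge0|C_lt0] := leP 0 C; first exact: archi_boundP.
exact: lt_le_trans C_lt0 _.
Qed.

Section GlidingHump.
Variable D : E -> X.
Hypothesis Dlin : lin D.

(* For such a pair, M' o D is bounded if and only if D o M is. *)
Record intertwined (M : E -> E) (M' : X -> X) : Prop := Intertwined {
  itw_lin : lin M;
  itw_lin' : lin M';
  itw_bounded : bounded nE nE M;
  itw_bounded' : bounded nX nX M';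
  itw_comm : bounded nE nX (fun x => D (M x) - M' (D x)) }.

Lemma itw_comp M M' P P' : intertwined M M' -> intertwined P P' ->
  intertwined (fun x => M (P x)) (fun x => M' (P' x)).
Proof.
move=> hM hP; split.
- exact: lin_comp (itw_lin hM) (itw_lin hP).
- exact: lin_comp (itw_lin' hM) (itw_lin' hP).
- exact: bounded_comp (itw_bounded hM) (itw_bounded hP).
- exact: bounded_comp (itw_bounded' hM) (itw_bounded' hP).
apply: (bounded_ext (f := fun x => (D (M (P x)) - M' (D (P x))) + M' (D (P x) - P' (D x)))).
  by move=> x; rewrite (linB _ _ (itw_lin' hM)) addrA subrK.
apply: (bounded_add nXP).
  exact: bounded_comp (itw_comm hM) (itw_bounded hP).
exact: bounded_comp (itw_bounded' hM) (itw_comm hP).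
Qed.

Lemma itw_add M M' P P' : intertwined M M' -> intertwined P P' ->
  intertwined (fun x => M x + P x) (fun x => M' x + P' x).
Proof.
move=> hM hP; split.
- exact: lin_add (itw_lin hM) (itw_lin hP).
- exact: lin_add (itw_lin' hM) (itw_lin' hP).
- exact: (bounded_add nEP (itw_bounded hM) (itw_bounded hP)).
- exact: (bounded_add nXP (itw_bounded' hM) (itw_bounded' hP)).
apply: (bounded_ext (f := fun x => (D (M x) - M' (D x)) + (D (P x) - P' (D x)))).
  by move=> x; case: Dlin => -> _; rewrite opprD addrACA.
exact: (bounded_add nXP (itw_comm hM) (itw_comm hP)).
Qed.

Lemma itw_scale (c : R[i]) M M' : intertwined M M' ->
  intertwined (fun x => c *: M x) (fun x => c *: M' x).
Proof.
move=> hM; have lc (V : lmodType R[i]) : lin (fun x : V => c *: x).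
  by split=> [x y|a x]; rewrite ?scalerDr // !scalerA mulrC.
split.
- exact: lin_comp (lc _) (itw_lin hM).
- exact: lin_comp (lc _) (itw_lin' hM).
- exact: (bounded_scale nEP c (itw_bounded hM)).
- exact: (bounded_scale nXP c (itw_bounded' hM)).
apply: (bounded_ext (f := fun x => c *: (D (M x) - M' (D x)))).
  by move=> x; case: Dlin => _ ->; rewrite scalerBr.
exact: (bounded_scale nXP c (itw_comm hM)).
Qed.

Lemma itw_sub M M' P P' : intertwined M M' -> intertwined P P' ->
  intertwined (fun x => M x - P x) (fun x => M' x - P' x).
Proof.
move=> hM hP.
have [] := itw_add hM (itw_scale (-1) hP).
move=> l l' b b' cm; split.
- by case: l => lD lZ; split=> [x y|c x]; rewrite -!(scaleN1r (P _)) ?lD ?lZ.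
- by case: l' => lD lZ; split=> [x y|c x]; rewrite -!(scaleN1r (P' _)) ?lD ?lZ.
- by apply: bounded_ext b => x; rewrite scaleN1r.
- by apply: bounded_ext b' => x; rewrite scaleN1r.
by apply: bounded_ext cm => x; rewrite !scaleN1r.
Qed.

(** Small vectors [V j v] are summed to [c]; when [D (T j (V j _))] is unbounded, [v] is chosen so
    that [D (T j _)] has norm at least [j (B j + 1)] at the partial sum, a sign absorbing the
    earlier terms. The later terms are killed by [T j], so [T j c] is the value at that partial sum.
    Intertwining bounds [D (T j c)] by [B j (|c| + |D c|)], hence such a [j] is at most
    [|c| + |D c|]. *)
Theorem gliding_hump (T V : nat -> E -> E) (T' V' : nat -> X -> X) :
  (forall j, intertwined (T j) (T' j)) -> (forall j, intertwined (V j) (V' j)) ->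
  (forall i j x, (i < j)%N -> T i (V j x) = 0) ->
  exists N, forall j, (N <= j)%N -> bounded nE nX (fun x => T' j (V' j (D x))).
Proof.
move=> hT hV TV0.
pose bad j := ~ bounded nE nX (fun x => D (T j (V j x))).
have cst j : exists B, [/\ 0 <= B, forall x, nX (D (T j x) - T' j (D x)) <= B * nE x
    & forall y, nX (T' j y) <= B * nX y].
  have [K K0 hK] := itw_comm (hT j); have [C C0 hC] := itw_bounded' (hT j).
  exists (K + C); split; first exact: addr_ge0.
    by move=> x; apply: le_trans (hK x) _; rewrite ler_wpM2r ?nrm_ge0 ?lerDl.
  by move=> x; apply: le_trans (hC x) _; rewrite ler_wpM2r ?nrm_ge0 ?lerDr.
have [B hB] := choice cst.
have step (jx : nat * E) : exists v, nE (V jx.1 v) <= 2^-1 ^+ jx.1 /\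
    (bad jx.1 -> jx.1%:R * (B jx.1 + 1) <= nX (D (T jx.1 (jx.2 + V jx.1 v)))).
  case: jx => j x /=; have [bj|nbj] := pselect (bad j); last first.
    by exists 0; rewrite (lin0 (itw_lin (hV j))) (nrm0 nEP) exprn_ge0 ?invr_ge0.
  have [C C0 hC] := itw_bounded (hV j).
  have lDT : lin (fun x => D (T j x)) := lin_comp Dlin (itw_lin (hT j)).
  have lDTV : lin (fun x => D (T j (V j x))) := lin_comp lDT (itw_lin (hV j)).
  have d0 : 0 < 2^-1 ^+ j / (C + 1) by rewrite divr_gt0 ?exprn_gt0 ?invr_gt0 // ltr_wpDl.
  have [v vd hv] := unbounded_large nEP nXP (j%:R * (B j + 1)) lDTV bj d0.
  have sm : nE (V j v) <= 2^-1 ^+ j.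
    apply: le_trans (hC v) _; rewrite ler_pdivlMr in vd; last by rewrite ltr_wpDl.
    have := nrm_ge0 nEP v; nra.
  have [w [->|->] hw] := plus_or_minus x (V j v) lDT.
    by exists v; split=> // _; apply: le_trans hv hw.
  exists (- v); rewrite (linN v (itw_lin (hV j))) (nrmN nEP); split=> // _.
  exact: le_trans hv hw.
have [v hv] := choice step.
pose x := fix x k := if k is j.+1 then x j + V j (v (j, x j)) else 0.
have [|c hc] := @tends_geometric R E nE nEP x cE.
  by move=> k /=; rewrite addrC addKr; case: (hv (k, x k)).
have Tc j : T j c = T j (x j.+1).
  have e m : T j (x (j.+1 + m)%N) = T j (x j.+1).
    elim: m => [|m IH]; first by rewrite addn0.
    rewrite addnS /= ; case: (itw_lin (hT j)) => TD _; rewrite TD TV0 ?addr0 ?IH //.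
    by rewrite addSn ltnS leq_addr.
  apply: (tends_uniq nEP (bounded_tends nEP (itw_lin (hT j)) (itw_bounded (hT j)) hc)).
  move=> eps e0; exists j.+1 => k jk; rewrite -(subnKC jk) e subrr (nrm0 nEP).
  exact: ltW.
have badN j : bad j -> j%:R <= nE c + nX (D c).
  move=> bj; have [_ /(_ bj)] := hv (j, x j); rewrite /= -[x j + _]/(x j.+1) -Tc.
  have [B0 h1 h2] := hB j; have := h1 c; have := h2 (D c).
  have := nrm_near nXP (D (T j c)) (T' j (D c)) => h3 h4 h5 h6.
  have h7 : j%:R * (B j + 1) <= (nE c + nX (D c)) * (B j + 1).
    have := nrm_ge0 nEP c; have := nrm_ge0 nXP (D c); nra.
  by rewrite ler_pM2r // ltr_wpDl in h7.
exists (Num.bound (nE c + nX (D c))) => j hj.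
have /contrapT bj : ~ bad j.
  move=> /badN; apply/negP; rewrite -ltNge.
  apply: lt_le_trans (_ : (Num.bound (nE c + nX (D c)))%:R <= _); last by rewrite ler_nat.
  by apply: archi_boundP; rewrite addr_ge0 ?(nrm_ge0 nEP) ?(nrm_ge0 nXP).
apply: (bounded_ext (f := fun x => D (T j (V j x)) - (D (T j (V j x)) - T' j (V' j (D x))))).
  by move=> y; rewrite opprB addrC subrK.
apply: (bounded_sub nXP bj).
exact: itw_comm (itw_comp (hT j) (hV j)).
Qed.

End GlidingHump.
End UniformBoundedness.

(** * The continuity ideal of a Jordan derivation *)

Section JordanDerivation.
Variables (R : realType) (E : algType R[i]) (X : lmodType R[i]).
Variables (nE : E -> R) (nX : X -> R).
Hypotheses (nEP : is_norm nE) (nXP : is_norm nX) (cE : complete_for nE).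
Hypothesis nEM : forall a b, nE (a * b) <= nE a * nE b.

Local Notation "a <o> b" := (jprod a b) (at level 40).

(** [L a] is the action of [a]. The identities [Lmul3] and [Lcyc] are full linearizations of the two
    Jordan module axioms, obtained in [module_mul3] and [module_cyc]. *)
Variable L : E -> X -> X.
Hypotheses (Llin : forall a, lin (L a)) (Llinl : forall x, lin (L^~ x)).
Hypothesis Lbounded : exists2 K, 0 <= K & forall a x, nX (L a x) <= K * (nE a * nX x).
Hypothesis Lmul3 : forall a b c x,
  L ((a <o> b) <o> c) x = L (a <o> b) (L c x) + L (b <o> c) (L a x) + L (a <o> c) (L b x)
    - L a (L c (L b x)) - L b (L c (L a x)).
Hypothesis Lcyc : forall a b c x,
  L (a <o> b) (L c x) + L (b <o> c) (L a x) + L (c <o> a) (L b x) =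
  L c (L (a <o> b) x) + L a (L (b <o> c) x) + L b (L (c <o> a) x).

Variable D : E -> X.
Hypothesis Dlin : lin D.
Hypothesis Dder : forall a b, D (a <o> b) = L a (D b) + L b (D a).

Let LD a x y : L a (x + y) = L a x + L a y. Proof. by case: (Llin a). Qed.
Let LZ a c x : L a (c *: x) = c *: L a x. Proof. by case: (Llin a). Qed.
Let LDl a b x : L (a + b) x = L a x + L b x. Proof. by case: (Llinl x) => ->. Qed.
Let LZl c a x : L (c *: a) x = c *: L a x. Proof. by case: (Llinl x) => _ ->. Qed.
Let L0l x : L 0 x = 0. Proof. exact: (lin0 (Llinl x)). Qed.
Let L0 a : L a 0 = 0. Proof. exact: (lin0 (Llin a)). Qed.
Let LN a x : L a (- x) = - L a x. Proof. exact: (linN x (Llin a)). Qed.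
Let LB a x y : L a (x - y) = L a x - L a y. Proof. by rewrite LD LN. Qed.

Lemma jprodC (a b : E) : a <o> b = b <o> a.
Proof. by rewrite /jprod addrC. Qed.

Lemma jprod_lin (a : E) : lin (jprod a).
Proof. by split=> [x y|c x]; rewrite /jprod; algebra_eq (R[i]). Qed.

Lemma jprod_bounded a : bounded nE nE (jprod a).
Proof.
exists (nE a) => [|x]; first exact: nrm_ge0.
rewrite /jprod (nrmZ nEP) cabs_half.
have := nrmD nEP (a * x) (x * a); have := nEM a x; have := nEM x a.
rewrite (mulrC (nE x)); lra.
Qed.

(** The defect [D (a <o> x) - L a (D x)] is [L x (D a)], in which [D] is only evaluated at the fixed
    [a]. *)
Lemma itw_L a : intertwined nE nX D (jprod a) (L a).
Proof.
have [K K0 hK] := Lbounded.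
split=> //; [exact: jprod_lin|exact: jprod_bounded| |].
  by exists (K * nE a) => [|x]; rewrite ?mulr_ge0 ?(nrm_ge0 nEP) // -mulrA; apply: hK.
exists (K * nX (D a)) => [|x]; first by rewrite mulr_ge0 ?(nrm_ge0 nXP).
rewrite Dder addrC addKr; apply: le_trans (hK _ _) _.
by rewrite -mulrA (mulrC (nE x)).
Qed.

(** The Jordan triple product [(a y b + b y a) / 2], written with Jordan products alone so that the
    same formula makes sense on X. *)
Definition quad (a b y : E) := a <o> (b <o> y) + b <o> (a <o> y) - (a <o> b) <o> y.
Definition quadX a b x := L a (L b x) + L b (L a x) - L (a <o> b) x.

Lemma quadE a b y : quad a b y = 2^-1 *: (a * y * b + b * y * a).
Proof. by rewrite /quad /jprod; algebra_eq (R[i]). Qed.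

Lemma itw_quad a b : intertwined nE nX D (quad a b) (quadX a b).
Proof.
apply: (itw_sub nEP nXP Dlin); last exact: itw_L.
by apply: (itw_add nEP nXP Dlin); apply: (itw_comp nXP); apply: itw_L.
Qed.

Let after (M : X -> X) := bounded nE nX (fun x => M (D x)).

Lemma after_left M M' P : intertwined nE nX D M M' -> after P -> after (fun x => M' (P x)).
Proof. by move=> hM; apply: bounded_comp (itw_bounded' hM). Qed.

(** [M' D] and [D M] differ by a bounded map, so [P M' D] is bounded as soon as [P D M] is. *)
Lemma after_right M M' P : intertwined nE nX D M M' -> lin P -> bounded nX nX P ->
  after P -> after (fun x => P (M' x)).
Proof.
move=> hM lP bP aP.
apply: (bounded_ext (f := fun x => P (D (M x)) - P (D (M x) - M' (D x)))).
  by move=> x; rewrite -(linB _ _ lP) opprB addrC subrK.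
apply: (bounded_sub nXP); first exact: bounded_comp aP (itw_bounded hM).
exact: bounded_comp bP (itw_comm hM).
Qed.

(* Plays the role of "a annihilates the separating space of D". *)
Definition good a := bounded nE nX (fun x => L a (D x)).

Lemma good_L a b : good a -> after (fun x => L b (L a x)).
Proof. exact: (after_left (itw_L b)). Qed.

Lemma good_R a b : good a -> after (fun x => L a (L b x)).
Proof.
by apply: (after_right (itw_L b)); [exact: Llin|exact: itw_bounded' (itw_L a)].
Qed.

Lemma after_add P Q : after P -> after Q -> after (fun x => P x + Q x).
Proof. exact: bounded_add. Qed.

Lemma after_sub P Q : after P -> after Q -> after (fun x => P x - Q x).
Proof. exact: bounded_sub. Qed.

Lemma goodD a b : good a -> good b -> good (a + b).
Proof. by move=> ga gb; apply: bounded_ext (after_add ga gb) => x; rewrite LDl. Qed.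

Lemma goodZ c a : good a -> good (c *: a).
Proof. by move=> ga; apply: bounded_ext (bounded_scale nXP c ga) => x; rewrite LZl. Qed.

Lemma goodB a b : good a -> good b -> good (a - b).
Proof. by move=> ga gb; apply: goodD => //; rewrite -scaleN1r; apply: goodZ. Qed.

Lemma good0 : good 0.
Proof. by apply: bounded_ext (bounded0 nE nXP) => x; rewrite L0l. Qed.

(** The bounded maps [L (u k) D] are pointwise bounded because [u] converges; uniform boundedness
    gives one constant for all [k], which passes to the limit. *)
Lemma good_lim u l : (forall k, good (u k)) -> tends nE u l -> good l.
Proof.
move=> gu ul; have [K K0 hK] := Lbounded.
have := @uniform_boundedness R E X nE nX nEP nXP cE
  (fun=> True) nat (fun k x => L (u k) (D x)); case=> //.
- move=> i; exact: lin_comp (Llin _) Dlin.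
- by move=> i; have [C C0 hC] := gu i; exists C => // z _; apply: hC.
- move=> z _; have [N hN] := ul 1 ltr01.
  pose M := nE l + 1 + \sum_(i < N) nE (u i).
  exists (K * (M * nX (D z))) => i; apply: le_trans (hK _ _) _.
  apply: ler_wpM2l => //; apply: ler_wpM2r; first exact: nrm_ge0.
  have s0 : 0 <= \sum_(i < N) nE (u i) by apply: sumr_ge0 => j _; apply: nrm_ge0.
  have l0 := nrm_ge0 nEP l.
  have [iN|Ni] := ltnP i N; last first.
    by have := hN _ Ni; have := nrm_near nEP (u i) l; rewrite /M; lra.
  rewrite /M (bigD1 (Ordinal iN)) //= in s0 *.
  have : 0 <= \sum_(i0 < N | i0 != Ordinal iN) nE (u i0).
    by apply: sumr_ge0 => j _; apply: nrm_ge0.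
  lra.
move=> C C0 hC; exists C => // x; apply: (nrm_le_eps) => e e0.
have [|N hN] := ul (e / (K * nX (D x) + 1)).
  by rewrite divr_gt0 // ltr_wpDl // mulr_ge0 ?(nrm_ge0 nXP).
have := hC N x I; have := nrm_near nXP (L l (D x)) (L (u N) (D x)).
have -> : L l (D x) - L (u N) (D x) = L (l - u N) (D x).
  by rewrite LDl -(scaleN1r (u N)) LZl scaleN1r.
have := hK (l - u N) (D x); have := hN N (leqnn N); rewrite (nrmC nEP).
rewrite ler_pdivlMr ?ltr_wpDl // ?mulr_ge0 ?(nrm_ge0 nXP) //.
have := nrm_ge0 nEP (l - u N); nra.
Qed.

(* [L_(e^n), L_f] = n [L_e, L_f] while the powers of e stay bounded, so L_e and L_f
   commute; then expand L_f = L_((f o e) o e). *)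
Lemma L_corner e f : (exists K, forall n, nE (e ^+ n) <= K) -> e * f = f -> f * e = f ->
  forall x, L f x = L f (2 *: L e x - quadX e e x).
Proof.
move=> [K eK] ef fe.
have enf n : e ^+ n * f = f by elim: n => [|n IH]; rewrite ?mul1r // exprSr -mulrA ef.
have fen n : f * e ^+ n = f by elim: n => [|n IH]; rewrite ?mulr1 // exprS mulrA fe.
have half2 (a : E) : 2^-1 *: (a + a) = a.
  by lmod_eq (R[i]).
have jf n : e ^+ n <o> f = f by rewrite /jprod enf fen half2.
have je n : e <o> e ^+ n = e ^+ n.+1 by rewrite /jprod -exprS -exprSr half2.
have cm m x : L (e ^+ m.+1) (L f x) = L f (L (e ^+ m.+1) x).
  pose phi n := L (e ^+ n) (L f x) - L f (L (e ^+ n) x).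
  have phiS n : phi n.+1 = phi 1%N + phi n.
    have := Lcyc e (e ^+ n) f x; rewrite je (jprodC f) -{2 4}[e]expr1 !jf -[L e _]/(L (e ^+ 1) _).
    rewrite -[L e (L f x)]/(L (e ^+ 1) (L f x)) /phi => h.
    apply/eqP; rewrite -subr_eq0; apply/eqP.
    move/eqP: h; rewrite -subr_eq0 => /eqP <-.
    by lmod_eq (R[i]).
  have phin n : phi n.+1 = n.+1%:R *: phi 1%N.
    elim: n => [|n IH]; first by rewrite scale1r.
    by rewrite phiS IH -[in RHS]natr1 addrC scalerDl scale1r.
  have phi1 : phi 1%N = 0.
    have [C C0 hC] := Lbounded.
    pose B := C * (K * (C * (nE f * nX x))) + C * (nE f * (C * (K * nX x))).
    have hB n : nX (phi n) <= B.
      have f0 := nrm_ge0 nEP f; have x0 := nrm_ge0 nXP x.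
      apply: le_trans (nrmB nXP _ _) _; apply: lerD.
        apply: le_trans (hC _ _) _; apply: ler_wpM2l => //.
        by apply: ler_pM; rewrite ?(nrm_ge0 nEP) ?(nrm_ge0 nXP).
      apply: le_trans (hC _ _) _; apply: ler_wpM2l => //; apply: ler_wpM2l => //.
      by apply: le_trans (hC _ _) _; apply: ler_wpM2l => //; apply: ler_wpM2r.
    apply: (nrm_small0 nXP) => eps e0.
    have B0 : 0 <= B := le_trans (nrm_ge0 nXP _) (hB 0%N).
    have := archi_boundP (divr_ge0 B0 (ltW e0)); set n := Num.bound _ => hn.
    have := hB n.+1; rewrite phin (nrmZ nXP) -(rmorph_nat (real_complex R)) cabs_nneg //.
    rewrite ltr_pdivrMr // in hn; rewrite -natr1 => h.
    have := nrm_ge0 nXP (phi 1%N); have : 0 <= n%:R :> R by [].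
    nra.
  by apply/eqP; rewrite -subr_eq0 -/(phi _) phin phi1 scaler0.
move=> x; have jfe : f <o> e = f by rewrite jprodC -{1}[e]expr1 jf.
have cm1 y : L e (L f y) = L f (L e y) by have := cm 0%N y.
have jee : e <o> e = e ^+ 2 := je 1%N.
have := Lmul3 f e e x; rewrite !jfe jee => ->.
rewrite (cm 1%N) !cm1 /quadX jee !(LB, LD, LN, LZ).
by lmod_eq (R[i]).
Qed.

Lemma quadX_linr f a x : lin (fun b => L f (quadX a b x)).
Proof.
split=> [b b'|c b]; rewrite /quadX /jprod ?(mulrDl, mulrDr) -?(scalerAl, scalerAr);
  rewrite !(LB, LD, LN, LZ, LDl, LZl); lmod_eq (R[i]).
Qed.

Lemma after_sum n (P : nat -> X -> X) : (forall i, (i < n)%N -> after (P i)) ->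
  after (fun x => \sum_(i < n) P i x).
Proof.
elim: n => [|n IH] h.
  by apply: bounded_ext (bounded0 nE nXP) => x; rewrite big_ord0.
apply: (bounded_ext (f := fun x => \sum_(i < n) P i (D x) + P n (D x))).
  by move=> x; rewrite big_ord_recr.
by apply: (bounded_add nXP); [apply: IH => i ni; exact: (h i (ltnW ni))|exact: (h n)].
Qed.

(** On the algebra the inner operator reads [2 e o y - e y e = y - (1 - e) y (1 - e)]: it discards
    the part of [y] away from [e]. By [L_corner] nothing is lost under [L f], and an operator built
    from [e] can take part in a hump. *)
Lemma good_of_corner e f : (exists K, forall n, nE (e ^+ n) <= K) -> e * f = f -> f * e = f ->
  after (fun x => L f (2 *: L e x - quadX e e x)) -> good f.
Proof. by move=> eK ef fe; apply: bounded_ext => x; rewrite -L_corner. Qed.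

(** If it fails, every corner holds an element [f j] that is not good and has [e j] as a unit; these
    pairs drive the humps. Goodness of a whole corner, rather than of [e j], is what [jgood_corner]
    will consume. *)
Lemma exists_good_corner (e : nat -> E) :
  (forall i j, i != j -> e i * e j = 0) ->
  (forall i, exists K, forall n, nE (e i ^+ n) <= K) ->
  exists j, forall f, e j * f = f -> f * e j = f -> good f.
Proof.
move=> ee eK; apply: contrapT => hn.
have /choice[f hf] : forall j, exists f, [/\ e j * f = f, f * e j = f & ~ good f].
  move=> j; apply: contrapT => h; apply: hn; exists j => f ef fe.
  by apply: contrapT => ng; apply: h; exists f.
have fe i j : i != j -> f i * e j = 0.
  by move=> ij; have [_ <- _] := hf i; rewrite -mulrA ee ?mulr0.
have ef i j : i != j -> e j * f i = 0.
  by move=> ij; have [<- _ _] := hf i; rewrite mulrA ee ?mul0r // eq_sym.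
have jq0 g a b y : g * a = 0 -> g * b = 0 -> a * g = 0 -> b * g = 0 -> g <o> quad a b y = 0.
  move=> ga gb ag bg; rewrite quadE /jprod -scalerAl -scalerAr !(mulrDl, mulrDr) !mulrA.
  by rewrite ga gb -!mulrA ag bg !(mul0r, mulr0) !addr0 !scaler0 ?addr0 ?scaler0.
(* First hump, against the fixed element e_i; it yields a subsequence n_k such that
   L_(f_(n_k)) quadX (e_(n_k)) (e_(n_i)) is good for i < k.  In the second hump the
   operator 2 e o y - e y e - (e y s + s y e), with s the sum of the earlier e_(n_i),
   is killed by all earlier f_(n_i); on X, composing it with L_f gives L_f up to the
   terms controlled by the first hump. *)
have far i : exists N, forall j, (N <= j)%N -> after (fun x => L (f j) (quadX (e j) (e i) x)).
  have [|||N hN] := @gliding_hump R E X nE nX nEP nXP cE D Dlin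
    (fun k => jprod (f (i.+1 + k)%N)) (fun k => quad (e (i.+1 + k)%N) (e i))
    (fun k => L (f (i.+1 + k)%N)) (fun k => quadX (e (i.+1 + k)%N) (e i)).
  - by move=> k; apply: itw_L.
  - by move=> k; apply: itw_quad.
  - move=> a b x ab.
    have ne1 : (i.+1 + a)%N != (i.+1 + b)%N by rewrite eqn_add2l ltn_eqF.
    have ne2 : (i.+1 + a)%N != i by rewrite addSn gtn_eqF // ltnS leq_addr.
    by apply: jq0; rewrite ?fe ?ef.
  exists (i.+1 + N)%N => j hj; rewrite -(subnKC hj) -addnA; apply: hN.
  by rewrite leq_addr.
have [N hN] := choice far.
(* The sum dominates every [N i] with [i <= n j], in particular [N (n j)]; the summand [n j] and the
   successor make [n] strictly increasing. *)
pose n := fix n k := if k is j.+1 then (n j + \sum_(i < (n j).+1) N i).+1 else 0%N.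
have nS i k : (i < k)%N -> (n i < n k)%N /\ (N (n i) <= n k)%N.
  have st j : (n j < n j.+1)%N /\ (N (n j) <= n j.+1)%N.
    split; first by rewrite /= ltnS leq_addr.
    rewrite /= big_ord_recr /= addnA; apply/leqW/leq_addl.
  elim: k => // k IH; rewrite ltnS leq_eqVlt => /predU1P[->|/IH[h1 h2]]; first exact: st.
  by have [h _] := st k; split; [exact: ltn_trans h1 h|exact: leq_trans h2 (ltnW h)].
have n_neq i k : (i < k)%N -> n i != n k by move=> /nS[h _]; rewrite ltn_eqF.
pose s k := \sum_(i < k) e (n i).
have fs i k : (i < k)%N -> f (n i) * s k = f (n i) /\ s k * f (n i) = f (n i).
  move=> ik; rewrite /s mulr_sumr mulr_suml (bigD1 (Ordinal ik)) //= big1; last first.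
    move=> j; rewrite -val_eqE /= => ji; apply: fe; apply: contra ji => /eqP.
    by case: (ltngtP i j) => // /n_neq/eqP; [|move=> h /esym].
  rewrite (bigD1 (Ordinal ik)) //= big1; last first.
    move=> j; rewrite -val_eqE /= => ji; apply: ef; apply: contra ji => /eqP.
    by case: (ltngtP i j) => // /n_neq/eqP; [|move=> h /esym].
  by have [-> -> _] := hf (n i); rewrite !addr0.
have [|||k0 hk0] := @gliding_hump R E X nE nX nEP nXP cE D Dlin
    (fun k => jprod (f (n k)))
    (fun k y => 2 *: (e (n k) <o> y) - quad (e (n k)) (e (n k)) y - 2 *: quad (e (n k)) (s k) y)
    (fun k => L (f (n k)))
    (fun k x => 2 *: L (e (n k)) x - quadX (e (n k)) (e (n k)) x - 2 *: quadX (e (n k)) (s k) x).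
- by move=> k; apply: itw_L.
- move=> k; apply: (itw_sub nEP nXP Dlin); last first.
    by apply: (itw_scale nEP nXP Dlin); apply: itw_quad.
  apply: (itw_sub nEP nXP Dlin); last exact: itw_quad.
  by apply: (itw_scale nEP nXP Dlin); apply: itw_L.
- move=> a b y ab; have [h1 h2] := fs _ _ ab.
  have h3 := fe _ _ (n_neq _ _ ab); have h4 := ef _ _ (n_neq _ _ ab).
  move: (f (n a)) (e (n b)) (s b) h1 h2 h3 h4 => g d t gt tg gd dg.
  have tg' z : z * t * g = z * g by rewrite -mulrA tg.
  have dg' z : z * d * g = 0 by rewrite -mulrA dg mulr0.
  rewrite !quadE /jprod.
  rewrite !(mulrDl, mulrDr, mulNr, mulrN, =^~ scalerAl, =^~ scalerAr, mulrA).
  rewrite !(gt, tg, gd, dg, tg', dg', mul0r).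
  by lmod_eq (R[i]).
have [ef0 fe0 ng] := hf (n k0); apply: ng.
apply: (good_of_corner (eK _) ef0 fe0).
have hA := hk0 _ (leqnn k0).
have hB : after (fun x => \sum_(i < k0) L (f (n k0)) (quadX (e (n k0)) (e (n i)) x)).
  apply: (@after_sum k0 (fun i x => L (f (n k0)) (quadX (e (n k0)) (e (n i)) x))).
  by move=> i /nS[_]; apply: hN.
apply: bounded_ext (bounded_add nXP hA (bounded_scale nXP 2 hB)) => x /=.
rewrite -(lin_sum _ _ (quadX_linr (f (n k0)) (e (n k0)) (D x))) -/(s k0).
by rewrite [in LHS]LB LZ subrK.
Qed.

(** Stability under one Jordan product already makes this a Jordan ideal, by [jgood_jprod]; it is
    the largest one made of good elements. *)
Let jgood a := good a /\ forall b, good (a <o> b).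

(** In [Lmul3] with [c = a], every term has [L a] or [L (a <o> a)] as its first or last factor. *)
Lemma good_inner (a b : E) : good a -> good (a <o> a) -> good ((a <o> b) <o> a).
Proof.
move=> ga gaa.
apply: (bounded_ext (f := fun x => L (a <o> b) (L a (D x)) + L (b <o> a) (L a (D x))
   + L (a <o> a) (L b (D x)) - L a (L a (L b (D x))) - L b (L a (L a (D x))))).
  by move=> x; rewrite -Lmul3.
apply: (@after_sub (fun x => L (a <o> b) (L a x) + L (b <o> a) (L a x)
   + L (a <o> a) (L b x) - L a (L a (L b x))) (fun x => L b (L a (L a x)))); last first.
  exact: (after_left (P := fun x => L a (L a x)) (itw_L b) (good_L a ga)).
apply: (@after_sub (fun x => L (a <o> b) (L a x) + L (b <o> a) (L a x)
   + L (a <o> a) (L b x)) (fun x => L a (L a (L b x)))); last first.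
  exact: (after_left (P := fun x => L a (L b x)) (itw_L a) (good_R b ga)).
apply: (@after_add (fun x => L (a <o> b) (L a x) + L (b <o> a) (L a x))); last exact: good_R.
by apply: (@after_add (fun x => L (a <o> b) (L a x))); apply: good_L.
Qed.

Lemma jgoodD a b : jgood a -> jgood b -> jgood (a + b).
Proof.
move=> [ga ha] [gb hb]; split=> [|c]; first exact: goodD.
by rewrite jprodC; case: (jprod_lin c) => -> _; apply: goodD; rewrite jprodC.
Qed.

Lemma jgoodZ k a : jgood a -> jgood (k *: a).
Proof.
move=> [ga ha]; split=> [|c]; first exact: goodZ.
by rewrite jprodC; case: (jprod_lin c) => _ ->; apply: goodZ; rewrite jprodC.
Qed.

(** Every term of [Lmul3] begins or ends with the action of [a], [a <o> b] or [a <o> c], all of them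
    good. *)
Lemma jgood_jprod a b : jgood a -> jgood (a <o> b).
Proof.
move=> [ga ha]; split=> // c.
apply: (bounded_ext (f := fun x => L (a <o> b) (L c (D x)) + L (b <o> c) (L a (D x))
   + L (a <o> c) (L b (D x)) - L a (L c (L b (D x))) - L b (L c (L a (D x))))).
  by move=> x; rewrite -Lmul3.
apply: (@after_sub (fun x => L (a <o> b) (L c x) + L (b <o> c) (L a x)
   + L (a <o> c) (L b x) - L a (L c (L b x))) (fun x => L b (L c (L a x)))); last first.
  exact: (after_left (P := fun x => L c (L a x)) (itw_L b) (good_L c ga)).
apply: (@after_sub (fun x => L (a <o> b) (L c x) + L (b <o> c) (L a x)
   + L (a <o> c) (L b x)) (fun x => L a (L c (L b x)))); last first.
  apply: (after_right (M := fun y => c <o> (b <o> y)) (M' := fun y => L c (L b y)) (P := L a)) => //.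
    by apply: (itw_comp nXP); apply: itw_L.
  exact: itw_bounded' (itw_L a).
apply: (@after_add (fun x => L (a <o> b) (L c x) + L (b <o> c) (L a x))); last exact: good_R.
by apply: (@after_add (fun x => L (a <o> b) (L c x))); [exact: good_R|exact: good_L].
Qed.

(** * From a good corner to two-sided products *)

Section NestedCorners.
Variables e f2 f1 f : E.
Hypothesis egood : forall g, e * g = g -> g * e = g -> good g.
Hypotheses (ef2 : e * f2 = f2) (f2e : f2 * e = f2) (f21 : f2 * f1 = f1) (f12 : f1 * f2 = f1).
Hypotheses (f1f : f1 * f = f) (ff1 : f * f1 = f).

(** [g <o> b] leaves the corner of [e], but multiplying twice by the intermediate unit [h] gives an
    element covered by [good_inner], and the correction terms fall back into the corner. *)
Lemma jgood_corner g h : h * g = g -> g * h = g -> e * h = h -> h * e = h -> jgood g.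
Proof.
move=> hg gh eh he.
have eg : e * g = g by rewrite -hg mulrA eh.
have ge : g * e = g by rewrite -gh -mulrA he.
have ehn k : e * h ^+ k.+1 = h ^+ k.+1 by rewrite exprS mulrA eh.
have hne k : h ^+ k.+1 * e = h ^+ k.+1 by rewrite exprSr -mulrA he.
have gg : good g by apply: egood.
split=> // b.
have gc k : good (g * b * h ^+ k.+1 + h ^+ k.+1 * b * g).
  by apply: egood; rewrite ?(mulrDr, mulrDl) ?mulrA ?eg ?ehn // -!mulrA ge hne.
(* The terms g b h^k + h^k b g with k > 0 lie in the corner of e. *)
have -> : g <o> b = 4 *: ((h <o> (g <o> b)) <o> h)
    - (g * b * h ^+ 1 + h ^+ 1 * b * g) - 2^-1 *: (g * b * h ^+ 2 + h ^+ 2 * b * g).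
  have hg' z : z * h * g = z * g by rewrite -mulrA hg.
  have gh' z : z * g * h = z * g by rewrite -mulrA gh.
  rewrite /jprod expr1 expr2.
  rewrite !(mulrDl, mulrDr, mulNr, mulrN, =^~ scalerAl, =^~ scalerAr, mulrA).
  rewrite !(hg, gh, hg', gh').
  by lmod_eq (R[i]).
have gh1 : good h by apply: egood.
have ghh : good (h <o> h).
  rewrite /jprod; apply: goodZ; apply: goodD; apply: egood; rewrite ?mulrA ?eh -?mulrA ?he //.
apply: goodB; last exact: goodZ (gc 1%N).
apply: goodB; last exact: (gc 0%N).
by apply: goodZ; apply: good_inner.
Qed.

(** Associative products are recovered from Jordan ones by [f z = 2 f o (f1 z) - f1 z f] and
    [b f c = 2 (f c) o b - f c b]. The chain has four members because [jgood_corner] is applied to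
    [f] with unit [f1] and to [f1 z f] with unit [f2], both units lying in the corner of [e]. *)
Lemma good_ideal_corner b c : good (b * f * c).
Proof.
have jf z : jgood (f * z).
  have jfz : jgood (f1 * z * f).
    apply: (@jgood_corner _ f2) => //; first by rewrite !mulrA f21.
    by rewrite -!mulrA -ff1 -(mulrA f) f12.
  have -> : f * z = 2 *: (f <o> (f1 * z)) - f1 * z * f.
    rewrite /jprod !mulrA ff1; lmod_eq (R[i]).
  rewrite -scaleN1r; apply: jgoodD; apply: jgoodZ => //; apply: jgood_jprod.
  apply: (@jgood_corner _ f1) => //; first by rewrite -f21 mulrA ef2.
  by rewrite -f12 -mulrA f2e.
have -> : b * f * c = 2 *: ((f * c) <o> b) - f * (c * b).
  rewrite /jprod !mulrA; lmod_eq (R[i]).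
apply: goodB; last by case: (jf (c * b)).
by apply: goodZ; case: (jf c) => _; apply.
Qed.

End NestedCorners.

(** [L z (D b)] is bounded in [b] because [z] is good and bounded in [z] because [L] is; uniform
    boundedness over the unit ball of [b] makes the bound joint. *)
Lemma bounded_on_products (N : E -> Prop) :
  N 0 -> (forall x y, N x -> N y -> N (x + y)) -> (forall c x, N x -> N (c *: x)) ->
  (forall u l, (forall k, N (u k)) -> tends nE u l -> N l) ->
  (forall z, N z -> good z) ->
  exists2 C, 0 <= C & forall z w, N z -> N w -> nX (D (z <o> w)) <= C * (nE z * nE w).
Proof.
move=> N0 ND NZ Ncl Ngood; have [K K0 hK] := Lbounded.
have [] := @uniform_boundedness R E X nE nX nEP nXP cE N {b : E | nE b <= 1}
  (fun b z => L z (D (sval b))) N0 ND NZ Ncl.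
- by move=> b; apply: Llinl.
- move=> [b b1]; exists (K * nX (D b)); first by rewrite mulr_ge0 ?(nrm_ge0 nXP).
  by move=> z _; apply: le_trans (hK _ _) _; rewrite (mulrC (nE z)) mulrA.
- move=> z /Ngood[C C0 hC]; exists C => -[b b1] /=; apply: le_trans (hC b) _.
  by rewrite -[leRHS]mulr1; apply: ler_wpM2l.
move=> C C0 hC.
have hL z b : N z -> nX (L z (D b)) <= C * (nE z * nE b).
  move=> Nz; have [->|b0] := eqVneq b 0.
    by rewrite (lin0 Dlin) L0 (nrm0 nXP) (nrm0 nEP) !mulr0.
  have nb : 0 < nE b by apply: (nrm_gt0 nEP); apply/eqP.
  have ib : 0 <= (nE b)^-1 by rewrite invr_ge0 ltW.
  have b1 : nE ((nE b)^-1%:C *: b) <= 1 by rewrite (nrmZr nEP) (ger0_norm ib) mulVf ?gt_eqF.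
  have := hC (exist (fun b => is_true (nE b <= 1)) _ b1) z Nz; case: Dlin => /= _ ->.
  rewrite LZ (nrmZr nXP) (ger0_norm ib) mulrC ler_pdivrMr //.
  by rewrite mulrA.
exists (C + C) => [|z w Nz Nw]; first exact: addr_ge0.
rewrite Dder mulrDl; apply: le_trans (nrmD nXP _ _) _; apply: lerD; first exact: hL.
by rewrite (mulrC (nE z)); apply: hL.
Qed.

End JordanDerivation.

(** * Functional calculus in a unital C*-algebra *)

(** The C*-identity is recorded as an inequality. It makes the involution isometric ([nE_star]), and
    submultiplicativity then gives the converse. *)
Record unital_cstar (R : realType) (E : algType R[i]) (star : E -> E) (nE : E -> R) : Prop :=
  UnitalCstar {
  uc_norm : is_norm nE;
  uc_complete : complete_for nE;
  uc_normM : forall a b, nE (a * b) <= nE a * nE b;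
  uc_starD : forall a b, star (a + b) = star a + star b;
  uc_starZ : forall c a, star (c *: a) = c^*%C *: star a;
  uc_starM : forall a b, star (a * b) = star b * star a;
  uc_starK : forall a, star (star a) = a;
  uc_normE : forall a, nE a ^+ 2 <= nE (star a * a) }.

Section RealIteration.
Variable R : realType.

(* The iteration s |-> (x + s ^ 2) / 2 has the fixed point 1 - sqrt (1 - x);
   at x = 1 it dominates the same iteration at any x of norm at most 1. *)
Fixpoint dom_seq (n : nat) : R := if n is k.+1 then (1 + dom_seq k ^+ 2) / 2 else 0.

(** With [d = 1 - s] the iteration reads [d - d^2 / 2]: the fixed point attracts only to second
    order, so the error decays like [2 / n]. *)
Lemma dom_seq_bound n : 0 <= dom_seq n /\ 1 - 2 / n.+2%:R <= dom_seq n <= 1.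
Proof.
elim: n => [|n [h0 /andP[h1 h2]]] /=; first by rewrite divff ?pnatr_eq0 // subrr lexx ler01.
have n0 : 0 <= n%:R :> R by [].
split; first by rewrite divr_ge0 // addr_ge0 // sqr_ge0.
apply/andP; split; last by rewrite ler_pdivrMr // mul1r; nra.
have e2 : n.+2%:R = n%:R + 2 :> R by rewrite -addn2 natrD.
have e3 : n.+3%:R = n%:R + 3 :> R by rewrite -addn3 natrD.
rewrite e2 e3 in h1 *.
have h3 : 2 / (n%:R + 2) - 2 / (n%:R + 2) ^+ 2 <= 2 / (n%:R + 3) :> R.
  have -> : 2 / (n%:R + 2) - 2 / (n%:R + 2) ^+ 2 = 2 * (n%:R + 1) / (n%:R + 2) ^+ 2 :> R.
    by field; lra.
  rewrite ler_pdivrMr ?exprn_gt0 ?ltr_wpDl // mulrAC ler_pdivlMr ?ltr_wpDl //; nra.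
have h4 : 2 / (n%:R + 2) ^+ 2 = (2 / (n%:R + 2)) ^+ 2 / 2 :> R by field; lra.
have h5 : 0 < 2 / (n%:R + 2) :> R by rewrite divr_gt0 ?ltr_wpDl.
have h6 : 2 / (n%:R + 2) <= 1 :> R by rewrite ler_pdivrMr ?ltr_wpDl //; lra.
move: h4 h5 h6 h3 h1; set q := 2 / (n%:R + 2) => h4 h5 h6 h3 h1.
nra.
Qed.

Lemma dom_seq_ge0 n : 0 <= dom_seq n. Proof. by case: (dom_seq_bound n). Qed.
Lemma dom_seq_le1 n : dom_seq n <= 1. Proof. by case: (dom_seq_bound n) => _ /andP[]. Qed.

Lemma dom_seq_lim (e : R) : 0 < e -> exists N, 1 - dom_seq N <= e.
Proof.
move=> e0; have := archi_boundP (ltW (divr_gt0 (ltr0n R 2) e0)).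
set N := Num.bound _ => h; exists N; have [_ /andP[h1 _]] := dom_seq_bound N.
suff : 2 / N.+2%:R <= e by move: (2 / _) h1 => q h1 h2; lra.
rewrite ler_pdivrMr // mulrC -ler_pdivrMr //; apply: (le_trans (ltW h)).
by rewrite ler_nat -addn2 leq_addr.
Qed.

End RealIteration.

Section UnitalCstar.
Variables (R : realType) (E : algType R[i]) (star : E -> E) (nE : E -> R).
Hypothesis hE : unital_cstar star nE.
Let nEP := uc_norm hE.
Let nEM := uc_normM hE.
Let starD := uc_starD hE.
Let starZ := uc_starZ hE.
Let starM := uc_starM hE.
Let starK := uc_starK hE.

Lemma star1 : star 1 = 1.
Proof. by have := starM (star 1) 1; rewrite mulr1 starK mulr1. Qed.

Lemma star0 : star 0 = 0.
Proof. by rewrite -[in LHS](scale0r (0 : E)) starZ conjc0 scale0r. Qed.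

Lemma starN a : star (- a) = - star a.
Proof. by rewrite -scaleN1r starZ rmorphN1 scaleN1r. Qed.

Lemma starB a b : star (a - b) = star a - star b.
Proof. by rewrite starD starN. Qed.

Lemma starZr (r : R) a : star (r%:C *: a) = r%:C *: star a.
Proof. by rewrite starZ conjc_real. Qed.

Lemma starX a n : star (a ^+ n) = star a ^+ n.
Proof. by elim: n => [|n IH]; rewrite ?star1 // exprSr starM IH exprS. Qed.

Lemma star_sum I (r : seq I) (F : I -> E) : star (\sum_(i <- r) F i) = \sum_(i <- r) star (F i).
Proof. by elim: r => [|i r IH]; rewrite ?big_nil ?star0 // !big_cons starD IH. Qed.

Lemma nE_ge0 a : 0 <= nE a. Proof. exact: nrm_ge0. Qed.

Lemma nE1 : nE 1 <= 1.
Proof.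
have := uc_normE hE 1; rewrite star1 mulr1; have := nE_ge0 1.
by rewrite expr2; nra.
Qed.

Lemma nE_star a : nE (star a) = nE a.
Proof.
suff h b : nE b <= nE (star b) by apply/eqP; rewrite eq_le h andbT -{2}[a]starK h.
have := uc_normE hE b; have := nEM (star b) b; have := nE_ge0 b; have := nE_ge0 (star b).
by rewrite expr2; nra.
Qed.

Lemma nEX a n : nE (a ^+ n) <= nE a ^+ n.
Proof.
elim: n => [|n IH]; first by rewrite !expr0 nE1.
by rewrite !exprS; apply: le_trans (nEM _ _) _; apply: ler_wpM2l => //; apply: nE_ge0.
Qed.

Lemma nE_sum I (r : seq I) (F : I -> E) : nE (\sum_(i <- r) F i) <= \sum_(i <- r) nE (F i).
Proof.
elim: r => [|i r IH]; first by rewrite !big_nil (nrm0 nEP).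
by rewrite !big_cons; apply: le_trans (nrmD nEP _ _) _; apply: lerD.
Qed.

Lemma nE_isometry u : star u * u = 1 -> nE u <= 1.
Proof.
move=> uu; have := uc_normE hE u; rewrite uu; have := nE1; have := nE_ge0 u; nra.
Qed.

Lemma tends_const (a : E) : tends nE (fun=> a) a.
Proof. by move=> e e0; exists 0%N => k _; rewrite subrr (nrm0 nEP) ltW. Qed.

Lemma tendsD u v a b : tends nE u a -> tends nE v b -> tends nE (fun k => u k + v k) (a + b).
Proof.
move=> ha hb e e0; have e2 : 0 < e / 2 by rewrite divr_gt0.
have [N hN] := ha _ e2; have [M hM] := hb _ e2; exists (maxn N M) => k.
rewrite geq_max => /andP[/hN h1 /hM h2]; rewrite opprD addrACA.
by apply: le_trans (nrmD nEP _ _) _; lra.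
Qed.

Lemma tendsM u v a b : tends nE u a -> tends nE v b -> tends nE (fun k => u k * v k) (a * b).
Proof.
move=> ha hb e e0; pose B := nE a + nE b + 1.
have a0 := nE_ge0 a; have b0 := nE_ge0 b.
have B0 : 0 < B by rewrite /B; lra.
have e2 : 0 < Num.min 1 (e / (2 * B)) by rewrite lt_min ltr01 divr_gt0 ?mulr_gt0.
have [N hN] := ha _ e2; have [M hM] := hb _ e2; exists (maxn N M) => k.
rewrite geq_max => /andP[/hN + /hM]; rewrite !le_min => /andP[h1 h2] /andP[h3 h4].
rewrite !ler_pdivlMr ?mulr_gt0 // in h2 h4.
have -> : u k * v k - a * b = (u k - a) * (v k - b) + (u k - a) * b + a * (v k - b).
  by algebra_eq (R[i]).
apply: le_trans (nrmD nEP _ _) _; apply: le_trans (lerD (nrmD nEP _ _) (lexx _)) _.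
have := nEM (u k - a) (v k - b); have := nEM (u k - a) b; have := nEM a (v k - b).
have := nE_ge0 (u k - a); have := nE_ge0 (v k - b).
move: (nE (u k - a)) (nE (v k - b)) h1 h2 h3 h4 => x y h1 h2 h3 h4 y0 x0 k1 k2 k3.
rewrite /B in h2 h4; nra.
Qed.

Lemma tendsZ c u a : tends nE u a -> tends nE (fun k => c *: u k) (c *: a).
Proof.
move=> /(tendsM (tends_const (c%:A))) h e /h[N hN]; exists N => k /hN.
by rewrite !mulr_algl.
Qed.

Lemma tends_star u a : tends nE u a -> tends nE (fun k => star (u k)) (star a).
Proof. by move=> h e /h[N hN]; exists N => k /hN; rewrite -starB nE_star. Qed.

Lemma tends_shift u (a : E) : tends nE u a -> tends nE (fun k => u k.+1) a.
Proof. by move=> h e /h[N hN]; exists N => k kN; apply: hN; apply: leqW. Qed.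

Lemma tends_ext u v (a : E) : (forall k, u k = v k) -> tends nE u a -> tends nE v a.
Proof. by move=> uv h e /h[N hN]; exists N => k /hN; rewrite uv. Qed.

Section Unitary.
Variable h : E.
Hypotheses (h_sa : star h = h) (h1 : nE h <= 1).

(** The iteration of [dom_seq] at [x = h^2], with limit [1 - sqrt (1 - h^2)]. Its terms commute, so
    an increment is half the product of the previous increment and of a sum of two terms, and is
    dominated by the scalar increment. *)
Fixpoint one_minus_sqrt (n : nat) : E :=
  if n is k.+1 then 2^-1 *: (h * h + one_minus_sqrt k * one_minus_sqrt k) else 0.
Local Notation y := one_minus_sqrt.

Lemma exists_one_minus_sqrt : exists z,
  [/\ z = 2^-1 *: (h * h + z * z), h * z = z * h & star z = z].
Proof.
have yc a n : h * a = a * h -> y n * a = a * y n.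
  move=> ha; elim: n => [|n IH] /=; first by rewrite mul0r mulr0.
  rewrite -scalerAl -scalerAr mulrDl mulrDr -!mulrA ha [in X in _ *: (X + _)]mulrA ha IH.
  by rewrite !mulrA IH -!mulrA.
have yh n : y n * h = h * y n by apply: yc.
have yS n : y n.+1 * y n = y n * y n.+1 by apply: yc; rewrite yh.
have ysa n : star (y n) = y n.
  elim: n => [|n IH] /=; first exact: star0.
  by rewrite starZ conj_half starD !starM IH h_sa.
have hh1 : nE (h * h) <= 1.
  by apply: le_trans (nEM _ _) _; rewrite -[leRHS]mulr1; apply: ler_pM; rewrite ?nE_ge0.
have yn n : nE (y n) <= dom_seq R n.
  elim: n => [|n IH] /=; first by rewrite (nrm0 nEP).
  rewrite (nrmZ nEP) cabs_half mulrC ler_pM2r ?invr_gt0 //.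
  apply: le_trans (nrmD nEP _ _) _; apply: lerD => //; apply: le_trans (nEM _ _) _.
  by rewrite expr2; apply: ler_pM; rewrite ?nE_ge0.
have yd n : nE (y n.+1 - y n) <= dom_seq R n.+1 - dom_seq R n.
  elim: n => [|n IH].
    rewrite /= mulr0 addr0 !subr0 expr0n addr0 (nrmZ nEP) cabs_half.
    by rewrite mul1r ger_pMr ?invr_gt0.
  have -> : y n.+2 - y n.+1 = 2^-1 *: ((y n.+1 - y n) * (y n.+1 + y n)).
    have -> : y n.+2 - y n.+1 =
      2^-1 *: (h * h + y n.+1 * y n.+1) - 2^-1 *: (h * h + y n * y n) by [].
    by rewrite mulrDl !mulrDr !mulNr yS; lmod_eq (R[i]).
  rewrite (nrmZ nEP) cabs_half.
  have := nEM (y n.+1 - y n) (y n.+1 + y n); have := nrmD nEP (y n.+1) (y n).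
  have := yn n; have := yn n.+1; have := nE_ge0 (y n.+1 - y n); have := nE_ge0 (y n.+1 + y n).
  move: IH; rewrite -[dom_seq R n.+2]/((1 + dom_seq R n.+1 ^+ 2) / 2).
  have e1 : dom_seq R n.+1 = (1 + dom_seq R n ^+ 2) / 2 by [].
  move: (nE (_ * _)) (nE (y n.+1 - y n)) (nE (y n.+1 + y n)) (nE (y n.+1)) (nE (y n)) => P A B C F.
  move: (dom_seq R n.+1) (dom_seq R n) e1 => a b e1 i1 i2 i3 i4 i5 i6 i7.
  have : A * B <= (a - b) * (a + b) by apply: ler_pM => //; lra.
  nra.
have [|z zl _] := tends_dominated nEP (uc_complete hE) (@dom_seq_le1 R) _ yd.
  by move=> e; apply: dom_seq_lim.
exists z; split.
- apply: (tends_uniq nEP (tends_shift zl)).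
  by apply: tendsZ; apply: tendsD (tends_const _) (tendsM zl zl).
- apply: (tends_uniq nEP (tendsM (tends_const h) zl)).
  by apply: (tends_ext (u := fun k => y k * h)); [exact: yh|apply: tendsM zl (tends_const _)].
- by apply: (tends_uniq nEP (tends_star zl)); apply: tends_ext zl => k; rewrite ysa.
Qed.

(** The unitary is [h + i sqrt (1 - h^2)], with [1 - z] for the square root. *)
Lemma exists_unitary : exists u, [/\ star u * u = 1, u * star u = 1 & h = 2^-1 *: (u + star u)].
Proof.
have [z [ze hz zs]] := exists_one_minus_sqrt.
have zz : z * z = 2 *: z - h * h by rewrite {3}ze; lmod_eq (R[i]).
have ii := mul_ii R.
exists (h + 'i *: (1 - z)).
have -> : star (h + 'i *: (1 - z)) = h - 'i *: (1 - z).
  by rewrite starD h_sa starZ starB zs star1 conj_i scaleNr.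
have hw : h * (1 - z) = (1 - z) * h by rewrite mulrBl mulrBr hz mul1r mulr1.
have ww : (1 - z) * (1 - z) = 1 - h * h.
  rewrite !(mulrDl, mulrDr, mulNr, mulrN) !mulr1 mul1r zz; lmod_eq (R[i]).
move: (1 - z) hw ww => w hw ww; split.
- rewrite mulrDl !mulrDr !mulNr -!(scalerAl, scalerAr) scalerA ii ww hw.
  lmod_eq (R[i]).
- rewrite mulrDl !mulrDr !mulrN -!(scalerAl, scalerAr) scalerA ii ww hw.
  lmod_eq (R[i]).
- lmod_eq (R[i]).
Qed.

End Unitary.
End UnitalCstar.

(** * Coefficients of polynomials bounded on the unit circle *)

Section CoefficientBound.
Variable R : realType.

Lemma exists_prim_root n : (0 < n)%N -> exists w : R[i], n.-primitive_root w.
Proof.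
move=> n0; have [rs Drs] := closed_field_poly_normal ('X^n - 1 : {poly R[i]}).
have mon : 'X^n - 1 \is @monic R[i] by rewrite monicXnsubC.
rewrite (monicP mon) scale1r in Drs.
have sz : size rs = n.
  by have := congr1 (fun p : {poly R[i]} => size p) Drs; rewrite size_XnsubC // size_prod_XsubC => -[].
suff : has n.-primitive_root rs by move=> /hasP[w _ hw]; exists w.
apply: has_prim_root => //; rewrite ?sz //.
  by apply/allP=> z; rewrite -root_prod_XsubC -Drs.
rewrite -separable_prod_XsubC -Drs separable_Xn_sub_1 //.
by rewrite pnatr_eq0 -lt0n.
Qed.

(* Average Q over the m-th roots of unity. *)
Lemma coef_bound (Q : {poly R[i]}) m M l : (0 < m)%N -> (size Q <= m)%N ->
  (forall z, cabs z = 1 -> cabs Q.[z] <= M) -> (l < m)%N -> cabs Q`_l <= M.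
Proof.
move=> m0 sQ hM lm; have [w pw] := exists_prim_root m0.
have wm : w ^+ m = 1 by apply: prim_expr_order.
have w0 : w != 0 by rewrite (prim_root_eq0 pw) -lt0n.
have aw : cabs w = 1.
  apply/eqP; rewrite -(@eqrXn2 _ m) ?cabs_ge0 // expr1n -cabsX wm; exact/eqP/cabs1.
have geo k : (k < m)%N -> \sum_(j < m) (w ^+ j) ^+ k * w^-1 ^+ (j * l) = (k == l)%:R *+ m.
  move=> km; have e j : (w ^+ j) ^+ k * w^-1 ^+ (j * l) = (w ^+ k / w ^+ l) ^+ j.
    by rewrite exprMn !exprVn -!exprM (mulnC k) (mulnC l).
  under eq_bigr do rewrite e.
  have [->|kl] := eqVneq k l.
    rewrite divff ?expf_neq0 //; under eq_bigr do rewrite expr1n.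
    by rewrite sumr_const card_ord.
  rewrite mul0rn; set z := w ^+ k / w ^+ l.
  have zn1 : z - 1 != 0.
    rewrite subr_eq0; apply: contra kl => /eqP/(congr1 (fun x => x * w ^+ l)).
    rewrite mul1r divfK ?expf_neq0 // => /eqP; rewrite (eq_prim_root_expr pw).
    by rewrite !modn_small.
  apply: (mulfI zn1); rewrite mulr0 -subrX1.
  by rewrite /z expr_div_n -!exprM -!(mulnC m) !exprM wm !expr1n divr1 subrr.
have key : \sum_(j < m) Q.[w ^+ j] * w^-1 ^+ (j * l) = Q`_l *+ m.
  under eq_bigr do rewrite (horner_coef_wide _ sQ) mulr_suml.
  rewrite exchange_big /=.
  under eq_bigr do under eq_bigr do rewrite -mulrA.
  under eq_bigr do rewrite -mulr_sumr geo //.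
  rewrite (bigD1 (Ordinal lm)) //= eqxx mulr1n big1 ?addr0 -?mulrnAr ?mulr1 //.
    by rewrite mulr_natr.
  by move=> i; rewrite -val_eqE /= => /negbTE ->; rewrite mul0rn mulr0.
have mM : cabs (Q`_l) * m%:R <= M * m%:R.
  have -> : cabs Q`_l * m%:R = cabs (Q`_l *+ m).
    by rewrite -[Q`_l *+ m]mulr_natr cabsM -(rmorph_nat (real_complex R)) cabs_nneg.
  rewrite -key; apply: (@le_trans _ _ (\sum_(j < m) M)); last first.
    by rewrite sumr_const card_ord mulr_natr.
  apply: (@le_trans _ _ (\sum_(j < m) cabs (Q.[w ^+ j] * w^-1 ^+ (j * l)))).
    elim/big_ind2: _ => [|x y x' y' h h'|//]; first by rewrite cabs0.
    by apply: le_trans (cabsD _ _) _; apply: lerD.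
  apply: ler_sum => j _; rewrite cabsM cabsX.
  have -> : cabs w^-1 = 1.
    by have := cabsM w w^-1; rewrite mulfV // aw cabs1 mul1r.
  by rewrite expr1n mulr1; apply: hM; rewrite cabsX aw expr1n.
by rewrite ler_pM2r ?ltr0n // in mM.
Qed.

End CoefficientBound.

(** * Real polynomials in a self-adjoint contraction *)

Section PolynomialCalculus.
Variables (R : realType) (E : algType R[i]) (star : E -> E) (nE : E -> R).
Hypothesis hE : unital_cstar star nE.
Let nEP := uc_norm hE.
Let nEM := uc_normM hE.
Variable h : E.
Hypotheses (h_sa : star h = h) (h1 : nE h <= 1).

Definition pol (p : {poly R}) : E := horner_alg h (map_poly (real_complex R) p).

Lemma polD p q : pol (p + q) = pol p + pol q.
Proof. by rewrite /pol rmorphD /= raddfD. Qed.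
Lemma polB p q : pol (p - q) = pol p - pol q.
Proof. by rewrite /pol rmorphB /= raddfB. Qed.
Lemma polM p q : pol (p * q) = pol p * pol q.
Proof. by rewrite /pol rmorphM /= rmorphM. Qed.
Lemma polXn p n : pol (p ^+ n) = pol p ^+ n.
Proof. by rewrite /pol rmorphXn /= rmorphXn. Qed.
Lemma polX : pol 'X = h.
Proof. by rewrite /pol map_polyX horner_algX. Qed.
Lemma polC c : pol c%:P = c%:C%:A.
Proof. by rewrite /pol map_polyC horner_algC. Qed.
Lemma pol_sum I (r : seq I) (F : I -> {poly R}) : pol (\sum_(i <- r) F i) = \sum_(i <- r) pol (F i).
Proof. by rewrite /pol !rmorph_sum. Qed.

Lemma polE p : pol p = \sum_(i < size p) (p`_i)%:C *: h ^+ i.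
Proof.
rewrite -{1}[p]coefK poly_def pol_sum; apply: eq_bigr => i _.
by rewrite -mul_polyC polM polC polXn polX mulr_algl.
Qed.

Lemma pol_sa p : star (pol p) = pol p.
Proof.
rewrite polE (star_sum hE); apply: eq_bigr => i _.
by rewrite (starZr hE) (starX hE) h_sa.
Qed.

(* h is the real part of a unitary u, and u^n p(h) = Q(u) with Q of degree at most 2n
   and |Q(z)| = |p(Re z)| on the unit circle. *)
Lemma pol_rough_bound (p : {poly R}) n M : (size p <= n.+1)%N ->
  (forall t, -1 <= t <= 1 -> `|p.[t]| <= M) -> nE (pol p) <= (2 * n).+1%:R * M.
Proof.
move=> sp hM; have [u [uu' uu he]] := exists_unitary hE h_sa h1.
pose half := 'X^2 + 1 : {poly R[i]}.
(* On the unit circle [z^2 + 1 = 2 z Re z], so the k-th term becomes [z^n p_k (Re z)^k]; in the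
   algebra [u^2 + 1 = 2 u h] plays the same part. *)
pose Q : {poly R[i]} := \sum_(k < n.+1) (p`_k / 2 ^+ k)%:C *: ('X^(n - k) * half ^+ k).
have sQ : (size Q <= (2 * n).+1)%N.
  apply: (leq_trans (size_sum _ _ _)); apply/bigmax_leqP => k _.
  apply: (leq_trans (size_scale_leq _ _)); apply: (leq_trans (size_polyMleq _ _)).
  rewrite size_polyXn /=; have sh : size half = 3 by rewrite size_polyDl ?size_polyXn ?size_poly1.
  have := size_poly_exp_leq half k; rewrite sh /= => h2.
  by have kn := ltn_ord k; lia.
have algE (a : E) (P : {poly R[i]}) m : (size P <= m)%N -> horner_alg a P = \sum_(i < m) P`_i *: a ^+ i.
  move=> sP; have {1}-> : P = \sum_(i < m) P`_i *: 'X^i.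
    rewrite -poly_def; apply/polyP => i; rewrite coef_poly; case: ltnP => // mi.
    by rewrite nth_default // (leq_trans sP).
  rewrite raddf_sum /=.
  apply: eq_bigr => i _.
  by rewrite -mul_polyC rmorphM rmorphXn /= horner_algC horner_algX mulr_algl.
have M0 : 0 <= M by apply: le_trans (hM 0 _); rewrite ?normr_ge0 // lerN10 ler01.
have nu : nE u <= 1 := nE_isometry hE uu'.
have nsu : nE (star u) <= 1 by rewrite (nE_star hE).
have powle (a : E) l : nE a <= 1 -> nE (a ^+ l) <= 1.
  by move=> a1; apply: le_trans (nEX hE _ _) _; rewrite exprn_ile1 // (nE_ge0 hE).
have circ z : cabs z = 1 -> cabs Q.[z] <= M.
  move=> z1; have zz : z * z^*%C = 1 by rewrite -sqr_normc cabsE z1 expr1n.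
  have rz : z + z^*%C = (2 * complex.Re z)%:C.
    by case: (z) => a b; apply/eqP; rewrite eq_complex /= subrr eqxx andbT; apply/eqP; ring.
  have -> : Q.[z] = z ^+ n * (p.[complex.Re z])%:C.
    rewrite horner_sum (horner_coef_wide _ sp) rmorph_sum mulr_sumr; apply: eq_bigr => k _.
    have hh : half.[z] = z ^+ 2 + 1 by rewrite /half !hornerE.
    rewrite hornerZ hornerM !horner_exp hornerX hh.
    have -> : z ^+ 2 + 1 = z * (2 * complex.Re z)%:C by rewrite -rz mulrDr zz expr2.
    rewrite exprMn (mulrA (z ^+ _)) -exprD subnK; last by rewrite -ltnS.
    rewrite mulrCA; congr (_ * _); rewrite -(rmorphXn (real_complex R)) -(rmorphM (real_complex R)) /=; congr (_%:C).
    by rewrite exprMn mulrA divfK // expf_neq0 // pnatr_eq0.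
  rewrite cabsM cabsX z1 expr1n mul1r cabs_real; apply: hM.
  by rewrite -ler_norml; have := normc_ge_Re z; rewrite cabsE z1 lecR.
have Qu : horner_alg u Q = u ^+ n * pol p.
  rewrite /pol (algE h _ n.+1) ?size_map_poly // /Q raddf_sum mulr_sumr.
  have hh : horner_alg u half = u ^+ 2 + 1 by rewrite /half rmorphD rmorph1 rmorphXn /= horner_algX.
  have uh : u * h = h * u by rewrite he -scalerAl -scalerAr mulrDl mulrDr uu uu'.
  have u2 : u ^+ 2 + 1 = 2 *: (u * h).
    by rewrite he -scalerAr scalerA mulfV ?pnatr_eq0 // scale1r mulrDr uu expr2.
  apply: eq_bigr => k _; set c := (_ / _)%:C.
  rewrite -[_ *: (_ * _)]mul_polyC /= rmorphM /= horner_algC mulr_algl rmorphM !rmorphXn /= hh u2 horner_algX.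
  rewrite exprZn exprMn_comm // -!scalerAr mulrA -exprD subnK; last by rewrite -ltnS.
  rewrite scalerA coef_map /= /c; congr (_ *: _).
  by rewrite -(rmorph_nat (real_complex R)) -(rmorphXn (real_complex R)) -(rmorphM (real_complex R)) /= divfK // expf_neq0 // pnatr_eq0.
have -> : pol p = star u ^+ n * horner_alg u Q.
  have e m : star u ^+ m * u ^+ m = 1.
    elim: m => [|m IH]; first by rewrite mulr1.
    by rewrite exprSr exprS -mulrA (mulrA _ u) uu' mul1r.
  by rewrite Qu mulrA e mul1r.
apply: le_trans (nEM _ _) _; apply: (@le_trans _ _ (1 * nE (horner_alg u Q))).
  by apply: ler_wpM2r; rewrite ?(nE_ge0 hE) // powle.
rewrite mul1r (algE _ _ _ sQ); apply: le_trans (nE_sum hE _ _) _.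
apply: (@le_trans _ _ (\sum_(i < (2 * n).+1) M)); last by rewrite sumr_const card_ord mulr_natl.
apply: ler_sum => i _; rewrite (nrmZ nEP) -[leRHS]mulr1.
apply: ler_pM; rewrite ?cabs_ge0 ?(nE_ge0 hE) ?powle //.
exact: coef_bound sQ circ _.
Qed.

Lemma nE_sq_sa (a : E) r s : star a = a -> 0 <= r -> nE (a ^+ (2 ^ s)) <= r ^+ (2 ^ s) -> nE a <= r.
Proof.
move=> a_sa r0; elim: s => [|s IH]; first by rewrite !expr1.
rewrite expnSr !exprM => h2; apply: IH.
have := uc_normE hE (a ^+ (2 ^ s)); rewrite (starX hE) a_sa -expr2 => h3.
rewrite -(@ler_pXn2r _ 2) ?nnegrE ?exprn_ge0 ?(nE_ge0 hE) //.
exact: le_trans h3 h2.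
Qed.

(* Apply the rough bound to the powers p^(2^s) and use |a^2| = |a|^2 for self-adjoint a. *)
Lemma pol_bound (p : {poly R}) M :
  (forall t, -1 <= t <= 1 -> `|p.[t]| <= M) -> nE (pol p) <= M.
Proof.
move=> hM; pose n := size p.
have M0 : 0 <= M by apply: le_trans (hM 0 _); rewrite ?normr_ge0 // lerN10 ler01.
have pw s : nE (pol p ^+ (2 ^ s)) <= (2 * (n * 2 ^ s)).+1%:R * M ^+ (2 ^ s).
  rewrite -polXn; apply: pol_rough_bound.
    by apply: leq_trans (size_poly_exp_leq _ _) _; rewrite ltnS leq_mul2r leq_pred orbT.
  by move=> t ht; rewrite horner_exp normrX; apply: lerXn2r; rewrite ?nnegrE ?hM.
have [M00|M00] := eqVneq M 0.
  by have := pw 0%N; rewrite expr1 M00 expr1 mulr0.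
have Mp : 0 < M by rewrite lt_neqAle eq_sym M00.
apply: nrm_le_eps => e e0.
pose d := e / M; have d0 : 0 < d by rewrite divr_gt0.
(* The rough factor at exponent [2^(s+1)] is [4 n 2^s + 1]. Bernoulli's inequality, squared, bounds
   [(1 + d)^(2^(s+1))] below by [(1 + 2^s d)^2], which exceeds that factor for such an [s]. *)
have [s hs] : exists s, 4 * n%:R / d ^+ 2 <= 2 ^+ s :> R.
  have := archi_boundP (_ : 0 <= 4 * n%:R / d ^+ 2); set k := Num.bound _ => hk.
  exists k; apply: le_trans (ltW (hk _)) _; first by rewrite divr_ge0 ?sqr_ge0 // mulr_ge0.
  by rewrite -natrX ler_nat ltnW // ltn_expl.
apply: (@nE_sq_sa _ _ s.+1); [exact: pol_sa|by rewrite addr_ge0 // ltW|].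
apply: le_trans (pw _) _.
have -> : M + e = (1 + d) * M by rewrite /d mulrDl mul1r divfK.
rewrite exprMn; apply: ler_wpM2r; first exact: exprn_ge0.
have bern k : 1 + k%:R * d <= (1 + d) ^+ k.
  elim: k => [|k IH]; first by rewrite mul0r addr0.
  rewrite exprS -natr1; have : 0 <= k%:R :> R by []. nra.
have := bern (2 ^ s)%N; rewrite natrX => h2.
rewrite expnSr exprM -natr1 !natrM natrX.
rewrite ler_pdivrMr ?exprn_gt0 // in hs.
have N0 : 0 < 2 ^+ s :> R by rewrite exprn_gt0.
have h3 : (1 + 2 ^+ s * d) ^+ 2 <= ((1 + d) ^+ (2 ^ s)) ^+ 2.
  apply: lerXn2r => //; rewrite nnegrE; first by rewrite addr_ge0 // mulr_ge0 // ltW.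
  by rewrite exprn_ge0 // addr_ge0 // ltW.
apply: le_trans h3; rewrite expr2; move: (2 ^+ s) n%:R hs N0 => N k hs N0.
rewrite expr2 in hs; nra.
Qed.

End PolynomialCalculus.

Lemma half_pow_le (R : realType) m n : (m <= n)%N -> 2^-1 ^+ n <= 2^-1 ^+ m :> R.
Proof. by move=> mn; apply: ler_wiXn2l mn; rewrite ?invr_ge0 ?invf_le1 //; lra. Qed.

(** * Uniform limits of real polynomials on [-1, 1] *)

Section Approximable.
Variable R : realType.
Implicit Types (f g : R -> R) (p q : {poly R}) (t e M : R).

(** Stands in for continuity on [-1, 1]. Membership in the uniform closure of the polynomials is
    proved operation by operation, so Weierstrass' theorem is not invoked. *)
Definition approximable f :=
  forall e, 0 < e -> exists p, forall t, -1 <= t <= 1 -> `|p.[t] - f t| <= e.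

Lemma poly_bounded p : exists M, forall t, -1 <= t <= 1 -> `|p.[t]| <= M.
Proof.
exists (\sum_(i < size p) `|p`_i|) => t ht; rewrite horner_coef.
apply: le_trans (ler_norm_sum _ _ _) _; apply: ler_sum => i _.
rewrite normrM normrX ler_piMr // exprn_ile1 // ler_norml; lra.
Qed.

Lemma approximable_bounded f : approximable f ->
  exists2 M, 0 < M & forall t, -1 <= t <= 1 -> `|f t| <= M.
Proof.
move=> /(_ 1 ltr01)[p hp]; have [M hM] := poly_bounded p.
exists (`|M| + 2) => [|t ht]; first by have := normr_ge0 M; lra.
have := hp t ht; have := hM t ht; have := ler_norm M; rewrite distrC.
have := lerB_dist (f t) p.[t]; lra.
Qed.

Lemma approximable_poly p : approximable (fun t => p.[t]).
Proof. by move=> e e0; exists p => t _; rewrite subrr normr0 ltW. Qed.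

Lemma approximable_cst (c : R) : approximable (fun=> c).
Proof. by move=> e e0; exists c%:P => t _; rewrite hornerC subrr normr0 ltW. Qed.

Lemma approximable_id : approximable id.
Proof. by move=> e e0; exists 'X => t _; rewrite hornerX subrr normr0 ltW. Qed.

Lemma approximable_ext f g : (forall t, -1 <= t <= 1 -> f t = g t) ->
  approximable f -> approximable g.
Proof. by move=> fg h e /h[p hp]; exists p => t ht; rewrite -fg // hp. Qed.

Lemma approximable_lim f :
  (forall e, 0 < e -> exists2 g, approximable g & forall t, -1 <= t <= 1 -> `|g t - f t| <= e) ->
  approximable f.
Proof.
move=> h e e0; have e2 : 0 < e / 2 by rewrite divr_gt0.
have [g ag gf] := h _ e2; have [p hp] := ag _ e2; exists p => t ht.
have := ler_distD (g t) p.[t] (f t); have := hp t ht; have := gf t ht; lra.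
Qed.

Lemma approximableD f g : approximable f -> approximable g -> approximable (fun t => f t + g t).
Proof.
move=> hf hg e e0; have e2 : 0 < e / 2 by rewrite divr_gt0.
have [p hp] := hf _ e2; have [q hq] := hg _ e2; exists (p + q) => t ht.
rewrite hornerD opprD addrACA; apply: le_trans (ler_normD _ _) _.
have := hp t ht; have := hq t ht; lra.
Qed.

Lemma prod_close (a b x y M K e : R) : 0 < e -> 0 < M -> 0 < K -> `|x| <= M -> `|y| <= K ->
  `|a - x| <= Num.min 1 (e / (M + K + 1)) -> `|b - y| <= Num.min 1 (e / (M + K + 1)) ->
  `|a * b - x * y| <= e.
Proof.
move=> e0 M0 K0 hx hy; have B0 : 0 < M + K + 1 by lra.
rewrite !le_min !ler_pdivlMr // => /andP[h1 h2] /andP[h3 h4].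
have -> : a * b - x * y = (a - x) * (b - y) + (a - x) * y + x * (b - y) by ring.
apply: le_trans (ler_normD _ _) _; apply: le_trans (lerD (ler_normD _ _) (lexx _)) _.
rewrite !normrM; have := normr_ge0 (a - x); have := normr_ge0 (b - y).
have := normr_ge0 x; have := normr_ge0 y.
move: `|a - x| `|b - y| `|x| `|y| hx hy h1 h2 h3 h4 => A B X Y hx hy h1 h2 h3 h4 Y0 X0 B1 A0.
have i1 : A * B <= A by nra.
have i2 : A * Y <= A * K by nra.
have i3 : X * B <= M * B by nra.
have [AB|BA] := leP A B; nra.
Qed.

Lemma approximableM f g : approximable f -> approximable g -> approximable (fun t => f t * g t).
Proof.
move=> hf hg e e0; have [M M0 hM] := approximable_bounded hf.
have [K K0 hK] := approximable_bounded hg.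
have e2 : 0 < Num.min 1 (e / (M + K + 1)) by rewrite lt_min ltr01 divr_gt0 //; lra.
have [p hp] := hf _ e2; have [q hq] := hg _ e2; exists (p * q) => t ht.
by rewrite hornerM; apply: (prod_close (M := M) (K := K)); auto.
Qed.

Lemma approximableZ (c : R) f : approximable f -> approximable (fun t => c * f t).
Proof. by move=> hf; apply: approximableM => //; apply: approximable_cst. Qed.

Lemma approximableB f g : approximable f -> approximable g -> approximable (fun t => f t - g t).
Proof.
move=> hf hg; apply: (approximable_ext (f := fun t => f t + (-1) * g t)).
  by move=> t _; rewrite mulN1r.
by apply: approximableD => //; apply: approximableZ.
Qed.

(* 1 - sqrt g is the uniform limit of the iteration y |-> ((1 - g) + y^2) / 2. *)
Lemma approximable_sqrt f : approximable f -> (forall t, -1 <= t <= 1 -> 0 <= f t) ->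
  approximable (fun t => Num.sqrt (f t)).
Proof.
move=> hf f0; have [M M0 hM] := approximable_bounded hf.
pose g t := f t / M.
have ag : approximable g.
  by apply: (approximable_ext (f := fun t => M^-1 * f t)) (approximableZ _ hf) => t _; rewrite /g mulrC.
have g01 t : -1 <= t <= 1 -> 0 <= g t <= 1.
  move=> ht; rewrite /g; apply/andP; split; first by apply: divr_ge0 (f0 t ht) (ltW M0).
  by rewrite ler_pdivrMr // mul1r; apply: le_trans (ler_norm _) (hM t ht).
suff ah : approximable (fun t => Num.sqrt (g t)).
  apply: (approximable_ext (f := fun t => Num.sqrt M * Num.sqrt (g t))) (approximableZ _ ah).
  by move=> t _; rewrite -sqrtrM ?ltW // /g mulrC divfK // gt_eqF.
pose y := fix y n t : R := if n is k.+1 then ((1 - g t) + y k t ^+ 2) / 2 else 0.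
have ay n : approximable (y n).
  elim: n => [|n IH]; first exact: approximable_cst.
  apply: (approximable_ext (f := fun t => 2^-1 * ((1 - g t) + y n t * y n t))).
    by move=> t _; rewrite /= expr2 mulrC.
  apply: approximableZ; apply: approximableD; last exact: approximableM.
  by apply: approximableB => //; apply: approximable_cst.
apply: approximable_lim => e e0; have [N hN] := dom_seq_lim e0.
exists (fun t => 1 - y N t); first by apply: approximableB (approximable_cst _) (ay N).
move=> t ht; have /andP[g0 g1] := g01 t ht.
have s0 := sqrtr_ge0 (g t); have gw := esym (sqr_sqrtr g0).
have s1 : Num.sqrt (g t) <= 1 by rewrite -sqrtr1 ler_wsqrtr.
move: (Num.sqrt (g t)) s0 s1 gw => w w0 w1 gw.
(* The slowest case is [g t = 0], where [y n t] is [dom_seq R n]; the last component bounds the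
   error at every [t] by the error there. *)
have key n : [/\ 0 <= y n t, y n t <= dom_seq R n, y n t <= 1 - w &
    1 - w - y n t <= 1 - dom_seq R n].
  elim: n => [|n [k1 k2 k3 k4]] /=; first by split; lra.
  rewrite gw; have := dom_seq_le1 R n; have := dom_seq_ge0 R n.
  move: (y n t) (dom_seq R n) k1 k2 k3 k4 => z d k1 k2 k3 k4 d0 d1.
  split; first by rewrite divr_ge0 // addr_ge0 ?sqr_ge0 // subr_ge0; nra.
  - rewrite ler_pM2r ?invr_gt0 //; nra.
  - rewrite ler_pdivrMr //; nra.
  - rewrite -(@ler_pM2r _ 2) // !mulrBl !divfK ?pnatr_eq0 //.
    have : (1 - w - z) * (1 - w + z) <= (1 - d) * (1 + d) by apply: ler_pM; lra.
    nra.
have [k1 k2 k3 k4] := key N.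
rewrite ler_norml; lra.
Qed.

Lemma approximable_norm f : approximable f -> approximable (fun t => `|f t|).
Proof.
move=> hf; apply: (approximable_ext (f := fun t => Num.sqrt (f t * f t))).
  by move=> t _; rewrite -expr2 sqrtr_sqr.
by apply: approximable_sqrt => [|t _]; [apply: approximableM|rewrite -expr2 sqr_ge0].
Qed.

Lemma approximable_max f g : approximable f -> approximable g ->
  approximable (fun t => Num.max (f t) (g t)).
Proof.
move=> hf hg; apply: (approximable_ext (f := fun t => 2^-1 * ((f t + g t) + `|f t - g t|))).
  by move=> t _; rewrite maxr_absE mulrC.
apply: approximableZ; apply: approximableD; first exact: approximableD.
by apply: approximable_norm; apply: approximableB.
Qed.

Lemma approximable_min f g : approximable f -> approximable g ->
  approximable (fun t => Num.min (f t) (g t)).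
Proof.
move=> hf hg; apply: (approximable_ext (f := fun t => 2^-1 * ((f t + g t) - `|f t - g t|))).
  by move=> t _; rewrite minr_absE mulrC.
apply: approximableZ; apply: approximableB; first exact: approximableD.
by apply: approximable_norm; apply: approximableB.
Qed.

End Approximable.

(** * Continuous functions of a self-adjoint contraction *)

Section FunctionalCalculus.
Variables (R : realType) (E : algType R[i]) (star : E -> E) (nE : E -> R).
Hypothesis hE : unital_cstar star nE.
Let nEP := uc_norm hE.
Let nEM := uc_normM hE.
Variable h : E.
Hypotheses (h_sa : star h = h) (h1 : nE h <= 1).
Implicit Types (f g : R -> R) (a b : E).

(* a = f(h): the same polynomials approximate f on [-1, 1] and a in norm. *)
Definition fcalc f a := forall e, 0 < e ->
  exists p, (forall t, -1 <= t <= 1 -> `|p.[t] - f t| <= e) /\ nE (pol h p - a) <= e.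

Lemma fcalc_exists f : approximable f -> exists a, fcalc f a.
Proof.
move=> hf; have en0 n : 0 < 2^-1 ^+ n :> R by rewrite exprn_gt0 ?invr_gt0.
have [p hp] := choice (fun n => hf _ (en0 n.+1)).
have [|l hl] := @tends_geometric R E nE nEP (fun k => pol h (p k)) (uc_complete hE).
  move=> k; rewrite -polB; apply: (pol_bound hE h_sa h1) => t ht; rewrite hornerD hornerN.
  have := ler_distD (f t) (p k.+1).[t] (p k).[t]; rewrite (distrC (f t)).
  have := hp k t ht; have := hp k.+1 t ht; have := en0 k; rewrite !exprS; lra.
exists l => e e0; have [N hN] := hl _ e0; have [M hM] := half_pow_small e0.
exists (p (maxn N M)); split=> [t ht|]; last by apply: hN; apply: leq_maxl.
apply: le_trans (hp _ t ht) _; apply: le_trans hM.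
by apply: half_pow_le; apply/leqW/leq_maxr.
Qed.

Lemma fcalc_poly p : fcalc (fun t => p.[t]) (pol h p).
Proof. by move=> e e0; exists p; rewrite subrr (nrm0 nEP); split=> [t _|]; rewrite ?subrr ?normr0 ltW. Qed.

Lemma fcalc_id : fcalc id h.
Proof.
move=> e e0; exists 'X; rewrite polX subrr (nrm0 nEP); split=> [t _|]; last exact: ltW.
by rewrite hornerX subrr normr0 ltW.
Qed.

Lemma fcalc_cst (c : R) : fcalc (fun=> c) (c%:C%:A).
Proof.
move=> e e0; exists c%:P; rewrite polC subrr (nrm0 nEP); split=> [t _|]; last exact: ltW.
by rewrite hornerC subrr normr0 ltW.
Qed.

Lemma fcalc_approximable f a : fcalc f a -> approximable f.
Proof. by move=> hf e /hf[p [hp _]]; exists p. Qed.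

Lemma fcalc_bound f a M : fcalc f a -> (forall t, -1 <= t <= 1 -> `|f t| <= M) -> nE a <= M.
Proof.
move=> hf hM; apply: nrm_le_eps => e e0; have e2 : 0 < e / 2 by rewrite divr_gt0.
have [p [hp pa]] := hf _ e2.
have : nE (pol h p) <= M + e / 2.
  apply: (pol_bound hE h_sa h1) => t ht; have := hM t ht; have := hp t ht.
  have := lerB_dist p.[t] (f t); lra.
have := nrm_near nEP a (pol h p); rewrite (nrmC nEP); lra.
Qed.

Lemma fcalcD f g a b : fcalc f a -> fcalc g b -> fcalc (fun t => f t + g t) (a + b).
Proof.
move=> hf hg e e0; have e2 : 0 < e / 2 by rewrite divr_gt0.
have [p [hp pa]] := hf _ e2; have [q [hq qb]] := hg _ e2; exists (p + q); split=> [t ht|].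
  rewrite hornerD opprD addrACA; apply: le_trans (ler_normD _ _) _.
  have := hp t ht; have := hq t ht; lra.
rewrite polD opprD addrACA; apply: le_trans (nrmD nEP _ _) _; lra.
Qed.

Lemma fcalcM f g a b : fcalc f a -> fcalc g b -> fcalc (fun t => f t * g t) (a * b).
Proof.
move=> hf hg e e0; have [M M0 hM] := approximable_bounded (fcalc_approximable hf).
have [K K0 hK] := approximable_bounded (fcalc_approximable hg).
have a0 := fcalc_bound hf hM; have b0 := fcalc_bound hg hK.
have na := nrm_ge0 nEP a; have nb := nrm_ge0 nEP b.
have e2 : 0 < Num.min 1 (e / (M + K + 1)) by rewrite lt_min ltr01 divr_gt0 //; lra.
have [p [hp pa]] := hf _ e2; have [q [hq qb]] := hg _ e2; exists (p * q); split=> [t ht|].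
  by rewrite hornerM; apply: (prod_close (M := M) (K := K)); auto.
rewrite polM; have -> : pol h p * pol h q - a * b =
    (pol h p - a) * (pol h q - b) + (pol h p - a) * b + a * (pol h q - b).
  by algebra_eq (R[i]).
apply: le_trans (nrmD nEP _ _) _; apply: le_trans (lerD (nrmD nEP _ _) (lexx _)) _.
have := nEM (pol h p - a) (pol h q - b); have := nEM (pol h p - a) b.
have := nEM a (pol h q - b).
have := nrm_ge0 nEP (pol h p - a); have := nrm_ge0 nEP (pol h q - b).
move: pa qb; rewrite !le_min !ler_pdivlMr; [|lra|lra] => /andP[h2 h3] /andP[h4 h5].
move: (nE (pol h p - a)) (nE (pol h q - b)) (nE a) (nE b) h2 h3 h4 h5 a0 b0 na nb.
move=> A B X Y h2 h3 h4 h5 a0 b0 na nb B0 A0 k1 k2 k3.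
have i1 : A * B <= A by nra.
have i2 : A * Y <= A * K by nra.
have i3 : X * B <= M * B by nra.
have [AB|BA] := leP A B; nra.
Qed.

Lemma fcalcZ (c : R) f a : fcalc f a -> fcalc (fun t => c * f t) (c%:C *: a).
Proof. by move=> /(fcalcM (fcalc_cst c)); rewrite mulr_algl. Qed.

Lemma fcalcB f g a b : fcalc f a -> fcalc g b -> fcalc (fun t => f t - g t) (a - b).
Proof.
move=> hf /(fcalcZ (-1)) /(fcalcD hf); rewrite rmorphN1 scaleN1r => H e /H[p [hp pa]].
by exists p; split=> // t /hp; rewrite mulN1r.
Qed.

Lemma fcalc_eq f g a b : (forall t, -1 <= t <= 1 -> f t = g t) ->
  fcalc f a -> fcalc g b -> a = b.
Proof.
move=> fg hf hg; apply/eqP; rewrite -subr_eq0; apply/eqP; apply: (nrm_eq0 nEP); apply/eqP.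
rewrite eq_le (nrm_ge0 nEP) andbT; apply: (fcalc_bound (fcalcB hf hg)) => t /fg ->.
by rewrite subrr normr0.
Qed.

Lemma fcalc_mul_eq f g k a b c : (forall t, -1 <= t <= 1 -> f t * g t = k t) ->
  fcalc f a -> fcalc g b -> fcalc k c -> a * b = c.
Proof. by move=> e hf hg hk; apply: fcalc_eq e (fcalcM hf hg) hk. Qed.

Lemma fcalc_sa f a : fcalc f a -> star a = a.
Proof.
move=> hf; apply/eqP; rewrite -subr_eq0; apply/eqP; apply: (nrm_small0 nEP) => e e0.
have e2 : 0 < e / 2 by rewrite divr_gt0.
have [p [_ pa]] := hf _ e2; have := nrm_dist3 nEP (pol h p) (star a) a.
have -> : star a - pol h p = star (a - pol h p) by rewrite (starB hE) (pol_sa hE h_sa).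
rewrite (nE_star hE) (nrmC nEP a); lra.
Qed.

Lemma fcalc_pow_bounded f a : fcalc f a -> (forall t, -1 <= t <= 1 -> 0 <= f t <= 1) ->
  exists K, forall n, nE (a ^+ n) <= K.
Proof.
move=> hf f01; exists 1 => n; apply: le_trans (nEX hE _ _) _.
apply: exprn_ile1; first exact: (nE_ge0 hE).
by apply: (fcalc_bound hf) => t /f01/andP[f0 f1]; rewrite ger0_norm.
Qed.

(** As [f 0 = 0], the approximating polynomials may be corrected to have no constant term; their
    values at [h] are then multiples of [h]. *)
Lemma fcalc_ideal (N : E -> Prop) f a :
  (forall u l, (forall k, N (u k)) -> tends nE u l -> N l) ->
  (forall x y, N x -> N (x * y)) -> N h -> f 0 = 0 -> fcalc f a -> N a.
Proof.
move=> Ncl NM Nh f0 hf; have en0 n : 0 < 2^-1 ^+ n / 2 :> R by rewrite divr_gt0 ?exprn_gt0 ?invr_gt0.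
have [p hp] := choice (fun n => hf _ (en0 n)).
apply: (Ncl (fun n => pol h (p n - (p n).[0]%:P))).
  move=> n; have /factor_theorem[q ->] : root (p n - (p n).[0]%:P) 0.
    by rewrite rootE !hornerE subrr.
  by rewrite subr0 mulrC polM polX; apply: NM.
move=> e e0; have [M hM] := half_pow_small e0; exists M => k Mk.
have [h2 h3] := hp k; rewrite polB polC.
have h4 : nE ((p k).[0]%:C%:A : E) <= 2^-1 ^+ k / 2.
  rewrite (nrmZ nEP) cabs_real; have := h2 0; rewrite f0 subr0 lerN10 ler01 => /(_ isT).
  have := nE1 hE; have := nE_ge0 hE 1; have := normr_ge0 (p k).[0]; nra.
have h5 := half_pow_le R Mk.
rewrite addrAC; apply: le_trans (nrmB nEP _ _) _; lra.
Qed.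

End FunctionalCalculus.

(** * Cousin's lemma and annular cut-off functions *)

Section RealFunctions.
Variable R : realType.
Implicit Types (a b c t x y z : R).

(** Compactness of an interval for a transitive relation: the supremum of the points [x] with
    [Q a x] can be overstepped unless it is [b]. *)
Lemma cousin (Q : R -> R -> Prop) a b : a <= b ->
  (forall x y z, Q x y -> Q y z -> Q x z) ->
  (forall c, a <= c <= b -> exists2 d, 0 < d & forall x y, x <= c <= y -> y - x < d -> Q x y) ->
  Q a b.
Proof.
move=> ab Qtrans Qloc; pose S := [set x | a <= x <= b /\ Q a x]%classic.
have Sa : S a.
  have [d d0 hd] := Qloc a (introT andP (conj (lexx a) ab)).
  by split; [rewrite lexx|apply: hd; rewrite ?lexx ?subrr].
have hS : has_sup S by split; [exists a|exists b => x [/andP[_ ?] _]].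
have Sac : a <= sup S by apply: ub_le_sup => //; case: hS.
have Scb : sup S <= b by apply: ge_sup => [|x [/andP[_ ?] _]//]; exists a.
have [d d0 hd] := Qloc _ (introT andP (conj Sac Scb)).
have d2 : 0 < d / 2 by rewrite divr_gt0.
have [x [/andP[ax xb] Qax] hx] := sup_adherent d2 hS.
have xS : x <= sup S by apply: ub_le_sup; [case: hS|split=> //; apply/andP].
pose y := Num.min b (sup S + d / 2).
have yS : sup S <= y by rewrite le_min Scb lerDl ltW.
have Qay : Q a y.
  apply: (Qtrans _ x) => //; apply: hd; first by rewrite xS.
  have : y <= sup S + d / 2 by rewrite ge_min lexx orbT.
  lra.
have /ub_le_sup : S y.
  by split=> //; rewrite (le_trans Sac yS) /= ge_min lexx.
move=> /(_ (proj2 hS)) yc; suff <- : y = b by [].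
move: yc; rewrite /y; case: (leP b) => //; lra.
Qed.

(** A piecewise linear bump, 1 for [a <= |t - c| <= b] and 0 outside [a / 2 < |t - c| < 2 b].
    Halving [a] and doubling [b] therefore produces a function that is 1 on its support. *)
Definition annulus c a b t : R :=
  Num.max 0 (Num.min 1 (Num.min (2 / a * `|t - c| - 1) (2 - b^-1 * `|t - c|))).

Lemma annulus_approximable c a b : approximable (annulus c a b).
Proof.
have ab : approximable (fun t => `|t - c|).
  by apply: approximable_norm; apply: approximableB; [apply: approximable_id|apply: approximable_cst].
apply: approximable_max; first exact: approximable_cst.
apply: approximable_min; first exact: approximable_cst.
apply: approximable_min; apply: approximableB; try exact: approximable_cst;
  exact: approximableZ.
Qed.

Lemma annulus01 c a b t : 0 <= annulus c a b t <= 1.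
Proof. by rewrite /annulus le_max lexx /= ge_max ler01 ge_min lexx. Qed.

Lemma annulus_one c a b t : 0 < a -> 0 < b -> a <= `|t - c| <= b -> annulus c a b t = 1.
Proof.
move=> a0 b0 /andP[h1 h2].
have k1 : 1 <= 2 / a * `|t - c| - 1.
  have : 1 <= a^-1 * `|t - c| by rewrite mulrC ler_pdivlMr // mul1r.
  rewrite -mulrA; lra.
have k2 : 1 <= 2 - b^-1 * `|t - c|.
  have : b^-1 * `|t - c| <= 1 by rewrite mulrC ler_pdivrMr // mul1r.
  lra.
have -> : annulus c a b t = Num.max 0 1.
  by rewrite /annulus; congr Num.max; apply: min_l; rewrite le_min k1.
by rewrite max_r.
Qed.

Lemma annulus_zero c a b t : 0 < a -> 0 < b -> `|t - c| <= a / 2 \/ 2 * b <= `|t - c| ->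
  annulus c a b t = 0.
Proof.
move=> a0 b0 h; apply: max_l; rewrite !ge_min; apply/orP; right; apply/orP.
case: h => h; [left|right].
  have : a^-1 * `|t - c| <= 2^-1 by rewrite mulrC ler_pdivrMr // mulrC.
  rewrite -mulrA; lra.
have : 2 <= b^-1 * `|t - c| by rewrite mulrC ler_pdivlMr.
lra.
Qed.

Lemma annulus_nested c a b t : 0 < a -> 0 < b ->
  annulus c a b t * annulus c (a / 2) (2 * b) t = annulus c a b t.
Proof.
move=> a0 b0; have [h1|h1] := leP `|t - c| (a / 2).
  by rewrite annulus_zero ?mul0r //; left.
have [h2|h2] := leP (2 * b) `|t - c|; first by rewrite annulus_zero ?mul0r //; right.
by rewrite [X in _ * X]annulus_one ?mulr1 ?divr_gt0 ?mulr_gt0 // !ltW.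
Qed.

End RealFunctions.

(** * Self-adjoint elements are algebraic modulo the ideal *)

Section SpectralPolynomial.
Variables (R : realType) (E : algType R[i]) (star : E -> E) (nE : E -> R).
Hypothesis hE : unital_cstar star nE.
Variable N : E -> Prop.
Hypotheses (ND : forall x y, N x -> N y -> N (x + y))
  (NMr : forall x y, N x -> N (x * y))
  (Ncl : forall u l, (forall k, N (u k)) -> tends nE u l -> N l).
Hypothesis Nnested : forall e f2 f1 f : nat -> E,
  (forall i j, i != j -> e i * e j = 0) ->
  (forall i, exists K, forall n, nE (e i ^+ n) <= K) ->
  (forall i, star (f i) = f i) ->
  (forall i, e i * f2 i = f2 i) -> (forall i, f2 i * e i = f2 i) ->
  (forall i, f2 i * f1 i = f1 i) -> (forall i, f1 i * f2 i = f1 i) ->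
  (forall i, f1 i * f i = f i) -> (forall i, f i * f1 i = f i) ->
  exists i, N (f i).
Variable h : E.
Hypotheses (h_sa : star h = h) (h1 : nE h <= 1).

Let fc := fcalc nE h.
Let inI f := exists2 a, fc f a & N a.

Lemma inI_mul f g : inI f -> approximable g -> inI (fun t => f t * g t).
Proof.
move=> [a fa Na] /(fcalc_exists hE h_sa h1)[b gb]; exists (a * b); last exact: NMr.
exact: (fcalcM hE h_sa h1 fa gb).
Qed.

Lemma fcalc_ext f g a : (forall t, -1 <= t <= 1 -> f t = g t) -> fc f a -> fc g a.
Proof. by move=> fg H e /H[p [hp pa]]; exists p; split=> // t ht; rewrite -fg ?hp. Qed.

Lemma inI_ext f g : (forall t, -1 <= t <= 1 -> f t = g t) -> inI f -> inI g.
Proof. by move=> fg [a fa Na]; exists a => //; apply: fcalc_ext fa. Qed.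

Lemma inI_add f g : inI f -> inI g -> inI (fun t => f t + g t).
Proof. by move=> [a fa Na] [b gb Nb]; exists (a + b); [apply: (fcalcD hE)|apply: ND]. Qed.

Lemma inI_lim f : approximable f ->
  (forall e, 0 < e -> exists2 g, inI g & forall t, -1 <= t <= 1 -> `|g t - f t| <= e) -> inI f.
Proof.
move=> af H; have [a fa] := fcalc_exists hE h_sa h1 af; exists a => //.
have en0 n : 0 < 2^-1 ^+ n :> R by rewrite exprn_gt0 ?invr_gt0.
have /choice[u hu] n : exists b, N b /\ nE (b - a) <= 2^-1 ^+ n.
  have [g [b gb Nb] hg] := H _ (en0 n); exists b; split=> //.
  exact: (fcalc_bound hE h_sa h1 (fcalcB hE h_sa h1 gb fa)).
apply: (Ncl (u := u)) => [n|e /half_pow_small[M hM]]; first by case: (hu n).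
exists M => k Mk; have [_ h2] := hu k; apply: le_trans h2 _; apply: le_trans hM.
exact: half_pow_le.
Qed.

Let P (s : seq R) : {poly R} := \prod_(m <- s) ('X - m%:P).

(* Modulo N, P s annihilates the functions of h supported in [x, y]. *)
Let local x y s := forall f, approximable f ->
  (forall t, -1 <= t <= 1 -> t < x \/ y < t -> f t = 0) -> inI (fun t => (P s).[t] * f t).

(** The margin [d] makes adjacent intervals overlap, which leaves room for the cut-off in
    [local_glue]. *)
Let Q x y := exists2 d, 0 < d & exists s, local (x - d) (y + d) s.

(** A cut-off [chi], falling from 1 to 0 around [y], splits [f] into a part for each interval; the
    product of both polynomials annihilates the sum. *)
Lemma local_glue x y z : Q x y -> Q y z -> Q x z.
Proof.
move=> [d1 d10 [s1 h2]] [d2 d20 [s2 h3]]; pose d := Num.min d1 d2.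
have d0 : 0 < d by rewrite lt_min d10.
have dd1 : d <= d1 by rewrite ge_min lexx.
have dd2 : d <= d2 by rewrite ge_min lexx orbT.
exists d => //; exists (s1 ++ s2) => f af f0.
pose chi t := Num.max 0 (Num.min 1 ((2 * d)^-1 * (y + d - t))).
have achi : approximable chi.
  apply: approximable_max; first exact: approximable_cst.
  apply: approximable_min; first exact: approximable_cst.
  by apply: approximableZ; apply: approximableB; [apply: approximable_cst|apply: approximable_id].
have chi0 t : y + d < t -> chi t = 0.
  move=> yt; apply: max_l; rewrite ge_min; apply/orP; right.
  by rewrite pmulr_rle0 ?invr_gt0 ?mulr_gt0 //; lra.
have chi1 t : t < y - d -> chi t = 1.
  move=> yt; have -> : chi t = Num.max 0 1.
    congr Num.max; apply: min_l; rewrite mulrC ler_pdivlMr ?mulr_gt0 //; lra.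
  exact: max_r.
have a1 : inI (fun t => (P s1).[t] * (f t * chi t)).
  apply: h2 => [|t ht [tx|yt]]; first exact: approximableM.
    by rewrite f0 ?mul0r //; left; lra.
  by rewrite chi0 ?mulr0 //; lra.
have a2 : inI (fun t => (P s2).[t] * (f t * (1 - chi t))).
  apply: h3 => [|t ht [ty|zt]].
  - by apply: approximableM => //; apply: approximableB => //; apply: approximable_cst.
  - by rewrite chi1 ?subrr ?mulr0 //; lra.
  - by rewrite f0 ?mul0r //; right; lra.
apply: (inI_ext (f := fun t => (P s1).[t] * (f t * chi t) * (P s2).[t] +
  (P s2).[t] * (f t * (1 - chi t)) * (P s1).[t])).
  by move=> t _; rewrite /P big_cat hornerM /=; ring.
by apply: inI_add; apply: inI_mul => //; apply: approximable_poly.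
Qed.

(* By Cousin's lemma, failure localizes at a point c: arbitrarily close to c there is
   a function outside the ideal supported in an annulus around c.  Disjoint annuli
   shrinking to c contradict Nnested. *)
Lemma spectral_polynomial : exists s, N (pol h (P s)).
Proof.
suff [d d0 [s hs]] : Q (-1) 1.
  have [|t ht [tx|yt]|a fa Na] := hs (fun=> 1); first exact: approximable_cst.
  - by move: ht => /andP[]; lra.
  - by move: ht => /andP[]; lra.
  exists s; have -> // : pol h (P s) = a.
  apply: (fcalc_eq hE h_sa h1 _ (fcalc_poly hE _ _) fa) => t _.
  by rewrite mulr1.
apply: contrapT => nQ.
have [c cc cbad] : exists2 c, -1 <= c <= 1 & forall d, 0 < d -> ~ local (c - d) (c + d) [:: c].
  apply: contrapT => nc; apply: nQ; apply: cousin; [lra|exact: local_glue|].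
  move=> c cc; apply: contrapT => nd; apply: nc; exists c => // d d0 hl.
  apply: nd; exists (d / 2); first by rewrite divr_gt0.
  move=> x y /andP[xc cy] xy; exists (d / 2); first by rewrite divr_gt0.
  exists [:: c] => f af f0; apply: hl => // t ht [tx|yt]; apply: f0 => //.
    by left; lra.
  by right; lra.
(* The factor [t - c] makes it cheap to cut [(t - c) f] off near [c]: within distance [2 r] the
   error is at most [2 r M <= e]. If all the functions so truncated lay in the ideal, their limit
   [(t - c) f] would too. *)
have step d : 0 < d -> exists ge : (R -> R) * R, [/\ approximable ge.1, ~ inI ge.1,
    0 < ge.2 <= d & forall t, -1 <= t <= 1 -> ge.1 t = 0 \/ ge.2 <= `|t - c| <= d].
  move=> d0; apply: contrapT => nge; apply: (cbad _ d0) => f af f0.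
  have [M M0 hM] := approximable_bounded af.
  have aPf : approximable (fun t => (P [:: c]).[t] * f t).
    by apply: approximableM => //; apply: approximable_poly.
  have PE t : (P [:: c]).[t] = t - c by rewrite /P big_seq1 hornerXsubC.
  apply: inI_lim => // e e0.
  pose r := Num.min d (e / (2 * M)).
  have r0 : 0 < r by rewrite lt_min d0 divr_gt0 // mulr_gt0.
  have rd : r <= d by rewrite ge_min lexx.
  have re : 2 * r * M <= e.
    by rewrite mulrAC mulrC -ler_pdivlMr ?mulr_gt0 // ge_min lexx orbT.
  pose b t := Num.max 0 (Num.min 1 (2 - r^-1 * `|t - c|)).
  have ab : approximable b.
    apply: approximable_max; first exact: approximable_cst.
    apply: approximable_min; first exact: approximable_cst.
    apply: approximableB; first exact: approximable_cst.
    apply: approximableZ; apply: approximable_norm.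
    by apply: approximableB; [apply: approximable_id|apply: approximable_cst].
  have b1 t : `|t - c| < r -> b t = 1.
    move=> tr; have -> : b t = Num.max 0 1; last exact: max_r.
    congr Num.max; apply: min_l.
    have : r^-1 * `|t - c| <= 1 by rewrite mulrC ler_pdivrMr // mul1r ltW.
    lra.
  have b0 t : 2 * r <= `|t - c| -> b t = 0.
    move=> tr; apply: max_l; rewrite ge_min; apply/orP; right.
    have : 2 <= r^-1 * `|t - c| by rewrite mulrC ler_pdivlMr.
    lra.
  have b01 t : 0 <= b t <= 1 by rewrite /b le_max lexx /= ge_max ler01 ge_min lexx.
  exists (fun t => (P [:: c]).[t] * f t * (1 - b t)).
    apply: contrapT => ni; apply: nge; exists (fun t => (P [:: c]).[t] * f t * (1 - b t), r).
    split=> //=; [|by rewrite r0|].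
      by apply: approximableM => //; apply: approximableB => //; apply: approximable_cst.
    move=> t ht; have [tr|rt] := ltP `|t - c| r; first by left; rewrite b1 // subrr mulr0.
    have [td|dt] := leP `|t - c| d; first by right.
    left; rewrite f0 ?mulr0 ?mul0r //.
    by move: dt; rewrite ltr_normr => /orP; case=> ?; [right|left]; lra.
  move=> t ht; have -> : (P [:: c]).[t] * f t * (1 - b t) - (P [:: c]).[t] * f t =
     - ((P [:: c]).[t] * f t * b t) by ring.
  rewrite normrN PE !normrM.
  have [tr|rt] := leP (2 * r) `|t - c|; first by rewrite b0 // normr0 mulr0 ltW.
  have := hM t ht; have /andP[b2 b3] := b01 t; rewrite (ger0_norm b2).
  have := normr_ge0 (t - c); have := normr_ge0 (f t).
  move: `|t - c| `|f t| (b t) rt b2 b3 => x y z rt b2 b3 y0 x0 yM.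
  have k1 : x * y <= 2 * r * M by apply: ler_pM => //; apply: ltW.
  have k2 : x * y * z <= x * y by rewrite ler_piMr // mulr_ge0.
  lra.
have step' d : exists ge : (R -> R) * R, 0 < d -> [/\ approximable ge.1, ~ inI ge.1,
    0 < ge.2 <= d & forall t, -1 <= t <= 1 -> ge.1 t = 0 \/ ge.2 <= `|t - c| <= d].
  have [d0|nd0] := ltP 0 d; first by have [ge hge] := step d d0; exists ge.
  by exists (id, 0) => d0; lra.
have [G hG] := choice step'.
(* At level 3 the k-th annulus function vanishes unless [ep k / 16 < |t - c| < 16 dl k]; the ratio
   [16 * 16] keeps these supports disjoint. *)
pose dl := fix dl k := if k is j.+1 then (G (dl j)).2 / (16 * 16) else 1 : R.
have dl0 k : 0 < dl k.
  by elim: k => [|k IH] //=; rewrite divr_gt0 ?mulr_gt0 //; have [_ _ /andP[]] := hG _ IH.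
pose ep k := (G (dl k)).2.
have ep0 k : 0 < ep k by have [_ _ /andP[]] := hG _ (dl0 k).
have epd k : ep k <= dl k by have [_ _ /andP[]] := hG _ (dl0 k).
have dle i j : (i < j)%N -> dl j <= ep i / (16 * 16).
  elim: j => // j IH; rewrite ltnS leq_eqVlt => /predU1P[->|/IH h2] //=.
  have := epd j; have := ep0 j; rewrite -/(ep j); lra.
(* Levels 0, 1, 2, 3 will provide [f], [f1], [f2] and [e]. *)
pose al m k := annulus c (ep k / 2 ^+ m) (2 ^+ m * dl k).
have pos m k : 0 < ep k / 2 ^+ m /\ 0 < 2 ^+ m * dl k.
  by split; rewrite ?divr_gt0 ?mulr_gt0 ?exprn_gt0.
have /choice[F hF] (mk : nat * nat) : exists a, fc (al mk.1 mk.2) a.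
  by apply: (fcalc_exists hE h_sa h1); apply: annulus_approximable.
have hF' m k := hF (m, k).
have nest m k t : al m k t * al m.+1 k t = al m k t.
  have [p1 p2] := pos m k; rewrite /al -[RHS](annulus_nested _ _ p1 p2); congr (_ * annulus _ _ _ _).
    by rewrite exprSr invfM mulrA.
  by rewrite exprS mulrA.
have nestl m k : F (m, k) * F (m.+1, k) = F (m, k).
  by apply: (fcalc_mul_eq hE h_sa h1 _ (hF' m k) (hF' m.+1 k) (hF' m k)) => t _; apply: nest.
have nestr m k : F (m.+1, k) * F (m, k) = F (m, k).
  by apply: (fcalc_mul_eq hE h_sa h1 _ (hF' m.+1 k) (hF' m k) (hF' m k)) => t _; rewrite mulrC nest.
have disj i j t : (i < j)%N -> al 3 i t * al 3 j t = 0.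
  move=> ij; have [p1 p2] := pos 3%N i; have [p3 p4] := pos 3%N j; have := dle _ _ ij.
  have e8 : 2 ^+ 3 = 8 :> R by ring.
  rewrite /al e8 in p1 p2 p3 p4 *.
  have [k1|k1] := leP `|t - c| (ep i / 8 / 2); first by rewrite annulus_zero ?mul0r //; left.
  move=> k2; rewrite [X in _ * X]annulus_zero ?mulr0 //; right.
  by have := ep0 i; lra.
have [|||||||||k Nk] := Nnested (e := fun k => F (3, k)) (f2 := fun k => F (2, k))
  (f1 := fun k => F (1, k)) (f := fun k => F (0, k)).
- move=> i j; case: (ltngtP i j) => // ij _.
    apply: (fcalc_mul_eq hE h_sa h1 _ (hF' _ _) (hF' _ _) (_ : fc (fun=> 0) 0)).
      by move=> t _; apply: disj.
    by have := fcalc_cst hE h 0; rewrite /= scale0r.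
  apply: (fcalc_mul_eq hE h_sa h1 _ (hF' _ _) (hF' _ _) (_ : fc (fun=> 0) 0)).
    by move=> t _; rewrite mulrC; apply: disj.
  by have := fcalc_cst hE h 0; rewrite /= scale0r.
- move=> i; apply: (fcalc_pow_bounded hE h_sa h1 (hF' 3%N i)) => t _; exact: annulus01.
- by move=> i; apply: (fcalc_sa hE h_sa (hF' 0%N i)).
- by move=> i; apply: (nestr 2%N).
- by move=> i; apply: (nestl 2%N).
- by move=> i; apply: (nestr 1%N).
- by move=> i; apply: (nestl 1%N).
- by move=> i; apply: (nestr 0%N).
- by move=> i; apply: (nestl 0%N).
have [_ ni _ hg] := hG _ (dl0 k); apply: ni.
apply: (inI_ext (f := fun t => al 0 k t * (G (dl k)).1 t)).
  move=> t ht; case: (hg t ht) => [->|hr]; first by rewrite mulr0.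
  by rewrite /al expr0 divr1 mul1r annulus_one ?mul1r.
by apply: inI_mul; [exists (F (0%N, k)) => //; apply: hF'|case: (hG _ (dl0 k))].
Qed.

End SpectralPolynomial.

(** * Finite codimension *)

Section ScalarCompleteness.
Variable R : realType.

Lemma real_cauchy_tends (u : nat -> R) :
  (forall e, 0 < e -> exists N, forall m k, (N <= m)%N -> (N <= k)%N -> `|u m - u k| <= e) ->
  exists l, forall e, 0 < e -> exists N, forall k, (N <= k)%N -> `|u k - l| <= e.
Proof.
(* The supremum of the eventual lower bounds is the lower limit of [u]. *)
move=> cu; pose S := [set x | exists N, forall k, (N <= k)%N -> x <= u k]%classic.
have near e N : (forall m k, (N <= m)%N -> (N <= k)%N -> `|u m - u k| <= e) ->
    S (u N - e) /\ forall x, S x -> x <= u N + e.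
  move=> hN; split; first by exists N => k Nk; have := hN N k (leqnn N) Nk; rewrite ler_norml; lra.
  move=> x [M hM]; have := hM _ (leq_maxr N M); have := hN N _ (leqnn N) (leq_maxl N M).
  rewrite ler_norml; lra.
have hS : has_sup S.
  have [N /near[S1 S2]] := cu 1 ltr01; split; first by exists (u N - 1).
  by exists (u N + 1).
exists (sup S) => e e0; have e2 : 0 < e / 2 by rewrite divr_gt0.
have [N hN] := cu _ e2; have [S1 S2] := near _ _ hN; exists N => k Nk.
have h1 : u N - e / 2 <= sup S by apply: ub_le_sup => //; case: hS.
have h2 : sup S <= u N + e / 2 by apply: ge_sup => //; case: hS.
have := hN k N Nk (leqnn N); rewrite !ler_norml; lra.
Qed.

Lemma cabs_ge_Re (z : R[i]) : `|complex.Re z| <= cabs z.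
Proof. by rewrite -lecR -cabsE normc_ge_Re. Qed.

Lemma cabs_ge_Im (z : R[i]) : `|complex.Im z| <= cabs z.
Proof.
have -> : complex.Im z = - complex.Re ('i * z) by case: z => a b /=; ring.
rewrite normrN; apply: le_trans (cabs_ge_Re _) _; rewrite cabsM.
by rewrite cabs_i mul1r.
Qed.

Lemma cabs_le (z : R[i]) : cabs z <= `|complex.Re z| + `|complex.Im z|.
Proof.
have -> : z = (complex.Re z)%:C + 'i * (complex.Im z)%:C by rewrite -complexE.
apply: le_trans (cabsD _ _) _; rewrite cabsM !cabs_real.
by rewrite cabs_i mul1r /=; case: z => a b /=; rewrite !(mul0r, mul1r, mulr0, addr0, subr0, add0r).
Qed.

Lemma complex_cauchy_tends (u : nat -> R[i]) :
  (forall e, 0 < e -> exists N, forall m k, (N <= m)%N -> (N <= k)%N -> cabs (u m - u k) <= e) ->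
  exists l, forall e, 0 < e -> exists N, forall k, (N <= k)%N -> cabs (u k - l) <= e.
Proof.
move=> cu.
have [|a ha] := @real_cauchy_tends (fun k => complex.Re (u k)).
  move=> e /cu[N hN]; exists N => m k Nm Nk; apply: le_trans (hN m k Nm Nk).
  by rewrite -raddfB cabs_ge_Re.
have [|b hb] := @real_cauchy_tends (fun k => complex.Im (u k)).
  move=> e /cu[N hN]; exists N => m k Nm Nk; apply: le_trans (hN m k Nm Nk).
  by rewrite -raddfB cabs_ge_Im.
exists (a +i* b) => e e0; have e2 : 0 < e / 2 by rewrite divr_gt0.
have [N hN] := ha _ e2; have [M hM] := hb _ e2; exists (maxn N M) => k.
rewrite geq_max => /andP[/hN h1 /hM h2]; apply: le_trans (cabs_le _) _.
rewrite !raddfB /=; lra.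
Qed.

End ScalarCompleteness.

Record subspace (K : pzRingType) (E : lmodType K) (M : E -> Prop) : Prop := Subspace {
  sub0 : M 0;
  subD : forall x y, M x -> M y -> M (x + y);
  subZ : forall c x, M x -> M (c *: x) }.

Definition closed_for (R : realType) (E : lmodType R[i]) (nE : E -> R) (M : E -> Prop) :=
  forall u l, (forall k, M (u k)) -> tends nE u l -> M l.

(** The subspace [M + K v]. Folding over a list [V] gives [M] plus the span of [V], so finite
    codimension is expressed without a quotient space. *)
Definition addspan (K : pzRingType) (E : lmodType K) (v : E) (M : E -> Prop) : E -> Prop :=
  fun x => exists c, M (x - c *: v).

Section AddSpan.
Variables (K : pzRingType) (E : lmodType K).
Implicit Types (M : E -> Prop) (V : seq E).

Lemma subN M x : subspace M -> M x -> M (- x).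
Proof. by move=> sM Mx; rewrite -scaleN1r; apply: (subZ sM). Qed.

Lemma subB M x y : subspace M -> M x -> M y -> M (x - y).
Proof. by move=> sM Mx My; apply: (subD sM) => //; apply: subN. Qed.

Lemma addspan_sub v M x : subspace M -> M x -> addspan v M x.
Proof. by move=> sM Mx; exists 0; rewrite scale0r subr0. Qed.

Lemma subspace_addspan v M : subspace M -> subspace (addspan v M).
Proof.
move=> sM; split=> [|x y [c hc] [d hd]|a x [c hc]].
- by apply: addspan_sub => //; apply: sub0.
- by exists (c + d); rewrite scalerDl opprD addrACA; apply: (subD sM).
- by exists (a * c); rewrite -scalerA -scalerBr; apply: (subZ sM).
Qed.

Lemma subspace_addspans V M : subspace M -> subspace (foldr (@addspan K E) M V).
Proof. by move=> sM; elim: V => //= v V; apply: subspace_addspan. Qed.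

Lemma addspans_sub V M x : subspace M -> M x -> foldr (@addspan K E) M V x.
Proof.
by move=> sM Mx; elim: V => //= v V IH; apply: addspan_sub => //; apply: subspace_addspans.
Qed.

End AddSpan.

Lemma addspans_mem (K : pzRingType) (E : lmodType K) (V : seq E) M x :
  subspace M -> x \in V -> foldr (@addspan K E) M V x.
Proof.
move=> sM; elim: V => //= v V IH; rewrite inE => /predU1P[->|/IH h].
  exists 1; rewrite scale1r subrr; apply: sub0; exact: subspace_addspans.
by apply: addspan_sub => //; apply: subspace_addspans.
Qed.

(** * Extending a bound across finite codimension *)

Section FiniteCodimension.
Variables (R : realType) (E X : lmodType R[i]) (nE : E -> R) (nX : X -> R).
Hypotheses (nEP : is_norm nE) (nXP : is_norm nX).
Variable D : E -> X.
Hypothesis Dlin : lin D.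

Definition bounded_on (M : E -> Prop) :=
  exists2 C, 0 <= C & forall x, M x -> nX (D x) <= C * nE x.

(** Here [d] is a lower bound for the distance from [v] to [M]; scaling turns it into a bound on the
    coefficient of [v]. *)
Lemma dist_closed M v : subspace M -> closed_for nE M -> ~ M v ->
  exists2 d, 0 < d & forall c m, M m -> cabs c * d <= nE (m + c *: v).
Proof.
move=> sM cM nMv; apply: contrapT => hn; apply: nMv.
have en0 n : 0 < 2^-1 ^+ n :> R by rewrite exprn_gt0 ?invr_gt0.
have /choice[u hu] n : exists m, M m /\ nE (m - v) <= 2^-1 ^+ n.
  apply: contrapT => hm; apply: hn; exists (2^-1 ^+ n) => // c m Mm.
  have [->|c0] := eqVneq c 0; first by rewrite cabs0 mul0r; apply: nrm_ge0.
  have -> : m + c *: v = c *: (v - (- c^-1 *: m)).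
    by rewrite scaleNr opprK scalerDr scalerA mulfV // scale1r addrC.
  rewrite (nrmZ nEP); apply: ler_wpM2l; first exact: cabs_ge0.
  rewrite leNgt (nrmC nEP).
  apply/negP => h; apply: hm; exists (- c^-1 *: m); split; first exact: (subZ sM).
  exact: ltW.
apply: (cM u) => [k|e /half_pow_small[N hN]]; first by case: (hu k).
by exists N => k /(half_pow_le R) h; case: (hu k) => _ h2; apply: le_trans h2 (le_trans h hN).
Qed.

(** The coefficient of [v] is a bounded function on [M + K v]: coefficients along a convergent
    sequence are Cauchy, and [D] gains only a rank-one term. *)
Lemma bounded_addspan M v : subspace M -> closed_for nE M -> bounded_on M ->
  closed_for nE (addspan v M) /\ bounded_on (addspan v M).
Proof.
move=> sM cM [C C0 hC]; have [Mv|nMv] := pselect (M v).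
  have e x : addspan v M x -> M x.
    by move=> [c hc]; rewrite -[x](subrK (c *: v)); apply: (subD sM) => //; apply: (subZ sM).
  split; last by exists C => // x /e; apply: hC.
  by move=> u l hu ul; apply: addspan_sub => //; apply: cM ul => k; apply: e.
have [d d0 hd] := dist_closed sM cM nMv.
split.
  move=> u l hu ul; have [c hc] := choice hu.
  have cc m k : cabs (c m - c k) * d <= nE (u m - u k).
    have := hd (c m - c k) _ (subB sM (hc m) (hc k)).
    suff -> : u m - c m *: v - (u k - c k *: v) + (c m - c k) *: v = u m - u k by [].
    by rewrite scalerBl; lmod_eq (R[i]).
  have [|z hz] := @complex_cauchy_tends R c.
    move=> e e0; have [|N hN] := ul (e * d / 2); first by rewrite divr_gt0 ?mulr_gt0.
    exists N => m k /hN h1 /hN h2; rewrite -(ler_pM2r d0); apply: le_trans (cc m k) _.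
    apply: le_trans (nrm_dist3 nEP l _ _) _; rewrite (nrmC nEP l); lra.
  exists z; apply: (cM (fun k => u k - c k *: v)) => // e e0.
  have v0 := nrm_ge0 nEP v.
  have [|N1 h1] := ul (e / 2); first by rewrite divr_gt0.
  have [|N2 h2] := hz (e / 2 / (nE v + 1)); first by rewrite !divr_gt0 // ltr_wpDl.
  exists (maxn N1 N2) => k; rewrite geq_max => /andP[/h1 k1 /h2 k2].
  have -> : u k - c k *: v - (l - z *: v) = (u k - l) - (c k - z) *: v.
    by rewrite scalerBl; lmod_eq (R[i]).
  apply: le_trans (nrmB nEP _ _) _; rewrite (nrmZ nEP).
  rewrite ler_pdivlMr in k2; last by rewrite ltr_wpDl.
  have := cabs_ge0 (c k - z); nra.
exists (C * (1 + nE v / d) + nX (D v) / d).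
  have q (y : R) : 0 <= y -> 0 <= y / d by move=> y0; apply: divr_ge0 => //; apply: ltW.
  apply: addr_ge0; last exact/q/nrm_ge0.
  by apply: mulr_ge0 => //; apply: addr_ge0 => //; apply/q/nrm_ge0.
move=> x [c hc].
have := hd c _ hc; rewrite subrK => cd.
have cx : cabs c <= nE x / d by rewrite ler_pdivlMr.
have -> : D x = D (x - c *: v) + c *: D v.
  by rewrite (linB _ _ Dlin); case: Dlin => _ ->; rewrite subrK.
apply: le_trans (nrmD nXP _ _) _; rewrite (nrmZ nXP).
have := hC _ hc; have := nrmB nEP x (c *: v); rewrite (nrmZ nEP).
have v0 := nrm_ge0 nEP v; have w0 := nrm_ge0 nXP (D v); have x0 := nrm_ge0 nEP x.
have k1 : cabs c * nE v <= nE x / d * nE v by apply: ler_wpM2r.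
have k2 : cabs c * nX (D v) <= nE x / d * nX (D v) by apply: ler_wpM2r.
move=> k3 k4.
have k5 : C * nE (x - c *: v) <= C * (nE x + nE x / d * nE v).
  by apply: ler_wpM2l => //; lra.
have -> : (C * (1 + nE v / d) + nX (D v) / d) * nE x =
  C * (nE x + nE x / d * nE v) + nE x / d * nX (D v) by ring.
lra.
Qed.

Lemma bounded_finite_codim M V : subspace M -> closed_for nE M -> bounded_on M ->
  (forall x, foldr (@addspan _ E) M V x) -> bounded nE nX D.
Proof.
move=> sM cM bM hV.
have : closed_for nE (foldr (@addspan _ E) M V) /\ bounded_on (foldr (@addspan _ E) M V).
  elim: {hV} V => [//|v V [h1 h2]] /=; apply: bounded_addspan => //.
  exact: subspace_addspans.
by move=> [_ [C C0 hC]]; exists C => // x; apply: hC.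
Qed.

End FiniteCodimension.

(** * Projections modulo a closed ideal *)

Section ModuloIdeal.
Variables (R : realType) (E : algType R[i]) (star : E -> E) (nE : E -> R).
Hypothesis hE : unital_cstar star nE.
Let nEP := uc_norm hE.
Let nEM := uc_normM hE.
Variable N : E -> Prop.
Hypotheses (sN : subspace N) (cN : closed_for nE N).
Hypotheses (NMr : forall x y, N x -> N (x * y)) (NMl : forall x y, N x -> N (y * x)).
Hypothesis Nstar : forall x, N x -> N (star x).
Let P (s : seq R) : {poly R} := \prod_(m <- s) ('X - m%:P).
Hypothesis Nalg1 : forall h, star h = h -> nE h <= 1 -> exists s, N (pol h (P s)).

Let ND := subD sN.
Let NB x y : N x -> N y -> N (x - y). Proof. exact: subB. Qed.
Let NN x : N x -> N (- x). Proof. exact: subN. Qed.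
Let NZ := subZ sN.
Let NZK c x : c != 0 -> N (c *: x) -> N x.
Proof. by move=> c0 /(NZ c^-1); rewrite scalerA mulVf // scale1r. Qed.

(* With k = x^* x and e = min(1, 2^n |k|) in N, |x e - x|^2 = |(1 - e) k (1 - e)| <= 2^-n. *)
Lemma semiprime x : N (star x * x) -> N x.
Proof.
pose r : R := (nE x + 1)^-1; have r0 : 0 < r by rewrite invr_gt0 ltr_wpDl ?nrm_ge0.
have rc0 : r%:C != 0 :> R[i] by rewrite (inj_eq (@complexI R)) gt_eqF.
move=> /(NZ (r%:C * r%:C)) h; apply: (NZK rc0).
have : N (star (r%:C *: x) * (r%:C *: x)) by rewrite (starZr hE) -scalerAl -scalerAr scalerA.
have : nE (r%:C *: x) <= 1.
  rewrite (nrmZr nEP) (ger0_norm (ltW r0)) mulrC ler_pdivrMr ?ltr_wpDl ?nrm_ge0 // mul1r.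
  by rewrite lerDl.
move: (r%:C *: x) => {r r0 rc0 h}{}x x1 Nk; pose k := star x * x.
have k_sa : star k = k by rewrite (uc_starM hE) (uc_starK hE).
have k1 : nE k <= 1.
  apply: le_trans (nEM _ _) _; rewrite (nE_star hE) -[leRHS]mulr1.
  by apply: ler_pM; rewrite ?nrm_ge0.
pose g n (t : R) := Num.min 1 (2 ^+ n * `|t|).
have g0 n : g n 0 = 0 by rewrite /g normr0 mulr0 min_r.
have ag n : approximable (g n).
  apply: approximable_min; first exact: approximable_cst.
  by apply/approximableZ/approximable_norm/approximable_id.
have [e he] := choice (fun n => fcalc_exists hE k_sa k1 (ag n)).
have Ne n : N (e n).
  by apply: (fcalc_ideal hE cN _ Nk (g0 n) (he n)).
have dist n : nE (x * e n - x) ^+ 2 <= 2^-1 ^+ n.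
  apply: le_trans (uc_normE hE _) _.
  have -> : star (x * e n - x) * (x * e n - x) = (1%:C%:A - e n) * k * (1%:C%:A - e n).
    rewrite (starB hE) (uc_starM hE) (fcalc_sa hE k_sa (he n)) scale1r /k.
    rewrite !(mulrBl, mulrBr, mul1r, mulr1, mulrA); lmod_eq (R[i]).
  have h1e := fcalcB hE k_sa k1 (fcalc_cst hE k 1) (he n).
  have hk := fcalcM hE k_sa k1 (fcalcM hE k_sa k1 h1e (fcalc_id hE k)) h1e.
  apply: (fcalc_bound hE k_sa k1 hk) => t _.
  rewrite /g; have p2 : 0 < 2 ^+ n :> R by rewrite exprn_gt0.
  case: (leP 1 (2 ^+ n * `|t|)) => h; first by rewrite subrr mulr0 normr0 exprn_ge0 ?invr_ge0.
  have a0 := normr_ge0 t.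
  have b0 : 0 <= 2 ^+ n * `|t| by rewrite mulr_ge0 // ltW.
  rewrite !normrM ger0_norm; last by lra.
  have : `|t| <= 2^-1 ^+ n.
    by rewrite exprVn -[_^-1]mul1r ler_pdivlMr // mulrC ltW.
  apply: le_trans; move: (2 ^+ n * `|t|) b0 h => b b0 h.
  have i1 : (1 - b) * `|t| <= `|t| by nra.
  have i2 : 0 <= (1 - b) * `|t| by rewrite mulr_ge0 //; lra.
  nra.
apply: (cN (u := fun n => x * e n)) => [n|eps e0]; first exact: NMl.
have [|M hM] := @half_pow_small R (eps ^+ 2); first by rewrite exprn_gt0.
exists M => n Mn; rewrite -(@ler_pXn2r _ 2) ?nnegrE ?nrm_ge0 ?(ltW e0) //.
exact: le_trans (dist n) (le_trans (half_pow_le R Mn) hM).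
Qed.

Lemma algebraic k : star k = k -> exists s, N (pol k (P s)).
Proof.
move=> k_sa; pose r := nE k + 1; have r0 : 0 < r by rewrite ltr_wpDl ?nrm_ge0.
have rc0 : r%:C != 0 :> R[i] by rewrite (inj_eq (@complexI R)) gt_eqF.
pose h := r^-1%:C *: k.
have [||s Ns] := @Nalg1 h.
- by rewrite (starZr hE) k_sa.
- rewrite (nrmZr nEP) ger0_norm ?invr_ge0 ?(ltW r0) // mulrC ler_pdivrMr // mul1r.
  by rewrite lerDl.
exists [seq r * m | m <- s].
suff -> : pol k (P [seq r * m | m <- s]) = r%:C ^+ size s *: pol h (P s) by apply: NZ.
elim: s {Ns} => [|m s IH].
  by rewrite /P /= !big_nil scale1r -!(polyC1 R) !polC.
have e : pol k ('X - (r * m)%:P) = r%:C *: pol h ('X - m%:P).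
  rewrite !polB !polX !polC scalerBr /h !scalerA.
  by rewrite -!(rmorphM (real_complex R)) /= mulfV ?gt_eqF // scale1r.
rewrite /P /= !big_cons !polM -/(P s) -/(P [seq r * m | m <- s]) IH exprS e.
by rewrite -scalerAl -scalerAr scalerA.
Qed.

(* Otherwise h = sum_i ep_i a_i, with distinct ep_i > 0, satisfies a_i p(h) = p(ep_i) a_i
   modulo N, so every polynomial p with p(h) in N vanishes at all the ep_i. *)
Lemma no_orthogonal_sequence (a : nat -> E) : (forall i, star (a i) = a i) ->
  (forall i, N (a i * a i - a i)) -> (forall i j, (i < j)%N -> N (a i * a j)) ->
  exists i, N (a i).
Proof.
move=> a_sa aa aij; apply: contrapT => hn.
have na i : ~ N (a i) by move=> h; apply: hn; exists i.
have aij' i j : i != j -> N (a i * a j).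
  case: (ltngtP i j) => // ij _; first exact: aij.
  by rewrite -[X in N X](uc_starK hE) (uc_starM hE) !a_sa; apply/Nstar/aij.
(* Dividing [2^-i] by a nondecreasing bound on [|a i|] makes the series converge geometrically and
   keeps the weights [ep] strictly decreasing, hence distinct. *)
pose M i := 1 + \sum_(j < i.+1) nE (a j).
have Mge i : 1 + nE (a i) <= M i.
  by rewrite /M big_ord_recr /= addrA addrAC lerDl; apply: sumr_ge0 => j _; apply: nrm_ge0.
have M0 i : 0 < M i by apply: lt_le_trans (Mge i); rewrite ltr_wpDr ?nrm_ge0.
have MS i : M i <= M i.+1.
  by rewrite /M [in leRHS]big_ord_recr /= addrA lerDl nrm_ge0.
pose ep i := 2^-1 ^+ i / M i.
have ep0 i : 0 < ep i by rewrite divr_gt0 // exprn_gt0 // invr_gt0.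
have epS i : ep i.+1 < ep i.
  rewrite /ep exprSr ltr_pdivrMr // mulrAC ltr_pdivlMr //.
  have p0 : 0 < 2^-1 ^+ i :> R by rewrite exprn_gt0 ?invr_gt0.
  have := MS i; have := M0 i; nra.
have ep_lt i j : (i < j)%N -> ep j < ep i.
  elim: j => // j IH; rewrite ltnS leq_eqVlt => /predU1P[->//|/IH].
  exact: lt_trans.
pose h n := \sum_(i < n) (ep i)%:C *: a i.
have [|l hl] := @tends_geometric R E nE nEP h (uc_complete hE).
  move=> k; have -> : h k.+1 - h k = (ep k)%:C *: a k.
    by rewrite {1}/h big_ord_recr /= addrAC subrr add0r.
  rewrite (nrmZr nEP) (ger0_norm (ltW (ep0 k))).
  rewrite /ep mulrAC ler_pdivrMr //; apply: ler_wpM2l; first by rewrite exprn_ge0 ?invr_ge0.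
  by have := Mge k; lra.
have l_sa : star l = l.
  apply: (tends_uniq nEP (tends_star hE hl)); apply: tends_ext hl => k.
  by rewrite (star_sum hE); apply: eq_bigr => i _; rewrite (starZr hE) a_sa.
have al i : N (a i * l - (ep i)%:C *: a i).
  (* The shift by [i.+1] restricts to partial sums that already contain the term [a i]. *)
  apply: (cN (u := fun n => a i * h (n + i.+1)%N - (ep i)%:C *: a i)); last first.
    move=> e e0.
    have [K hK] := tendsM hE (tends_const hE (a i)) hl e0.
    exists K => k Kk; rewrite opprB addrA subrK.
    by apply: hK; apply: leq_trans Kk _; apply: leq_addr.
  move=> n; have lt_in : (i < n + i.+1)%N by rewrite addnS ltnS leq_addl.
  rewrite /h (bigD1 (Ordinal lt_in)) //= mulrDr -scalerAr addrAC -scalerBr.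
  apply: ND; first exact: NZ.
  rewrite mulr_sumr; apply: (big_ind N) => [|x y|j]; [exact: sub0|exact: ND|].
  by rewrite -val_eqE /= eq_sym => ij; rewrite -scalerAr; apply/NZ/aij'.
have alp i f : N (a i * pol l f - (f.[ep i])%:C *: a i).
  elim/poly_ind: f => [|f c IH].
    by rewrite horner0 scale0r subr0 -[0]polyC0 polC /= scale0r mulr0; apply: sub0.
  rewrite polD polM polX polC hornerMXaddC.
  have -> : a i * (pol l f * l + c%:C%:A) - (f.[ep i] * ep i + c)%:C *: a i =
    (a i * pol l f - (f.[ep i])%:C *: a i) * l + (f.[ep i])%:C *: (a i * l - (ep i)%:C *: a i).
    rewrite rmorphD rmorphM /= mulrDr -scalerAr mulr1 mulrBl scalerBr -scalerAl !mulrA.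
    lmod_eq (R[i]).
  by apply: ND; [apply: NMr|apply: NZ].
have [s Ns] := algebraic l_sa.
have eps i : ep i \in s.
  rewrite -root_prod_XsubC rootE; apply/negPn/negP => nz; apply: (na i).
  have c0 : ((P s).[ep i])%:C != 0 :> R[i] by rewrite (inj_eq (@complexI R)).
  apply: (NZK c0).
  have -> : ((P s).[ep i])%:C *: a i =
      a i * pol l (P s) - (a i * pol l (P s) - ((P s).[ep i])%:C *: a i).
    by rewrite opprB addrC subrK.
  by apply: NB; [apply: NMl|apply: alp].
have inj : injective ep.
  by move=> i j eij; case: (ltngtP i j) => // /ep_lt; rewrite eij ltxx.
have := @uniq_leq_size _ [seq ep i | i <- iota 0 (size s).+1] s.
rewrite size_map size_iota ltnn (map_inj_uniq inj) iota_uniq => /(_ isT) h0.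
suff : false by [].
apply: h0.
by move=> _ /mapP[i _ ->].
Qed.

(* Projections are understood modulo N. *)
Definition is_proj p := star p = p /\ N (p * p - p).
Definition minimal_proj p := is_proj p /\ forall x, exists c : R[i], N (p * x * p - c *: p).

Lemma pol_comm p k f : N (p * k - k * p) -> N (p * pol k f - pol k f * p).
Proof.
move=> pk; elim/poly_ind: f => [|f c IH].
  by rewrite -[0]polyC0 polC /= scale0r mulr0 mul0r subr0; apply: sub0.
rewrite polD polM polX polC.
have -> : p * (pol k f * k + c%:C%:A) - (pol k f * k + c%:C%:A) * p =
   (p * pol k f - pol k f * p) * k + pol k f * (p * k - k * p).
  rewrite !(mulrDl, mulrDr, mulNr, mulrN, =^~ scalerAl, =^~ scalerAr, mulrA, mulr1, mul1r).
  lmod_eq (R[i]).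
by apply: ND; [apply: NMr|apply: NMl].
Qed.

(* Take k = p y p not congruent to a scalar and a product of fewest linear factors X - m
   with p P(k) in N.  If P = (X - m) f then f(m) <> 0 because N is semiprime, and
   p f(k) p / f(m) is the required projection. *)
Lemma split_proj p : is_proj p -> ~ minimal_proj p ->
  exists q, [/\ is_proj q, N (p * q - q), ~ N q & ~ N (p - q)].
Proof.
move=> [p_sa pp] nmin.
have [y y_sa ny] : exists2 y, star y = y & ~ exists c : R[i], N (p * y * p - c *: p).
  apply: contrapT => hn; apply: nmin; split=> // x.
  have sc y : star y = y -> exists c : R[i], N (p * y * p - c *: p).
    by move=> y_sa; apply: contrapT => h; apply: hn; exists y.
  have [|c hc] := sc (2^-1 *: (x + star x)).
    by rewrite (uc_starZ hE) conj_half (uc_starD hE) (uc_starK hE) addrC.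
  have ii := mul_ii R.
  have [|d hd] := sc (2^-1 *: ('i *: (star x - x))).
    rewrite (uc_starZ hE) conj_half (uc_starZ hE) conj_i (starB hE) (uc_starK hE).
    by rewrite scaleNr -scalerN opprB.
  exists (c + 'i * d).
  have -> : p * x * p - (c + 'i * d) *: p = (p * (2^-1 *: (x + star x)) * p - c *: p) +
      'i *: (p * (2^-1 *: ('i *: (star x - x))) * p - d *: p).
    rewrite !(mulrDl, mulrDr, mulNr, mulrN, =^~ scalerAl, =^~ scalerAr, mulrA).
    have i2 : 'i * (2^-1 * 'i) = - 2^-1 :> R[i] by rewrite mulrCA ii mulrN1.
    rewrite !(scalerDr, scalerN, scalerA, i2, mulrA); rewrite ?mulrA in i2 *; rewrite ?i2.
    lmod_eq (R[i]).
  by apply: ND; last apply: NZ.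
pose k := p * y * p.
have k_sa : star k = k by rewrite /k !(uc_starM hE) p_sa y_sa mulrA.
have pk : N (p * k - k * p).
  have -> : p * k - k * p = (p * p - p) * (y * p) - (p * y) * (p * p - p).
    by rewrite /k; algebra_eq (R[i]).
  by apply: NB; [apply: NMr|apply: NMl].
pose pr n := `[< exists2 s, size s = n & N (p * pol k (P s)) >].
have expr : exists n, pr n.
  by have [s Ns] := algebraic k_sa; exists (size s); apply/asboolP; exists s => //; apply: NMl.
case: (ex_minnP expr) => n /asboolP[s sn Ns] hmin.
have nmin_list s' : (size s' < n)%N -> ~ N (p * pol k (P s')).
  move=> lt h; have : pr (size s') by apply/asboolP; exists s'.
  by move=> /hmin; rewrite leqNgt lt.
have nonscalar m : ~ N (p * pol k ('X - m%:P)).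
  rewrite polB polX polC => h; apply: ny; exists m%:C.
  have -> : p * y * p - m%:C *: p = p * (k - m%:C%:A) - (p * p - p) * (y * p).
    rewrite /k !(mulrDl, mulrDr, mulNr, mulrN, =^~ scalerAl, =^~ scalerAr, mulrA, mulr1).
    lmod_eq (R[i]).
  by apply: NB => //; apply: NMr.
case: s sn Ns => [|m [|m' s]] sn Ns.
- case: (nonscalar 0); rewrite -[X in pol k X]mul1r polM mulrA.
  by apply: NMr; move: Ns; rewrite /P big_nil.
- by case: (nonscalar m); move: Ns; rewrite /P big_seq1.
set f := P (m' :: s) in Ns *.
have {}Ns : N (p * pol k (('X - m%:P) * f)) by move: Ns; rewrite /P big_cons.
have nf : ~ N (p * pol k f) by apply: nmin_list; rewrite -sn.
pose F := pol k f.
have F_sa : star F = F by exact: (pol_sa hE k_sa).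
have pF : N (p * F - F * p) by apply: pol_comm.
pose c := f.[m].
have c0 : c != 0.
  apply/negP => c00; have /factor_theorem[g fg] : root f m by [].
  apply: nf; apply: semiprime.
  rewrite (uc_starM hE) -/F F_sa p_sa.
  have FF : N (p * (F * F)).
    rewrite /F -polM {1}fg -mulrA polM -[pol k g * _](polM k g) mulrC polM mulrA.
    exact: NMr.
  have -> : F * p * (p * F) = F * (p * p - p) * F - (p * F - F * p) * F + p * (F * F).
    by algebra_eq (R[i]).
  by apply: ND => //; apply: NB; [apply/NMr/NMl|apply: NMr].
have cc0 : c%:C != 0 :> R[i] by rewrite (inj_eq (@complexI R)).
(* [f - f(m)] is a multiple of [X - m], so [f^2 = f(m) f] modulo [(X - m) f]; this makes [p F / c]
   idempotent modulo [N]. *)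
have FFc : N (p * F * F - c%:C *: (p * F)).
  have [g fg] : exists g, f - c%:P = g * ('X - m%:P).
    by apply/factor_theorem; rewrite rootE !hornerE subrr.
  have -> : p * F * F - c%:C *: (p * F) = p * pol k (('X - m%:P) * f) * pol k g.
    have e : ('X - m%:P) * f * g = f * f - c%:P * f by rewrite -mulrBl fg mulrC mulrA.
    by rewrite -[RHS]mulrA -polM e polB !polM polC mulr_algl -/F mulrBr -scalerAr mulrA.
  exact: NMr.
pose q := c^-1%:C *: (p * F * p).
have cV : c^-1%:C * c%:C = 1 :> R[i] by rewrite -(rmorphM (real_complex R)) /= mulVf.
have NpFp : ~ N (p * F * p).
  move=> h; apply: nf; rewrite -/F.
  have -> : p * F = p * F * p + p * (p * F - F * p) - (p * p - p) * F by algebra_eq (R[i]).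
  by apply: NB; [apply: ND => //; apply: NMl|apply: NMr].
exists q; split.
- split; first by rewrite /q (starZr hE) !(uc_starM hE) p_sa F_sa mulrA.
  have -> : q * q - q = (c^-1%:C * c^-1%:C) *: (p * F * (p * p - p) * F * p
     - p * (p * F - F * p) * F * p + (p * p - p) * F * F * p
     + (p * F * F - c%:C *: (p * F)) * p).
    have e : q = (c^-1%:C * c^-1%:C) *: (c%:C *: (p * F * p)).
      by rewrite scalerA -mulrA cV mulr1.
    have e2 : q * q = (c^-1%:C * c^-1%:C) *: (p * F * p * (p * F * p)).
      by rewrite /q -scalerAl -scalerAr scalerA.
    rewrite e2 [X in _ - X]e -scalerBr; congr (_ *: _).
    by move: (c%:C : R[i]) => v; algebra_eq (R[i]).
  apply: NZ; do !apply: ND; do ?[by apply/NMr/NMr/NMl|by do !apply: NMr].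
  by apply: NN; apply/NMr/NMr/NMl.
- have -> : p * q - q = c^-1%:C *: ((p * p - p) * F * p) by rewrite /q; algebra_eq (R[i]).
  by apply: NZ; do !apply: NMr.
- by move=> /NZK; rewrite (inj_eq (@complexI R)) invr_eq0 => /(_ c0).
(* [q K] lies in [N] because [p ((X - m) f)(k)] does. If [p] and [q] agreed modulo [N], then [p K]
   would be in [N] and a single linear factor would suffice. *)
move=> h; apply: (nonscalar m); set K := pol k ('X - m%:P).
have FK : F * K = K * F by rewrite /F /K -!polM mulrC.
have pK : N (p * K - K * p) by apply: pol_comm.
have -> : p * K = (p - q) * K + c^-1%:C *: (p * F * (p * K - K * p) + (p * pol k (('X - m%:P) * f)) * p).
  have e : p * F * K * p = p * K * F * p by rewrite -(mulrA p F) FK !mulrA.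
  rewrite polM -/K -/F /q.
  rewrite !(mulrDl, mulrDr, mulNr, mulrN, =^~ scalerAl, =^~ scalerAr, mulrA) e.
  lmod_eq (R[i]).
apply: ND; first exact: NMr.
by apply: NZ; apply: ND; [apply: NMl|apply: NMr].
Qed.

Let decomposable p := exists qs : seq E, (forall q, q \in qs -> minimal_proj q) /\
  N (p - \sum_(q <- qs) q).

Lemma proj_sub p q : is_proj p -> is_proj q -> N (p * q - q) -> is_proj (p - q).
Proof.
move=> [p_sa pp] [q_sa qq] pq; split; first by rewrite (starB hE) p_sa q_sa.
have qp : N (q * p - q).
  by have := Nstar pq; rewrite (starB hE) (uc_starM hE) p_sa q_sa.
have -> : (p - q) * (p - q) - (p - q) = (p * p - p) - (p * q - q) - (q * p - q) + (q * q - q).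
  by algebra_eq (R[i]).
by apply: ND => //; apply: NB => //; apply: NB.
Qed.

(** When a non-decomposable projection splits, one of the two pieces is again non-decomposable and
    is kept. The discarded differences are orthogonal projections outside [N], which
    [no_orthogonal_sequence] forbids. *)
Lemma proj_decomposable p : is_proj p -> decomposable p.
Proof.
move=> hp; apply: contrapT => nd.
have step r : exists r', is_proj r -> ~ decomposable r ->
    [/\ is_proj r', ~ decomposable r', N (r * r' - r') & ~ N (r - r')].
  have [[hr nr]|h] := pselect (is_proj r /\ ~ decomposable r); last first.
    by exists 0 => hr nr; case: h.
  have nm : ~ minimal_proj r.
    move=> hm; apply: nr; exists [:: r]; split=> [q|]; first by rewrite inE => /eqP ->.
    by rewrite big_seq1 subrr; apply: sub0.
  have [q [hq rq nq nrq]] := split_proj hr nm.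
  have hrq := proj_sub hr hq rq.
  have [[s1 [h1 k1]]|nq'] := pselect (decomposable q); last by exists q.
  exists (r - q) => _ _; split=> //.
  - move=> [s2 [h2 k2]]; apply: nr; exists (s1 ++ s2); split=> [x|].
      by rewrite mem_cat => /orP[/h1|/h2].
    rewrite big_cat /=.
    have -> : r - (\sum_(q0 <- s1) q0 + \sum_(q0 <- s2) q0) =
      (q - \sum_(q0 <- s1) q0) + (r - q - \sum_(q0 <- s2) q0) by lmod_eq (R[i]).
    exact: ND.
  - case: hr => _ rr; have -> : r * (r - q) - (r - q) = (r * r - r) - (r * q - q).
      by algebra_eq (R[i]).
    exact: NB.
  - by rewrite opprB addrC subrK.
have [G hG] := choice step.
pose r n := iter n G p.
have hr n : is_proj (r n) /\ ~ decomposable (r n).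
  by elim: n => [|n [IH1 IH2]] //=; have [] := hG _ IH1 IH2.
have hG' n := hG (r n) (hr n).1 (hr n).2.
have le i j : (i <= j)%N -> N (r i * r j - r j).
  elim: j => [|j IH]; first by rewrite leqn0 => /eqP ->; case: (hr 0%N) => -[].
  rewrite leq_eqVlt => /predU1P[->|/IH h]; first by case: (hr j.+1) => -[].
  have [_ _ h2 _] := hG' j; rewrite -[r j.+1]/(G (r j)).
  have -> : r i * G (r j) - G (r j) = (r i * r j - r j) * G (r j)
     - r i * (r j * G (r j) - G (r j)) + (r j * G (r j) - G (r j)) by algebra_eq (R[i]).
  by apply: ND => //; apply: NB; [apply: NMr|apply: NMl].
have hs n : is_proj (r n - r n.+1).
  by have [h1 _ h2 _] := hG' n; apply: proj_sub => //; case: (hr n).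
have [i|i|i j ij|i] := @no_orthogonal_sequence (fun n => r n - r n.+1).
- by case: (hs i).
- by case: (hs i).
- have -> : (r i - r i.+1) * (r j - r j.+1) = (r i * r j - r j) - (r i * r j.+1 - r j.+1)
    - (r i.+1 * r j - r j) + (r i.+1 * r j.+1 - r j.+1) by algebra_eq (R[i]).
  apply: ND; last by apply: le; apply: leqW.
  by apply: NB; [apply: NB|]; apply: le => //; [apply: ltnW|apply/leqW/ltnW].
by have [_ _ _ ni] := hG' i; move=> /ni.
Qed.

(** If some [y = q y0 r] is outside [N], then modulo [N] the product [y * star y] is a nonzero
    multiple [mu q], and [star y * (q x r)], being in the corner of [r], is a multiple of [r]. Thus
    [mu q x r = y * (star y * (q x r))] is a multiple of [y]. *)
Lemma minimal_corner q r : minimal_proj q -> minimal_proj r ->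
  exists v, forall x, exists c : R[i], N (q * x * r - c *: v).
Proof.
move=> [[q_sa qq] hq] [[r_sa rr] hr].
have [h|/existsNP[y0 ny]] := pselect (forall x, N (q * x * r)).
  by exists 0 => x; exists 0; rewrite scale0r subr0.
pose y := q * y0 * r.
have ys : star y = r * star y0 * q by rewrite /y !(uc_starM hE) q_sa r_sa mulrA.
have [mu hmu] : exists mu : R[i], N (y * star y - mu *: q).
  have [mu hmu] := hq (y0 * r * r * star y0); exists mu.
  by rewrite ys /y; move: hmu; rewrite !mulrA.
have mu0 : mu != 0.
  apply/negP => /eqP mu0; apply: ny; rewrite -/y -[y](uc_starK hE); apply: Nstar.
  by apply: semiprime; rewrite (uc_starK hE); move: hmu; rewrite mu0 scale0r subr0.
exists y => x; have [c hc] := hr (star y0 * q * q * x).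
exists (mu^-1 * c); apply: (NZK mu0).
have -> : mu *: (q * x * r - (mu^-1 * c) *: y) =
   y * (star y * (q * x * r) - c *: r) - (y * star y - mu *: q) * (q * x * r)
   - mu *: ((q * q - q) * x * r) + c *: (q * y0 * (r * r - r)).
  rewrite ys /y; have e : mu * (mu^-1 * c) = c by rewrite mulrA mulfV // mul1r.
  rewrite scalerBr scalerA e.
  by algebra_eq (R[i]).
apply: ND; last by apply/NZ/NMl.
apply: NB; last by apply/NZ/NMr/NMr.
apply: NB; last exact: NMr.
by apply: NMl; rewrite ys; move: hc; rewrite !mulrA.
Qed.

Theorem finite_codimension : exists V : seq E, forall x, foldr (@addspan _ E) N V x.
Proof.
have p1 : is_proj 1 by split; [exact: star1 hE|rewrite mulr1 subrr; apply: sub0].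
have [qs [hqs h1]] := proj_decomposable p1.
have /choice[v hv] (qr : E * E) : exists v, minimal_proj qr.1 -> minimal_proj qr.2 ->
    forall x, exists c : R[i], N (qr.1 * x * qr.2 - c *: v).
  have [[m1 m2]|h] := pselect (minimal_proj qr.1 /\ minimal_proj qr.2).
    by have [v hv] := minimal_corner m1 m2; exists v.
  by exists 0 => m1 m2; case: h.
pose V := [seq v (q, r) | q <- qs, r <- qs].
have sV := subspace_addspans V sN; exists V => x.
set e := \sum_(q <- qs) q in h1.
rewrite -[x](subrK (e * x * e)); apply: (subD sV).
  apply: addspans_sub => //.
  have -> : x - e * x * e = (1 - e) * x + e * x * (1 - e).
    rewrite !(mulrDl, mulrDr, mulNr, mulrN, mul1r, mulr1, mulrA); lmod_eq (R[i]).
  by apply: ND; [apply: NMr|apply: NMl].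
rewrite /e mulr_suml mulr_suml big_seq; apply: (big_ind (foldr (@addspan _ E) N V)).
- exact: sub0.
- by move=> a b; apply: subD.
move=> q hq; rewrite mulr_sumr big_seq; apply: (big_ind (foldr (@addspan _ E) N V)).
- exact: sub0.
- by move=> a b; apply: subD.
move=> r hr'; have [c hc] := hv (q, r) (hqs _ hq) (hqs _ hr') x.
rewrite -[q * x * r](subrK (c *: v (q, r))); apply: (subD sV); first exact: addspans_sub.
by apply: (subZ sV); apply: addspans_mem => //; apply: allpairs_f.
Qed.

End ModuloIdeal.

(** * Boundedness of the derivation on a unital algebra *)

Section UnitalCase.
Variables (R : realType) (E : algType R[i]) (X : lmodType R[i]).
Variables (star : E -> E) (nE : E -> R) (nX : X -> R).
Hypotheses (hE : unital_cstar star nE) (nXP : is_norm nX).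
Let nEP := uc_norm hE.
Let cE := uc_complete hE.
Let nEM := uc_normM hE.

Variable L : E -> X -> X.
Hypotheses (Llin : forall a, lin (L a)) (Llinl : forall x, lin (L^~ x)).
Hypothesis Lbounded : exists2 K, 0 <= K & forall a x, nX (L a x) <= K * (nE a * nX x).
Hypothesis Lmul3 : forall a b c x,
  L (jprod (jprod a b) c) x = L (jprod a b) (L c x) + L (jprod b c) (L a x)
    + L (jprod a c) (L b x) - L a (L c (L b x)) - L b (L c (L a x)).
Hypothesis Lcyc : forall a b c x,
  L (jprod a b) (L c x) + L (jprod b c) (L a x) + L (jprod c a) (L b x) =
  L c (L (jprod a b) x) + L a (L (jprod b c) x) + L b (L (jprod c a) x).
Variable D : E -> X.
Hypothesis Dlin : lin D.
Hypothesis Dder : forall a b, D (jprod a b) = L a (D b) + L b (D a).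

Let good := good nE nX L D.

Definition cont_ideal a := forall b c, good (b * a * c) /\ good (b * star a * c).
Local Notation N := cont_ideal.

Lemma cont_ideal_subspace : subspace N.
Proof.
have g0 : good 0 := good0 nE nXP Llinl D.
have gD x y : good x -> good y -> good (x + y) := @goodD R E X nE nX nXP L Llinl D x y.
have gZ c x : good x -> good (c *: x) := @goodZ R E X nE nX nXP L Llinl D c x.
split=> [b c|x y hx hy b c|k x hx b c].
- by rewrite (star0 hE) mulr0 mul0r.
- rewrite (uc_starD hE) !mulrDr !mulrDl; have [h1 h2] := hx b c; have [h3 h4] := hy b c.
  by split; apply: gD.
- rewrite (uc_starZ hE) -!scalerAr -!scalerAl; have [h1 h2] := hx b c.
  by split; apply: gZ.
Qed.

Lemma cont_ideal_closed : closed_for nE N.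
Proof.
move=> u l hu ul b c; have tl v m : tends nE v m -> tends nE (fun k => b * v k * c) (b * m * c).
  by move=> vm; apply: (tendsM hE (tendsM hE (tends_const hE b) vm) (tends_const hE c)).
split.
  by apply: (good_lim nEP nXP cE Llin Llinl Lbounded Dlin _ (tl _ _ ul)) => k; case: (hu k b c).
apply: (good_lim nEP nXP cE Llin Llinl Lbounded Dlin _ (tl _ _ (tends_star hE ul))) => k.
by case: (hu k b c).
Qed.

Lemma cont_ideal_mulr x y : N x -> N (x * y).
Proof.
move=> Nx b c; rewrite (uc_starM hE) !mulrA -(mulrA (b * x)).
by have [h1 _] := Nx b (y * c); have [_ h2] := Nx (b * star y) c.
Qed.

Lemma cont_ideal_mull x y : N x -> N (y * x).
Proof.
move=> Nx b c; rewrite (uc_starM hE) !mulrA -(mulrA (b * star x)).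
by have [_ h1] := Nx b (star y * c); have [h2 _] := Nx (b * y) c.
Qed.

Lemma cont_ideal_star x : N x -> N (star x).
Proof. by move=> Nx b c; rewrite (uc_starK hE); case: (Nx b c). Qed.

Lemma cont_ideal_good x : N x -> good x.
Proof. by move=> /(_ 1 1)[+ _]; rewrite mul1r mulr1. Qed.

Lemma cont_ideal_spectral h : star h = h -> nE h <= 1 ->
  exists s : seq R, N (pol h (\prod_(m <- s) ('X - m%:P))).
Proof.
move=> h_sa h1; apply: (spectral_polynomial hE (subD cont_ideal_subspace)
  cont_ideal_mulr cont_ideal_closed _ h_sa h1).
move=> e f2 f1 f ee eK f_sa ef2 f2e f21 f12 f1f ff1.
have [j hj] := exists_good_corner nEP nXP cE nEM Llin Llinl Lbounded Lmul3 Lcyc Dlin Dder ee eK.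
exists j => b c; rewrite f_sa.
suff g : good (b * f j * c) by [].
exact: (good_ideal_corner nEP nXP nEM Llin Llinl Lbounded Lmul3 Dder hj (ef2 j) (f2e j)
  (f21 j) (f12 j) (f1f j) (ff1 j)).
Qed.

Lemma bounded_on_cont_ideal : bounded_on nE nX D N.
Proof.
have sN := cont_ideal_subspace; have cN := cont_ideal_closed.
have [C C0 hC] := bounded_on_products nEP nXP cE Llin Llinl Lbounded Dlin Dder
  (sub0 sN) (subD sN) (subZ sN) cN cont_ideal_good.
have sa_bound a : star a = a -> N a -> nX (D a) <= (C + C) * nE a.
  move=> a_sa Na; have [->|a0] := eqVneq a 0.
    by rewrite (lin0 Dlin) (nrm0 nXP) (nrm0 nEP) mulr0.
  have na : 0 < nE a by apply: (nrm_gt0 nEP); apply/eqP.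
  have ia : 0 <= (nE a)^-1 by rewrite invr_ge0 ltW.
  pose h := (nE a)^-1%:C *: a.
  have h_sa : star h = h by rewrite (starZr hE) a_sa.
  have h1 : nE h <= 1 by rewrite (nrmZr nEP) (ger0_norm ia) mulVf ?gt_eqF.
  have Nh : N h by apply: (subZ sN).
  (* Used at [t] and at [-t]: the resulting [z] and [w] are square roots of the positive and
     negative parts of [h]. They remain in [N] because the functions vanish at 0. *)
  have sq (g : R -> R) : approximable g -> g 0 = 0 ->
      (forall t, -1 <= t <= 1 -> `|g t| <= 1) ->
      exists z, [/\ N z, nX (D (z * z)) <= C & fcalc nE h (fun t => Num.max (g t) 0) (z * z)].
    move=> ag g0 g1; pose f t := Num.sqrt (Num.max (g t) 0).
    have f_sq t : f t * f t = Num.max (g t) 0 by rewrite -expr2 sqr_sqrtr // le_max lexx orbT.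
    have af : approximable f.
      apply: approximable_sqrt => [|t _]; last by rewrite le_max lexx orbT.
      by apply: approximable_max => //; apply: approximable_cst.
    have [z fz] := fcalc_exists hE h_sa h1 af.
    have Nz : N z.
      apply: (fcalc_ideal hE cN cont_ideal_mulr Nh _ fz).
      by rewrite /f g0 maxxx sqrtr0.
    have z1 : nE z <= 1.
      apply: (fcalc_bound hE h_sa h1 fz) => t ht.
      rewrite ger0_norm ?sqrtr_ge0 // -sqrtr1 ler_wsqrtr // ge_max ler01 andbT.
      exact: le_trans (ler_norm _) (g1 t ht).
    exists z; split=> //.
      have -> : z * z = jprod z z by rewrite /jprod; lmod_eq (R[i]).
      apply: le_trans (hC _ _ Nz Nz) _; rewrite -[leRHS]mulr1; apply: ler_wpM2l => //.
      by have := nrm_ge0 nEP z; nra.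
    by move=> e e0; have [p [hp pz]] := fcalcM hE h_sa h1 fz fz e0; exists p; split=> // t /hp; rewrite f_sq.
  have [|||z [Nz zC fz]] := sq id; [exact: approximable_id|by []|by move=> t; rewrite ler_norml|].
  have [|||w [Nw wC fw]] := sq (fun t => -1 * t).
  - exact/approximableZ/approximable_id.
  - by rewrite mulr0.
  - by move=> t ht; rewrite mulN1r normrN ler_norml.
  have hzw : h = z * z - w * w.
    apply: (fcalc_eq hE h_sa h1 _ (fcalc_id hE h) (fcalcB hE h_sa h1 fz fw)) => t _.
    by rewrite mulN1r /=; case: (leP t 0) => t0; [rewrite max_l|rewrite max_r]; lra.
  have -> : a = (nE a)%:C *: h.
    by rewrite /h scalerA -(rmorphM (real_complex R)) /= mulfV ?gt_eqF // scale1r.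
  case: (Dlin) => _ ->; rewrite (nrmZr nXP) (ger0_norm (ltW na)) (nrmZr nEP) (ger0_norm (ltW na)).
  have nh : nE h = 1 by rewrite (nrmZr nEP) (ger0_norm ia) mulVf ?gt_eqF.
  rewrite nh mulr1 mulrC; apply: ler_wpM2r; first exact: ltW.
  rewrite hzw (linB _ _ Dlin); have := nrmB nXP (D (z * z)) (D (w * w)); lra.
exists (2 * (C + C)) => [|x Nx]; first by rewrite mulr_ge0 ?addr_ge0.
have Ns := cont_ideal_star Nx.
pose y := 2^-1 *: (x + star x); pose z := 2^-1 *: ('i *: (star x - x)).
have ex : x = y + 'i *: z.
  rewrite /y /z !scalerA [_ * 'i]mulrC mulrA mul_ii; lmod_eq (R[i]).
have y_sa : star y = y.
  by rewrite /y (uc_starZ hE) conj_half (uc_starD hE) (uc_starK hE) addrC.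
have z_sa : star z = z.
  rewrite /z (uc_starZ hE) conj_half (uc_starZ hE) conj_i (starB hE) (uc_starK hE).
  by rewrite scaleNr -scalerN opprB.
have Ny : N y by apply/(subZ sN)/(subD sN).
have Nz : N z by apply/(subZ sN)/(subZ sN)/(subB sN).
have y1 : nE y <= nE x.
  rewrite (nrmZ nEP) cabs_half; have := nrmD nEP x (star x); rewrite (nE_star hE); lra.
have z1 : nE z <= nE x.
  rewrite !(nrmZ nEP) cabs_half cabs_i; have := nrmB nEP (star x) x; rewrite (nE_star hE); lra.
have -> : D x = D y + 'i *: D z by rewrite {1}ex; case: (Dlin) => DD DZ; rewrite DD (DZ 'i).
apply: le_trans (nrmD nXP _ _) _; rewrite (nrmZ nXP 'i) cabs_i mul1r.
have := sa_bound _ y_sa Ny; have := sa_bound _ z_sa Nz.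
have CC : 0 <= C + C by rewrite addr_ge0.
have := ler_wpM2l CC y1; have := ler_wpM2l CC z1; lra.
Qed.

Theorem jordan_derivation_bounded_unital : bounded nE nX D.
Proof.
have sN := cont_ideal_subspace; have cN := cont_ideal_closed.
have [V hV] := finite_codimension hE sN cN cont_ideal_mulr cont_ideal_mull cont_ideal_star
  cont_ideal_spectral.
exact: (bounded_finite_codim nEP nXP Dlin sN cN bounded_on_cont_ideal hV).
Qed.

End UnitalCase.

(** * Real-valued norms of normed modules *)

(* The norm of a normed module over R[i] is R[i]-valued; rnorm is its real version. *)
Definition rnorm (R : realType) (V : normedModType R[i]) (x : V) : R := complex.Re `|x|.

Section RealNorm.
Variables (R : realType) (V : normedModType R[i]).
Implicit Types x y : V.

Lemma rnormE x : `|x| = (rnorm x)%:C.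
Proof.
rewrite /rnorm; have := normr_ge0 x; case: `|x| => a b; rewrite lecE /= => /andP[/eqP -> _].
by [].
Qed.

Lemma rnorm_norm : is_norm (@rnorm R V).
Proof.
split=> [x y|c x|x h].
- by have := ler_normD x y; rewrite !rnormE -rmorphD lecR.
- by apply: (@complexI R); rewrite -rnormE normrZ rnormE cabsE rmorphM.
- by apply/eqP; rewrite -normr_eq0 rnormE h.
Qed.

End RealNorm.

Lemma real_pos (R : realType) (e : R[i]) : 0 < e -> 0 < complex.Re e /\ e = (complex.Re e)%:C.
Proof. by case: e => a b; rewrite ltcE /= => /andP[/eqP -> a0]. Qed.

Lemma rnorm_complete (R : realType) (V : completeNormedModType R[i]) : complete_for (@rnorm R V).
Proof.
move=> u cu; have uc : cvg (u @ \oo)%classic.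
  apply: cauchy_cvg; apply: cauchy_exP => e /real_pos[e0 ->].
  have [|N hN] := cu (complex.Re e / 2); first by rewrite divr_gt0.
  exists (u N), N => // k /= Nk; rewrite -ball_normE /= rnormE ltcR.
  by apply: le_lt_trans (hN N k (leqnn N) Nk) _; lra.
exists (lim (u @ \oo)%classic) => e e0; have ec0 : 0 < e%:C by rewrite ltcR.
have ul : (u @ \oo --> lim (u @ \oo))%classic by exact: uc.
have /cvgrPdist_lt/(_ _ ec0)[N _ hN] := ul; exists N => k /hN /=.
by rewrite distrC rnormE ltcR; apply: ltW.
Qed.

Lemma bounded_continuous (R : realType) (V W : normedModType R[i]) (f : {linear V -> W}) :
  bounded (@rnorm R V) (@rnorm R W) f -> continuous f.
Proof.
move=> [C C0 hC] x; apply/cvgrPdist_lt => e /real_pos[e0 ->].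
have d0 : 0 < complex.Re e / (C + 1) by rewrite divr_gt0 // ltr_wpDl.
have dc0 : 0 < (complex.Re e / (C + 1))%:C by rewrite ltcR.
have /cvgrPdist_lt/(_ _ dc0) := @cvg_id _ (nbhs x) _; apply: filterS => y /=.
rewrite -linearB !rnormE !ltcR ltr_pdivlMr; last by rewrite ltr_wpDl.
have := hC (x - y); have := nrm_ge0 (@rnorm_norm R V) (x - y); nra.
Qed.

Lemma continuous_bilinear_bounded (R : realType) (U V W : normedModType R[i])
    (f : U -> V -> W) :
  (forall a, lin (f a)) -> (forall x, lin (f^~ x)) ->
  continuous (fun p : U * V => f p.1 p.2) ->
  exists2 K, 0 <= K & forall a x, rnorm (f a x) <= K * (rnorm a * rnorm x).
Proof.
move=> flin flinl fc.
have nU := @rnorm_norm R U; have nV := @rnorm_norm R V; have nW := @rnorm_norm R W.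
have /cvgrPdist_lt/(_ 1 ltr01) := fc (0, 0).
move=> /nbhs_ballP[d /real_pos[d0 ed] hd].
pose r := complex.Re d / 2; have r0 : 0 < r by rewrite divr_gt0.
have small a x : rnorm a <= r -> rnorm x <= r -> rnorm (f a x) <= 1.
  move=> ha hx; have := hd (a, x).
  rewrite (lin0 (flin 0)) sub0r normrN rnormE (ltcR _ 1) => h; apply/ltW/h.
  by split; rewrite /= -ball_normE /= sub0r normrN rnormE ed ltcR /r in ha hx *; lra.
exists (r^-1 * r^-1); first by rewrite mulr_ge0 // invr_ge0 ltW.
move=> a x; have [->|a0] := eqVneq a 0.
  by rewrite (lin0 (flinl x)) (nrm0 nW) (nrm0 nU) mul0r mulr0.
have [->|x0] := eqVneq x 0.
  by rewrite (lin0 (flin a)) (nrm0 nW) (nrm0 nV) !mulr0.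
have na : 0 < rnorm a by apply: (nrm_gt0 nU); apply/eqP.
have nx : 0 < rnorm x by apply: (nrm_gt0 nV); apply/eqP.
have qa : 0 <= r / rnorm a by rewrite divr_ge0 ?ltW.
have qx : 0 <= r / rnorm x by rewrite divr_ge0 ?ltW.
have := small ((r / rnorm a)%:C *: a) ((r / rnorm x)%:C *: x).
rewrite (nrmZr nU) (nrmZr nV) (ger0_norm qa) (ger0_norm qx) !divfK ?gt_eqF //.
move=> /(_ (lexx _) (lexx _)); case: (flinl ((r / rnorm x)%:C *: x)) => _ ->.
case: (flin a) => _ ->; rewrite !(nrmZr nW) (ger0_norm qa) (ger0_norm qx) => h.
have -> : r^-1 * r^-1 * (rnorm a * rnorm x) = (r / rnorm a * (r / rnorm x))^-1.
  by field; rewrite !gt_eqF.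
have q0 : 0 < r / rnorm a * (r / rnorm x) by rewrite mulr_gt0 // divr_gt0.
by rewrite -[leRHS]mul1r ler_pdivlMr // mulrC -(mulrA (r / rnorm a)).
Qed.

(** * Unitization *)

(* The proof hA is a parameter of the type, so that the ring structure declared below
   can rely on the associativity of mul. *)
Definition unitization (R : realType) (A : completeNormedModType R[i])
  (mul : {bilinear A -> A -> A}) (star : A -> A) (hA : cstar_algebra mul star) : Type :=
  (R[i]^o * A)%type.

Section Unitization.
Variables (R : realType) (A : completeNormedModType R[i]).
Variables (mul : {bilinear A -> A -> A}) (star : A -> A) (hA : cstar_algebra mul star).
Local Notation E := (unitization hA).

HB.instance Definition _ := GRing.Lmodule.copy E (R[i]^o * A)%type.

Let mulA := cstar_mulA hA.

Definition unit_mul (u v : E) : E :=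
  (u.1 * v.1, u.1 *: v.2 + v.1 *: u.2 + mul u.2 v.2).

Definition unit_one : E := (1, 0).

Let mulDl a b c : mul (a + b) c = mul a c + mul b c. Proof. exact: linearDl. Qed.
Let mulDr a b c : mul a (b + c) = mul a b + mul a c. Proof. exact: linearDr. Qed.
Let mulZl k a b : mul (k *: a) b = k *: mul a b. Proof. exact: linearZl. Qed.
Let mulZr k a b : mul a (k *: b) = k *: mul a b. Proof. exact: linearZr. Qed.
Let mul0l a : mul 0 a = 0. Proof. exact: linear0l. Qed.
Let mul0A a : mul a 0 = 0. Proof. exact: linear0r. Qed.

Lemma unit_mulA : associative unit_mul.
Proof.
move=> [l a] [m b] [n c]; rewrite /unit_mul /=; congr pair; first exact: mulrA.
rewrite !(mulDl, mulDr, mulZl, mulZr, mulA); lmod_eq (R[i]).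
Qed.

Lemma unit_mul1l : left_id unit_one unit_mul.
Proof.
by move=> [l a]; rewrite /unit_mul /= mul0l scaler0 scale1r mul1r !addr0.
Qed.

Lemma unit_mul1r : right_id unit_one unit_mul.
Proof.
by move=> [l a]; rewrite /unit_mul /= mul0A scaler0 scale1r mulr1 add0r addr0.
Qed.

Lemma unit_mulDl : left_distributive unit_mul +%R.
Proof.
move=> [l a] [m b] [n c]; apply: injective_projections; rewrite /=; first exact: mulrDl.
rewrite !(mulDl, mulDr, mulZl, mulZr, mulA); lmod_eq (R[i]).
Qed.

Lemma unit_mulDr : right_distributive unit_mul +%R.
Proof.
move=> [l a] [m b] [n c]; apply: injective_projections; rewrite /=; first exact: mulrDr.
rewrite !(mulDl, mulDr, mulZl, mulZr, mulA); lmod_eq (R[i]).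
Qed.

Lemma unit_oner_neq0 : unit_one != 0.
Proof. by apply/eqP => -[/eqP]; rewrite oner_eq0. Qed.

HB.instance Definition _ := GRing.Zmodule_isNzRing.Build E
  unit_mulA unit_mul1l unit_mul1r unit_mulDl unit_mulDr unit_oner_neq0.

Lemma unit_scaleAl k (u v : E) : k *: (u * v) = (k *: u) * v.
Proof.
case: u v => [l a] [m b]; apply: injective_projections; rewrite /=; first exact: mulrA.
have -> : k *: l = k * l by [].
rewrite !(mulDl, mulDr, mulZl, mulZr, mulA); lmod_eq (R[i]).
Qed.

HB.instance Definition _ := GRing.Lmodule_isLalgebra.Build R[i] E unit_scaleAl.

Lemma unit_scaleAr k (u v : E) : k *: (u * v) = u * (k *: v).
Proof.
case: u v => [l a] [m b]; apply: injective_projections; rewrite /=; first exact: mulrCA.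
have -> : k *: m = k * m by [].
rewrite !(mulDl, mulDr, mulZl, mulZr, mulA); lmod_eq (R[i]).
Qed.

HB.instance Definition _ := GRing.Lalgebra_isAlgebra.Build R[i] E unit_scaleAr.
Local Notation nA := (@rnorm R A).
Let nAP : is_norm nA := @rnorm_norm R A.

Lemma rnorm_mul a b : nA (mul a b) <= nA a * nA b.
Proof. by have := cstar_normM hA a b; rewrite !rnormE -rmorphM lecR. Qed.

Lemma rnorm_cstar a : nA (mul (star a) a) = nA a ^+ 2.
Proof.
by apply: (@complexI R); rewrite -rnormE (cstar_normE hA) rnormE rmorphXn.
Qed.

Lemma rnorm_star a : nA (star a) = nA a.
Proof.
suff h b : nA b <= nA (star b).
  by apply/eqP; rewrite eq_le h andbT -[in leRHS](cstar_starK hA a) h.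
have := rnorm_mul (star b) b; rewrite rnorm_cstar expr2.
have := nrm_ge0 nAP b; have := nrm_ge0 nAP (star b).
have [->|b0] := eqVneq b 0; first by rewrite (nrm0 nAP).
have : 0 < nA b by apply: (nrm_gt0 nAP); apply/eqP.
nra.
Qed.

Definition unit_act (u : E) (b : A) : A := u.1 *: b + mul u.2 b.

Lemma unit_actM u v b : unit_act (u * v) b = unit_act u (unit_act v b).
Proof.
case: u v => [l a] [m c]; rewrite /unit_act /=.
rewrite !(mulDl, mulDr, mulZl, mulZr, mulA); lmod_eq (R[i]).
Qed.

Lemma unit_actD u v b : unit_act (u + v) b = unit_act u b + unit_act v b.
Proof.
case: u v => [l a] [m c]; rewrite /unit_act /= mulDl; lmod_eq (R[i]).
Qed.

Lemma unit_actZ k u b : unit_act (k *: u) b = k *: unit_act u b.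
Proof.
case: u => [l a]; rewrite /unit_act /=; have -> : k *: l = k * l by [].
rewrite mulZl; lmod_eq (R[i]).
Qed.

Lemma unit_actZr k u b : unit_act u (k *: b) = k *: unit_act u b.
Proof. by rewrite /unit_act mulZr scalerDr !scalerA mulrC. Qed.

Lemma unit_act_bound u b : nA (unit_act u b) <= (cabs u.1 + nA u.2) * nA b.
Proof.
rewrite mulrDl; apply: le_trans (nrmD nAP _ _) _; apply: lerD; last exact: rnorm_mul.
by rewrite (nrmZ nAP).
Qed.

Definition act_norm (u : E) : R := sup [set r | exists2 b, nA b <= 1 & r = nA (unit_act u b)]%classic.

Let act_has_sup u : has_sup [set r | exists2 b, nA b <= 1 & r = nA (unit_act u b)]%classic.
Proof.
split; first by exists (nA (unit_act u 0)), 0; rewrite ?(nrm0 nAP) ?ler01.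
exists (cabs u.1 + nA u.2) => _ [b b1 ->]; apply: le_trans (unit_act_bound u b) _.
by rewrite -[leRHS]mulr1; apply: ler_wpM2l => //; rewrite addr_ge0 ?cabs_ge0 ?(nrm_ge0 nAP).
Qed.

Lemma act_norm_ge u b : nA (unit_act u b) <= act_norm u * nA b.
Proof.
have [->|b0] := eqVneq b 0.
  by rewrite /unit_act scaler0 mul0A addr0 (nrm0 nAP) mulr0.
have nb : 0 < nA b by apply: (nrm_gt0 nAP); apply/eqP.
have ib : 0 <= (nA b)^-1 by rewrite invr_ge0 ltW.
rewrite -ler_pdivrMr //.
have -> : nA (unit_act u b) / nA b = nA (unit_act u ((nA b)^-1%:C *: b)).
  by rewrite unit_actZr (nrmZr nAP) (ger0_norm ib) mulrC.
apply: ub_le_sup; first by case: (act_has_sup u).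
exists ((nA b)^-1%:C *: b) => //.
by rewrite (nrmZr nAP) (ger0_norm ib) mulVf ?gt_eqF.
Qed.

(** The operator norm of left multiplication on A is only a seminorm when A already has a unit [e],
    since [(1, - e)] acts as 0. The maximum with the modulus of the scalar part is a C*-norm in both
    cases. *)
Definition unit_norm (u : E) : R := Num.max (cabs u.1) (act_norm u).

Lemma unit_norm_le u r : 0 <= r -> cabs u.1 <= r ->
  (forall b, nA (unit_act u b) <= r * nA b) -> unit_norm u <= r.
Proof.
move=> r0 h1 h2; rewrite ge_max h1; apply: ge_sup; first by case: (act_has_sup u).
move=> _ [b b1 ->]; apply: le_trans (h2 b) _.
by rewrite -[leRHS]mulr1; apply: ler_wpM2l.
Qed.

Lemma cabs_unit_norm u : cabs u.1 <= unit_norm u.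
Proof. by rewrite le_max lexx. Qed.

Lemma unit_norm_ge0 u : 0 <= unit_norm u.
Proof. exact: le_trans (cabs_ge0 _) (cabs_unit_norm u). Qed.

Lemma unit_norm_act u b : nA (unit_act u b) <= unit_norm u * nA b.
Proof.
apply: le_trans (act_norm_ge u b) _; apply: ler_wpM2r; first exact: (nrm_ge0 nAP).
by rewrite le_max lexx orbT.
Qed.

Lemma unit_norm_upper (u : E) : unit_norm u <= cabs u.1 + nA u.2.
Proof.
apply: unit_norm_le; last exact: unit_act_bound.
  by rewrite addr_ge0 ?cabs_ge0 ?(nrm_ge0 nAP).
by rewrite lerDl (nrm_ge0 nAP).
Qed.

(** The operator norm of [a] is attained in the direction of [star a], where the C*-identity gives
    [|a|^2]. *)
Lemma unit_norm_embed a : unit_norm ((0, a) : E) = nA a.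
Proof.
apply/eqP; rewrite eq_le; apply/andP; split.
  by apply: le_trans (unit_norm_upper _) _; rewrite /= cabs0 add0r.
have := unit_norm_act ((0, a) : E) (star a).
rewrite /unit_act /= scale0r add0r.
have := rnorm_cstar (star a); rewrite (cstar_starK hA) rnorm_star => ->.
have [->|a0] := eqVneq a 0; first by rewrite (nrm0 nAP) unit_norm_ge0.
have na : 0 < nA a by apply: (nrm_gt0 nAP); apply/eqP.
by rewrite expr2 ler_pM2r.
Qed.

Lemma unit_normD u v : unit_norm (u + v) <= unit_norm u + unit_norm v.
Proof.
apply: unit_norm_le => [||b]; first by rewrite addr_ge0 ?unit_norm_ge0.
  by apply: le_trans (cabsD _ _) _; apply: lerD; apply: cabs_unit_norm.
rewrite unit_actD mulrDl; apply: le_trans (nrmD nAP _ _) _.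
by apply: lerD; apply: unit_norm_act.
Qed.

Lemma unit_normZ k u : unit_norm (k *: u) = cabs k * unit_norm u.
Proof.
have le c v : unit_norm (c *: v) <= cabs c * unit_norm v.
  apply: unit_norm_le => [||b]; first by rewrite mulr_ge0 ?cabs_ge0 ?unit_norm_ge0.
    rewrite /= -[c *: v.1]/(c * v.1) cabsM; apply: ler_wpM2l; first exact: cabs_ge0.
    exact: cabs_unit_norm.
  rewrite unit_actZ (nrmZ nAP) -mulrA; apply: ler_wpM2l; first exact: cabs_ge0.
  exact: unit_norm_act.
apply/eqP; rewrite eq_le le /=; have [->|k0] := eqVneq k 0.
  by rewrite cabs0 mul0r unit_norm_ge0.
have ck : 0 < cabs k.
  by rewrite lt_neqAle cabs_ge0 andbT eq_sym; apply/eqP => /cabs_eq0/eqP; apply/negP.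
have := le k^-1 (k *: u); rewrite scalerA mulVf // scale1r.
have -> : cabs k^-1 = (cabs k)^-1.
  apply: (mulfI (lt0r_neq0 ck)); rewrite -cabsM !mulfV ?cabs1 //; exact: lt0r_neq0.
by rewrite mulrC ler_pdivlMr // mulrC.
Qed.

Lemma unit_norm_norm : is_norm unit_norm.
Proof.
split; [exact: unit_normD|exact: unit_normZ|move=> [l a] h].
have l0 : l = 0.
  apply: cabs_eq0; apply/eqP; rewrite eq_le cabs_ge0 andbT -h.
  exact: (cabs_unit_norm (l, a)).
move: h; rewrite l0 unit_norm_embed => /(nrm_eq0 nAP) ->.
by [].
Qed.

(** The component in A is [w - w.1 *: 1], and both terms have norm at most that of [w]. *)
Lemma rnorm_unit_norm (w : E) : nA w.2 <= 2 * unit_norm w.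
Proof.
rewrite -(unit_norm_embed w.2); have -> : (0, w.2) = w - w.1 *: 1 :> E.
  apply: injective_projections; rewrite /=.
    by rewrite [w.1 *: _]mulr1 subrr.
  by rewrite scaler0 subr0.
apply: le_trans (nrmB unit_norm_norm _ _) _; rewrite unit_normZ.
have : unit_norm 1 <= 1.
  by apply: le_trans (unit_norm_upper _) _; rewrite /= (nrm0 nAP) addr0 cabs1.
have := cabs_unit_norm w; have := cabs_ge0 w.1; have := unit_norm_ge0 1; nra.
Qed.

Lemma unit_normM u v : unit_norm (u * v) <= unit_norm u * unit_norm v.
Proof.
apply: unit_norm_le => [||b]; first by rewrite mulr_ge0 ?unit_norm_ge0.
  by rewrite cabsM; apply: ler_pM; rewrite ?cabs_ge0 ?cabs_unit_norm.
rewrite unit_actM; apply: le_trans (unit_norm_act _ _) _; rewrite -mulrA.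
by apply: ler_wpM2l; [apply: unit_norm_ge0|apply: unit_norm_act].
Qed.

Definition unit_star (u : E) : E := (u.1^*%C, star u.2).

Lemma unit_act_star u b c : mul (star (unit_act u b)) c = mul (star b) (unit_act (unit_star u) c).
Proof.
rewrite /unit_act /= (cstar_starD hA) (cstar_starZ hA) (cstar_starM hA).
by rewrite !(mulDl, mulDr, mulZl, mulZr, mulA).
Qed.

Lemma unit_norm_complete : complete_for unit_norm.
Proof.
move=> u cu.
have [|l hl] := @complex_cauchy_tends R (fun k => (u k).1).
  move=> e /cu[N hN]; exists N => m k Nm Nk; apply: le_trans (hN m k Nm Nk).
  exact: (cabs_unit_norm (u m - u k)).
have [|a ha] := @rnorm_complete R A (fun k => (u k).2).
  move=> e e0; have [|N hN] := cu (e / 2); first by rewrite divr_gt0.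
  exists N => m k Nm Nk; apply: le_trans (rnorm_unit_norm (u m - u k)) _.
  by have := hN m k Nm Nk; lra.
exists (l, a) => e e0; have e2 : 0 < e / 2 by rewrite divr_gt0.
have [N hN] := hl _ e2; have [M hM] := ha _ e2; exists (maxn N M) => k.
rewrite geq_max => /andP[/hN h1 /hM h2]; apply: le_trans (unit_norm_upper _) _ => /=.
lra.
Qed.

Theorem unitization_cstar : unital_cstar unit_star unit_norm.
Proof.
split.
- exact: unit_norm_norm.
- exact: unit_norm_complete.
- exact: unit_normM.
- move=> u v; apply: injective_projections => /=; first exact: rmorphD.
  exact: (cstar_starD hA).
- move=> c u; apply: injective_projections => /=; first exact: rmorphM.
  exact: (cstar_starZ hA).
- move=> [l a] [m b]; apply: injective_projections => /=; first by rewrite rmorphM /= mulrC.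
  by rewrite !(cstar_starD hA) !(cstar_starZ hA) (cstar_starM hA) [X in X + _]addrC.
- by move=> [l a]; rewrite /unit_star /= conjcK (cstar_starK hA).
(* For [b] in A, [|u b|^2] is the norm of [star b] times [(star u * u) b], at most [n |b|^2]; the
   scalar part is handled separately. *)
move=> u; set n := unit_norm (unit_star u * u).
have n0 : 0 <= n by apply: unit_norm_ge0.
apply: (@le_trans _ _ (Num.sqrt n ^+ 2)); last by rewrite sqr_sqrtr.
apply: lerXn2r; [by rewrite nnegrE unit_norm_ge0|by rewrite nnegrE sqrtr_ge0|].
apply: unit_norm_le => [||b]; [by rewrite sqrtr_ge0| |].
  rewrite -(@ler_pXn2r _ 2) ?nnegrE ?cabs_ge0 ?sqrtr_ge0 // sqr_sqrtr // expr2.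
  have := cabs_unit_norm (unit_star u * u).
  by rewrite /= cabsM cabsJ.
rewrite -(@ler_pXn2r _ 2) ?nnegrE ?mulr_ge0 ?(nrm_ge0 nAP) ?sqrtr_ge0 //.
rewrite -rnorm_cstar unit_act_star -unit_actM exprMn sqr_sqrtr //.
apply: le_trans (rnorm_mul _ _) _; rewrite rnorm_star expr2 mulrCA.
apply: ler_wpM2l; first exact: (nrm_ge0 nAP).
exact: unit_norm_act.
Qed.

End Unitization.

(** * Jordan derivations on C*-algebras *)

Section Core.
Variables (R : realType) (A X : completeNormedModType R[i]).
Variables (mul : {bilinear A -> A -> A}) (star : A -> A) (hA : cstar_algebra mul star).
Variable L : A -> X -> X.
Hypotheses (Llin : forall a, lin (L a)) (Llinl : forall x, lin (L^~ x)).
Hypothesis Lbounded : exists2 K, 0 <= K & forall a x, rnorm (L a x) <= K * (rnorm a * rnorm x).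
Local Notation "a <o> b" := (jordan_product mul a b) (at level 40).
Hypothesis Lcommute : forall a x, L (a <o> a) (L a x) = L a (L (a <o> a) x).
Hypothesis Llinear : forall a b x,
  2 *: L a (L b (L a x)) + L ((a <o> a) <o> b) x = 2 *: L (a <o> b) (L a x) + L (a <o> a) (L b x).
Variable D : {linear A -> X}.
Hypothesis Dder : forall a b, D (a <o> b) = L b (D a) + L a (D b).

Let LD a x y : L a (x + y) = L a x + L a y. Proof. by case: (Llin a). Qed.
Let LZ a c x : L a (c *: x) = c *: L a x. Proof. by case: (Llin a). Qed.
Let LDl a b x : L (a + b) x = L a x + L b x. Proof. by case: (Llinl x) => ->. Qed.
Let LZl c a x : L (c *: a) x = c *: L a x. Proof. by case: (Llinl x) => _ ->. Qed.

Lemma jordan_productC a b : a <o> b = b <o> a.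
Proof. by rewrite /jordan_product addrC. Qed.

Lemma jordan_productDl a b c : (a + b) <o> c = a <o> c + b <o> c.
Proof. by rewrite /jordan_product linearDl linearDr; lmod_eq (R[i]). Qed.

Lemma jordan_productDr a b c : c <o> (a + b) = c <o> a + c <o> b.
Proof. by rewrite jordan_productC jordan_productDl !(jordan_productC _ c). Qed.

Lemma jordan_productZl k a c : (k *: a) <o> c = k *: (a <o> c).
Proof. by rewrite /jordan_product linearZl linearZr /=; lmod_eq (R[i]). Qed.

(** Subtracts a known identity [u = v] from the goal; after the last one only a formal linear
    identity remains. *)
Let cancel_eq (u v x y : X) : u = v -> x + v = y + u -> x = y.
Proof. by move=> -> /addIr. Qed.

(** Polarization of [Llinear] in the variable where it is quadratic, at [a + b], [a] and [b]. *)
Lemma module_mul3 a b c x :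
  L ((a <o> b) <o> c) x = L (a <o> b) (L c x) + L (b <o> c) (L a x)
    + L (a <o> c) (L b x) - L a (L c (L b x)) - L b (L c (L a x)).
Proof.
have h1 := Llinear (a + b) c x; have h2 := Llinear a c x; have h3 := Llinear b c x.
apply: (scalerI (a := 2 : R[i])); first by rewrite pnatr_eq0.
move: h1 h2 h3; rewrite !(jordan_productDl, jordan_productDr, LDl, LD) (jordan_productC b a).
move=> h1 h2 h3; apply: (cancel_eq h1); apply: (cancel_eq (esym h2)); apply: (cancel_eq (esym h3)).
by lmod_eq (R[i]).
Qed.

(** Full polarization of the cubic identity [Lcommute], by inclusion-exclusion over [a + b + c], its
    pairs and its single terms. *)
Lemma module_cyc a b c x :
  L (a <o> b) (L c x) + L (b <o> c) (L a x) + L (c <o> a) (L b x) =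
  L c (L (a <o> b) x) + L a (L (b <o> c) x) + L b (L (c <o> a) x).
Proof.
have := Lcommute (a + b + c) x; have := Lcommute (a + b) x; have := Lcommute (b + c) x.
have := Lcommute (a + c) x; have := Lcommute a x; have := Lcommute b x; have := Lcommute c x.
rewrite !(jordan_productDl, jordan_productDr, LDl, LD) (jordan_productC b a) (jordan_productC c b).
rewrite (jordan_productC a c) => fc fb fa fac fbc fab fabc.
apply: (scalerI (a := 2 : R[i])); first by rewrite pnatr_eq0.
apply: (cancel_eq fabc); apply: (cancel_eq (esym fab)); apply: (cancel_eq (esym fbc)).
apply: (cancel_eq (esym fac)); apply: (cancel_eq fa); apply: (cancel_eq fb); apply: (cancel_eq fc).
by lmod_eq (R[i]).
Qed.

Local Notation E := (unitization hA).

(** The adjoined unit acts as the identity. [D] is then extended by 0 on it, the only choice: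
    [D 1 = D (1 o 1) = 2 D 1]. *)
Let LE (u : E) x := u.1 *: x + L u.2 x.
Let DE (u : E) := D u.2.

Lemma unit_jprodE (u v : E) :
  jprod u v = (u.1 * v.1, u.1 *: v.2 + v.1 *: u.2 + u.2 <o> v.2) :> E.
Proof.
case: u v => [l a] [m b]; rewrite /jprod /jordan_product; apply: injective_projections; rewrite /=.
  rewrite -[2^-1 *: _]/(2^-1 * _) (mulrC m); by field.
lmod_eq (R[i]).
Qed.

Theorem jordan_derivation_bounded : bounded (@rnorm R A) (@rnorm R X) D.
Proof.
have nXP := @rnorm_norm R X; have nAP := @rnorm_norm R A.
have hE := unitization_cstar hA.
have [C C0 hC] : bounded (unit_norm (hA := hA)) (@rnorm R X) DE.
  apply: (@jordan_derivation_bounded_unital R E X _ _ _ hE nXP LE).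
  - by move=> u; split=> [x y|c x]; rewrite /LE ?LD ?LZ; lmod_eq (R[i]).
  - move=> x; split=> [u v|c u]; rewrite /LE /= ?LDl ?LZl; last rewrite -[c *: u.1]/(c * u.1);
      lmod_eq (R[i]).
  - have [K K0 hK] := Lbounded; exists (1 + 2 * K) => [|u x]; first by rewrite addr_ge0 ?mulr_ge0.
    case: u => [l a]; rewrite /LE /= mulrDl mul1r mulrDl.
    have h1 : cabs l <= unit_norm ((l, a) : E) by exact: (@cabs_unit_norm R A mul star hA (l, a)).
    have h2 : rnorm a <= 2 * unit_norm ((l, a) : E) by exact: (@rnorm_unit_norm R A mul star hA (l, a)).
    have x0 := nrm_ge0 nXP x.
    apply: le_trans (nrmD nXP _ _) _; apply: lerD.
      by rewrite (nrmZ nXP); apply: ler_wpM2r.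
    apply: le_trans (hK _ _) _.
    have := ler_wpM2l K0 (ler_wpM2r x0 h2); lra.
  - move=> [l a] [m b] [n c] x; rewrite !unit_jprodE /LE /=.
    have -> u v w k q : (k *: u + q *: v + w) <o> c = k *: (u <o> c) + q *: (v <o> c) + w <o> c.
      by rewrite !jordan_productDl !jordan_productZl.
    have := module_mul3 a b c x.
    move: ((a <o> b) <o> c) => abc; move: (a <o> b) (b <o> c) (a <o> c) => ab bc ac h.
    by rewrite !(LDl, LZl, LD, LZ) h; lmod_eq (R[i]).
  - move=> [l a] [m b] [n c] x; rewrite !unit_jprodE /LE /=.
    have := module_cyc a b c x.
    move: (a <o> b) (b <o> c) (c <o> a) => ab bc ca h.
    rewrite !(LDl, LZl, LD, LZ); apply: (cancel_eq h).
    by lmod_eq (R[i]).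
  - by split=> [u v|c u]; rewrite /DE /= ?linearD ?linearZ.
  move=> [l a] [m b]; rewrite unit_jprodE /DE /LE /=.
  have := Dder a b; move: (a <o> b) => ab h; rewrite !linearD !linearZ /= h.
  lmod_eq (R[i]).
exists C => // a; have := hC ((0, a) : E); rewrite unit_norm_embed.
exact.
Qed.

End Core.

Lemma jordan_module_derivation_continuous (R : realType) (A X : completeNormedModType R[i])
    (mul : {bilinear A -> A -> A}) (star : A -> A) (hA : cstar_algebra mul star)
    (lact : {bilinear A -> X -> X}) (ract : {bilinear X -> A -> X}) :
  jordan_banach_module (jordan_product mul) lact ract ->
  forall D : {linear A -> X},
    jordan_derivation (jordan_product mul) lact ract D -> continuous D.
Proof.
move=> [[comm jord lind] lc rc] D Dder.
have ll a : lin (lact a) by split=> *; rewrite ?linearDr ?linearZr.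
have llr x : lin (lact^~ x) by split=> *; rewrite ?linearDl ?linearZl.
apply: bounded_continuous; apply: (jordan_derivation_bounded hA ll llr).
- exact: continuous_bilinear_bounded ll llr lc.
- by move=> a x; rewrite [lact a x]comm jord -comm.
- by move=> a b x; have := lind a b x; rewrite -!comm.
by move=> a b; rewrite Dder -comm.
Qed.

Lemma bimodule_derivation_continuous (R : realType) (A X : completeNormedModType R[i])
    (mul : {bilinear A -> A -> A}) (star : A -> A) (hA : cstar_algebra mul star)
    (lact : {bilinear A -> X -> X}) (ract : {bilinear X -> A -> X}) :
  banach_bimodule mul lact ract ->
  forall D : {linear A -> X},
    bimodule_jordan_derivation mul lact ract D -> continuous D.
Proof.
move=> [llA lrA rrA lc rc] D Dder.
have mulA := cstar_mulA hA.
have lDl a b x : lact (a + b) x = lact a x + lact b x by rewrite linearDl.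
have lDr a x y : lact a (x + y) = lact a x + lact a y by rewrite linearDr.
have lZl k a x : lact (k *: a) x = k *: lact a x by rewrite linearZl.
have lZr k a x : lact a (k *: x) = k *: lact a x by rewrite linearZr.
have rDl x y a : ract (x + y) a = ract x a + ract y a by rewrite linearDl.
have rDr x a b : ract x (a + b) = ract x a + ract x b by rewrite linearDr.
have rZl k x a : ract (k *: x) a = k *: ract x a by rewrite linearZl.
have rZr k x a : ract x (k *: a) = k *: ract x a by rewrite linearZr.
have mDl a b c : mul (a + b) c = mul a c + mul b c by rewrite linearDl.
have mDr a b c : mul c (a + b) = mul c a + mul c b by rewrite linearDr.
have mZl k a c : mul (k *: a) c = k *: mul a c by rewrite linearZl.
have mZr k a c : mul c (k *: a) = k *: mul c a by rewrite linearZr.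
pose expand := (lDl, lDr, lZl, lZr, rDl, rDr, rZl, rZr, (mDl, mDr, mZl, mZr), mulA).
pose L a x := 2^-1 *: (lact a x + ract x a).
have ll a : lin (L a) by split=> *; rewrite /L ?(lDr, rDl, lZr, rZl); lmod_eq (R[i]).
have llr x : lin (L^~ x) by split=> *; rewrite /L ?(lDl, rDr, lZl, rZr); lmod_eq (R[i]).
apply: bounded_continuous; apply: (jordan_derivation_bounded hA ll llr).
- have [||K K0 hK] := @continuous_bilinear_bounded R A X X lact _ _ lc.
  + by move=> a; split=> *; rewrite !expand.
  + by move=> x; split=> *; rewrite !expand.
  have [||M M0 hM] := @continuous_bilinear_bounded R X A X ract _ _ rc.
  + by move=> a; split=> *; rewrite !expand.
  + by move=> x; split=> *; rewrite !expand.
  have nXP := @rnorm_norm R X.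
  exists (K + M) => [|a x]; first exact: addr_ge0.
  rewrite /L (nrmZ nXP) cabs_half; have := nrmD nXP (lact a x) (ract x a).
  have := hK a x; have := hM x a; rewrite (mulrC (rnorm x)) mulrDl.
  move: (nrm_ge0 nXP (lact a x + ract x a)) => {lDl lDr lZl lZr rDl rDr rZl rZr mDl mDr mZl mZr mulA expand}; lra.
- move=> a x; rewrite /L /jordan_product !(expand, llA, rrA, =^~ lrA).
  by lmod_eq (R[i]).
- move=> a b x; rewrite /L /jordan_product !(expand, llA, rrA, =^~ lrA).
  by lmod_eq (R[i]).
(* The square identity is polarized by comparing its instances at [a + b], [a] and [b]. *)
move=> a b; rewrite /L /jordan_product linearZ /= linearD /=.
have := Dder (a + b); have := Dder a; have := Dder b.
rewrite !expand !linearD /= !expand => hb ha; rewrite ha hb => hab.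
have e (u v x y : X) : u = v -> x + v = y + u -> x = y by move=> -> /addIr.
apply: (scalerI (a := 2 : R[i])); first by rewrite pnatr_eq0.
by apply: (e _ _ _ _ hab); lmod_eq (R[i]).
Qed.

Theorem theorem3 (R : realType) (A : completeNormedModType R[i])
    (mul : {bilinear A -> A -> A}) (star : A -> A)
    (hA : cstar_algebra mul star) :
  (forall (X : completeNormedModType R[i])
     (lact : {bilinear A -> X -> X}) (ract : {bilinear X -> A -> X}),
     banach_bimodule mul lact ract ->
     forall D : {linear A -> X},
       bimodule_jordan_derivation mul lact ract D -> continuous D)
  /\
  (forall (X : completeNormedModType R[i])
     (lact : {bilinear A -> X -> X}) (ract : {bilinear X -> A -> X}),
     jordan_banach_module (jordan_product mul) lact ract ->
     forall D : {linear A -> X},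
       jordan_derivation (jordan_product mul) lact ract D -> continuous D).
Proof.
split=> X lact ract hX; first exact: bimodule_derivation_continuous hA _ _ hX.
exact: jordan_module_derivation_continuous hA _ _ hX.
Qed.
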